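(* There is a positive integer $m_0$ such that for all integers $m$ and $n$ with $m>m_0$ and $\frac{1}{6}\binom{m}{2}+\frac{m}{3}+40 \leqslant n < \frac{1}{3}\binom{m}{2}$, we have \[Z_{2,2}(m,n) = \begin{cases} \left\lfloor\tfrac{1}{14}m(3m-4)+\tfrac{12}{7}n\right\rfloor & \text{if $m$ is even and $n > \left\lfloor\tfrac{1}{3}\binom{m}{2}-\frac{m}{4}\right\rfloor$,} \\[1.5mm] \left\lfloor\tfrac{1}{6}m(m-1)+2n\right\rfloor-1 & \text{if $m$ is odd and $n = \left\lfloor\tfrac{1}{3}\binom{m}{2}\right\rfloor-r$ for some $r \in S$,} \\[1.5mm] \left\lfloor\tfrac{1}{6}m(m-1)+2n\right\rfloor & \text{otherwise,} \end{cases} \] where $S=\{1,2,3,4\}$ if $m \equiv 1,3 \pmod{6}$ and $S=\{0,1,3\}$ if $m \equiv 5 \pmod{6}$.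
   Context: A hypergraph $H$ consists of a finite set $V(H)$ of vertices and a multiset $E(H)$ of edges, each edge being a nonempty subset of $V(H)$. The total degree of $H$ is $\sum_{E\in E(H)}|E|$. $H$ is linear if each pair of distinct vertices lies together in at most one edge (counted with multiplicity). For positive integers $m,n$, the Zarankiewicz number $Z_{2,2}(m,n)$ is the maximum total degree of a linear hypergraph with $m$ vertices and $n$ edges. *)

(* Defs.v *)
From mathcomp Require Import all_boot all_order all_algebra.

Set Implicit Arguments.
Unset Strict Implicit.
Unset Printing Implicit Defensive.

(* The multiset of edges is given by a list [E : seq {set V}] with arbitrary  *)
(* repetitions; every notion below depends on [E] only up to permutation.     *)
Section Hypergraph.
Variable V : finType.
Implicit Type E : seq {set V}.

Definition is_hypergraph E : bool := set0 \notin E.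

Definition total_degree E : nat := \sum_(e <- E) #|e|.

Definition linear_hypergraph E : bool :=
  [forall x : V, forall y : V,
    (x != y) ==> (count (fun e : {set V} => (x \in e) && (y \in e)) E <= 1)].

End Hypergraph.

(* The vertex set is taken to be ['I_m]; [Z22_ub] and [Z22_attained] show that *)
(* this is the maximum over hypergraphs on arbitrary m-element vertex sets.    *)
Definition Z22 (m n : nat) : nat :=
  \max_(E : n.-tuple {set 'I_m} | is_hypergraph E && linear_hypergraph E)
    total_degree E.

Lemma Z22_ub (m n : nat) (V : finType) (E : seq {set V}) :
  #|V| = m -> size E = n -> is_hypergraph E -> linear_hypergraph E ->
  total_degree E <= Z22 m n.
Proof.
move=> Vm En hE lE; subst m n.
pose f (e : {set V}) : {set 'I_#|V|} := enum_rank @: e.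
have -> : total_degree E = total_degree (map_tuple f (in_tuple E)).
  rewrite /total_degree /= big_map; apply: eq_bigr => e _.
  by rewrite card_imset //; exact: enum_rank_inj.
have mf x e : (x \in f e) = (enum_val x \in e).
  by rewrite -{1}(enum_valK x) mem_imset //; exact: enum_rank_inj.
apply: (leq_bigmax_cond (F := fun E : (size E).-tuple _ => total_degree E)).
apply/andP; split.
  apply: contra hE => /mapP [e eE /esym/eqP].
  by rewrite imset_eq0 => /eqP <-.
apply/forallP => x; apply/forallP => y; apply/implyP => xy.
have /forallP/(_ (enum_val x))/forallP/(_ (enum_val y))/implyP := lE.
rewrite (inj_eq enum_val_inj) => /(_ xy); rewrite count_map.
by congr (_ <= 1); apply: eq_count => e /=; rewrite !mf.
Qed.

Lemma Z22_attained (m n : nat) : 0 < m ->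
  exists E : seq {set 'I_m},
    [/\ size E = n, is_hypergraph E, linear_hypergraph E
      & total_degree E = Z22 m n].
Proof.
case: m => // m _.
pose P (E : n.-tuple {set 'I_m.+1}) := is_hypergraph E && linear_hypergraph E.
pose E0 : n.-tuple {set 'I_m.+1} := [tuple of nseq n [set ord0]].
have PE0 : P E0.
  apply/andP; split.
    rewrite /is_hypergraph mem_nseq negb_and; apply/orP; right.
    by apply/eqP => /setP/(_ ord0); rewrite !inE eqxx.
  apply/forallP => x; apply/forallP => y; apply/implyP => xy.
  rewrite count_nseq !inE; case: (x =P _) => [xe|_] /=; last by rewrite mul0n.
  by case: (y =P _) => [ye|_]; [rewrite xe ye eqxx in xy | rewrite mul0n].
have [|E /andP[hE lE] eE] := @eq_bigmax_cond _ P (fun E => total_degree E).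
  by apply/card_gt0P; exists E0.
by exists E; split=> //; rewrite size_tuple.
Qed.

(* The set S; it is only used for odd m, where m mod 6 is 1, 3 or 5. *)
Definition excS (m : nat) : seq nat :=
  if m %% 6 \in [:: 1; 3] then [:: 1; 2; 3; 4]
  else if m %% 6 == 5 then [:: 0; 1; 3]
  else [::].

(* Main.v *)
Require Import Defs.
From mathcomp Require Import all_boot all_order all_algebra zify lra.

Set Implicit Arguments.
Unset Strict Implicit.
Unset Printing Implicit Defensive.

(** Write C for the number of pairs of vertices.  Since (k - 3)(k - 4) >= 0, an edge of
size k satisfies 6 k <= k (k - 1) + 12, and summing gives 3 deg <= C + 6 n, with equality
exactly for decompositions of K_m into triangles and K4s.  When m is even each vertex lies
in an edge of even size or in an uncovered pair, and charging each vertex for that yields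
the other bound.  When m is odd the K4s of a decomposition meet all but at most two
vertices an even number of times, which is impossible for one to four K4s; this accounts
for the exceptional values.

Attaining the bounds amounts to decomposing K_m into prescribed numbers of K4s and
triangles, with a few single edges or one K5.  A pairwise balanced design with block
sizes 4, 5, 6 on about m / 12 points, obtained from truncated transversal designs over
Z/n with n coprime to 6, is inflated by weight 12, except for one point of weight u in a
hole of bounded size, and c points at infinity are added.  Every block can be replaced
by a group divisible design consisting of triangles or of K4s, independently of the
others, which moves the number of K4s through the whole range in bounded steps; the
steps are filled in by the choice of the designs on the groups, and the hole takes care
of m mod 12 and of the exact configuration at the lower end.  The designs
with the most K4s have fewer than 2 m / 3 + 80 triangles. *)

(** * Decompositions of multigraphs into cliques *)

(** The edge count of K_m fixes the number of triangles once the other blocks are counted, so only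
    the K4s have to be controlled. With t triangles and q K4s one has 3 t = 6 n - C, so the lower
    hypothesis on n says t >= 2 m / 3 + 80. This matches the construction: in the worst residues of
    m modulo 12 its designs richest in K4s still leave eight triangles per group of size 12, about 2
    m / 3 in all.

    Weight 12 is chosen because for 4, 5 and 6 groups of size 12 both kinds of group divisible
    designs exist. The parity of c is that of m, since u is even. In a design of K4s on three groups
    of size 12 and one of size u every K4 meets all four groups, which forces u = 12. Hence blocks
    through the special point must have size 5 or 6; they are lines that meet the truncated last
    group of a transversal design, and this is why the special point lies in a hole. Designs of K4s
    exist for u = 6; the weights 4 and 10, used for m = 5 and 11 modulo 12, come from truncation and
    cost triangles. *)

Definition pair_count (T : eqType) (B : seq (seq T)) (x y : T) : nat :=
  count (fun b => (x \in b) && (y \in b)) B.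

(** Diagonal values of [g] carry no meaning. Admitting arbitrary multiplicities makes decompositions
    additive under concatenation. *)
Definition isdec (T : eqType) (g : T -> T -> nat) (B : seq (seq T)) : Prop :=
  all uniq B /\ forall x y, x != y -> pair_count B x y = g x y.

Section Isdec.
Variable T : eqType.
Implicit Types (g : T -> T -> nat) (B : seq (seq T)).

Lemma isdec_ext g g' B :
  isdec g B -> (forall x y, x != y -> g x y = g' x y) -> isdec g' B.
Proof. by move=> [uB cB] gg'; split=> // x y xy; rewrite cB ?gg'. Qed.

Lemma isdec_cat g1 g2 B1 B2 :
  isdec g1 B1 -> isdec g2 B2 -> isdec (fun x y => g1 x y + g2 x y) (B1 ++ B2).
Proof.
move=> [u1 c1] [u2 c2]; split; first by rewrite all_cat u1.
by move=> x y xy; rewrite /pair_count count_cat [count _ B1]c1 // [count _ B2]c2.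
Qed.

Lemma isdec_flatten (I : eqType) (s : seq I) (G : I -> T -> T -> nat)
    (BB : I -> seq (seq T)) :
  (forall i, i \in s -> isdec (G i) (BB i)) ->
  isdec (fun x y => \sum_(i <- s) G i x y) (flatten [seq BB i | i <- s]).
Proof.
elim: s => [|i s IH] H /=.
  by split=> // x y _; rewrite big_nil.
apply: (isdec_ext (isdec_cat (H i _) (IH _))); rewrite ?mem_head //.
- by move=> j js; apply: H; rewrite inE js orbT.
- by move=> x y _; rewrite big_cons.
Qed.

(** A point of a block with a second point is an end of a covered pair. This confines a design to
    its point set, as transport along partial bijections demands. *)
Lemma isdec_supp g B (D : pred T) :
  isdec g B -> all (fun b => 1 < size b) B ->
  (forall x y, x != y -> 0 < g x y -> D x) ->
  all (all D) B.
Proof.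
move=> [uB cB] szB gD; apply/allP => b bB; apply/allP => x xb.
have ub := allP uB b bB; have sb := allP szB b bB.
have [y yb xy] : exists2 y, y \in b & x != y.
  case: b ub sb xb {bB} => [|a [|c b]] //= ub _ xb.
  have ac : a != c by move: ub; rewrite inE negb_or => /andP[/andP[]].
  have [->|xa] := eqVneq x a.
    by exists c; rewrite ?inE ?eqxx ?orbT.
  by exists a; rewrite ?inE ?eqxx.
apply: (gD x y) => //; rewrite -cB // -has_count.
by apply/hasP; exists b; rewrite ?xb.
Qed.

End Isdec.

Lemma isdec_map (T T' : eqType) (g : T -> T -> nat) (B : seq (seq T))
    (f : T -> T') (f' : T' -> T) (D : pred T) (D' : pred T') :
  isdec g B -> all (all D) B ->
  (forall x, D x -> D' (f x) /\ f' (f x) = x) ->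
  (forall y, D' y -> D (f' y) /\ f (f' y) = y) ->
  isdec (fun x y => (D' x && D' y) * g (f' x) (f' y)) [seq map f b | b <- B].
Proof.
move=> [uB cB] DB fD f'D.
have memf (b : seq T) y : b \in B -> (y \in map f b) = D' y && (f' y \in b).
  move=> bB; have Db := allP (allP DB b bB).
  apply/mapP/andP => [[x xb ->]|[Dy yb]].
    by have [Dx ->] := fD x (Db x xb).
  by exists (f' y) => //; have [_ ->] := f'D y Dy.
split.
  rewrite all_map; apply/allP => b bB /=.
  rewrite map_inj_in_uniq ?(allP uB) // => x y xb yb e.
  have Db := allP (allP DB b bB).
  by have [_ <-] := fD x (Db x xb); have [_ <-] := fD y (Db y yb); rewrite e.
move=> x y xy; rewrite /pair_count count_map.
rewrite (eq_in_count (a2 := fun b : seq T => D' x && D' y && ((f' x \in b) && (f' y \in b)))).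
  case Dxy: (D' x && D' y); last by rewrite mul0n /= count_pred0.
  have /andP[Dx Dy] := Dxy.
  rewrite mul1n -cB //; apply: contraNneq xy => e.
  by have [_ <-] := f'D x Dx; rewrite e; have [_ ->] := f'D y Dy.
by move=> b bB /=; rewrite !memf // andbACA.
Qed.

(** [realizes g t q p f]: the multigraph [g] splits into [t] triangles, [q]
copies of K4, [p] single edges and [f] copies of K5. *)
Definition profile (t q p f : nat) : seq nat :=
  nseq t 3 ++ nseq q 4 ++ nseq p 2 ++ nseq f 5.

Definition has_profile (T : Type) (B : seq (seq T)) (t q p f : nat) : bool :=
  perm_eq (map size B) (profile t q p f).

Definition realizes (T : eqType) (g : T -> T -> nat) (t q p f : nat) : Prop :=
  exists2 B, isdec g B & has_profile B t q p f.

Lemma profile_size2 (T : Type) (B : seq (seq T)) t q p f :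
  has_profile B t q p f -> all (fun b => 1 < size b) B.
Proof.
move=> /perm_all e; have := e (leq 2); rewrite all_map => ->.
by rewrite /profile !all_cat !all_nseq /= !orbT.
Qed.

Lemma profile_cat t1 q1 p1 f1 t2 q2 p2 f2 :
  perm_eq (profile t1 q1 p1 f1 ++ profile t2 q2 p2 f2)
          (profile (t1 + t2) (q1 + q2) (p1 + p2) (f1 + f2)).
Proof.
apply/permP => a; rewrite /profile !count_cat !count_nseq; lia.
Qed.

Section Realizes.
Variable T : eqType.
Implicit Types g : T -> T -> nat.

Lemma realizes_ext g g' t q p f :
  (forall x y, x != y -> g x y = g' x y) ->
  realizes g t q p f -> realizes g' t q p f.
Proof. by move=> e [B dB pB]; exists B => //; apply: isdec_ext dB e. Qed.

Lemma realizes0 : realizes (fun _ _ : T => 0) 0 0 0 0.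
Proof. by exists [::]. Qed.

Lemma realizesD g1 g2 t1 q1 p1 f1 t2 q2 p2 f2 :
  realizes g1 t1 q1 p1 f1 -> realizes g2 t2 q2 p2 f2 ->
  realizes (fun x y => g1 x y + g2 x y) (t1 + t2) (q1 + q2) (p1 + p2) (f1 + f2).
Proof.
move=> [B1 d1 s1] [B2 d2 s2]; exists (B1 ++ B2); first exact: isdec_cat.
by rewrite /has_profile map_cat (perm_trans (perm_cat s1 s2)) ?profile_cat.
Qed.

Lemma realizes_sum (I : eqType) (s : seq I) (G : I -> T -> T -> nat)
    (t q p f : I -> nat) :
  (forall i, i \in s -> realizes (G i) (t i) (q i) (p i) (f i)) ->
  realizes (fun x y => \sum_(i <- s) G i x y) (\sum_(i <- s) t i)
    (\sum_(i <- s) q i) (\sum_(i <- s) p i) (\sum_(i <- s) f i).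
Proof.
elim: s => [|i s IH] H.
  rewrite !big_nil; apply: realizes_ext realizes0 => x y _; by rewrite big_nil.
rewrite !big_cons; apply: realizes_ext; last first.
  apply: realizesD; first exact: H (mem_head _ _).
  by apply: IH => j js; apply: H; rewrite inE js orbT.
by move=> x y _; rewrite big_cons.
Qed.

End Realizes.

Lemma realizes_map (T T' : eqType) (g : T -> T -> nat) t q p k
    (f : T -> T') (f' : T' -> T) (D : pred T) (D' : pred T') :
  realizes g t q p k ->
  (forall x y, x != y -> 0 < g x y -> D x) ->
  (forall x, D x -> D' (f x) /\ f' (f x) = x) ->
  (forall y, D' y -> D (f' y) /\ f (f' y) = y) ->
  realizes (fun x y => (D' x && D' y) * g (f' x) (f' y)) t q p k.
Proof.
move=> [B dB pB] gD fD f'D; exists [seq map f b | b <- B].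
  by apply: isdec_map fD f'D => //; apply: isdec_supp gD => //; exact: profile_size2 pB.
by rewrite /has_profile -map_comp (eq_map (g := size)) // => b /=; rewrite size_map.
Qed.

(** * Verification of explicit designs *)

(** The blocks through [x] are extracted once for each [x], so that evaluation does not scan all
    blocks for every pair. *)
Definition pairs_ok (T : eqType) (pts : seq T) (g : rel T) (B : seq (seq T)) : bool :=
  all (fun x => let Bx := [seq b <- B | x \in b] in
    all (fun y => (x == y) || (count (fun b : seq T => y \in b) Bx == g x y)) pts) pts.

Definition design_ok (T : eqType) (pts : seq T) (g : rel T) (B : seq (seq T)) t q p f :=
  [&& all (fun b => uniq b && all (mem pts) b) B,
      [&& count (fun b => size b == 3) B == t, count (fun b => size b == 4) B == q,
          count (fun b => size b == 2) B == p, count (fun b => size b == 5) B == f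
        & size B == t + q + p + f]
    & pairs_ok pts g B].

Lemma realizes_check (T : eqType) (pts : seq T) (g : rel T) B t q p f :
  design_ok pts g B t q p f ->
  realizes (fun x y => (x \in pts) && (y \in pts) && g x y) t q p f.
Proof.
case/and3P=> uB /and5P[/eqP c3 /eqP c4 /eqP c2 /eqP c5 /eqP sB] pB; exists B.
  split; first by apply: sub_all uB => b /andP[].
  move=> x y xy; have memB b z : b \in B -> z \in b -> z \in pts.
    by move=> bB; move: (allP uB b bB) => /andP[_ /allP]; apply.
  case xp: (x \in pts); last first.
    rewrite /pair_count (eq_in_count (a2 := pred0)) ?count_pred0 // => b bB /=.
    by apply: contraFF xp => /andP[xb _]; apply: memB xb.
  case yp: (y \in pts); last first.
    rewrite /pair_count (eq_in_count (a2 := pred0)) ?count_pred0 // => b bB /=.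
    by apply: contraFF yp => /andP[_ yb]; apply: memB yb.
  move: (allP (allP pB x xp) y yp); rewrite (negbTE xy) /= count_filter => /eqP <-.
  by apply: eq_count => b /=; rewrite andbC.
(* The four counts add up to the number of blocks, which leaves none of another size. *)
have c0 : {in B, forall b : seq T, size b \in [:: 3; 4; 2; 5]}.
  have e : size B = count (fun b => size b == 3) B + count (fun b => size b == 4) B
      + count (fun b => size b == 2) B + count (fun b => size b == 5) B
      + count (fun b => size b \notin [:: 3; 4; 2; 5]) B.
    elim: (B) => //= b B' ->; rewrite !inE; case: (size b) => [|[|[|[|[|[|k]]]]]] /=; lia.
  have /eqP : count (fun b => size b \notin [:: 3; 4; 2; 5]) B = 0 by lia.
  rewrite -leqn0 leqNgt -has_count => /hasPn H b bB.
  by have := H b bB; rewrite negbK.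
apply/allP => k _ /=; rewrite /profile !count_cat !count_nseq !count_map.
have cn j : j \notin [:: 3; 4; 2; 5] -> count (preim size (pred1 j)) B = 0.
  move=> jn; apply/eqP; rewrite -leqn0 leqNgt -has_count; apply/hasPn => b bB /=.
  by apply: contra jn => /eqP <-; exact: c0.
have [kk|kk] := boolP (k \in [:: 3; 4; 2; 5]).
  by move: kk; rewrite !inE => /or4P[]/eqP-> /=; rewrite ?c3 ?c4 ?c2 ?c5; apply/eqP; lia.
rewrite cn //; move: kk; rewrite !inE !negb_or => /and4P[k3 k4 k2 k5].
by rewrite /= ![_ == k]eq_sym (negbTE k3) (negbTE k4) (negbTE k2) (negbTE k5).
Qed.

(** * Group divisible designs *)

(** Explicit designs are stored as flat lists of points and cut into blocks of constant size. *)
Definition chunk (T : Type) (k : nat) (s : seq T) : seq (seq T) :=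
  reshape (nseq (size s %/ k) k) s.

(* Points [x < M] form a cycle of length [M]; the remaining points are split into
   cycles of length [l].  A base block is developed by the shifts by the multiples
   of [s] below [M]. *)
Definition cyc_shift (M l k x : nat) : nat :=
  if x < M then (x + k) %% M
  else M + ((x - M) %/ l * l + (x - M + k) %% l).

Definition develop (M s l : nat) (base : seq (seq nat)) : seq (seq nat) :=
  [seq map (cyc_shift M l (s * k)) b | b <- base, k <- iota 0 (M %/ s)].

(* The cyclic point [x] is the [x %/ g]-th point of group [x %% g]; the points from
   [M] on form group [g]. *)
Definition gdd_point (M g x : nat) : nat * nat :=
  if x < M then (x %% g, x %/ g) else (g, x - M).

Definition gdd_blocks (M g s l r : nat) (base : seq nat) : seq (seq (nat * nat)) :=
  [seq map (gdd_point M g) b | b <- develop M s l (chunk r base)].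

Definition gdd_width (k u i : nat) : nat := if i < k.-1 then 12 else u.

Definition gdd_points (k u : nat) : seq (nat * nat) :=
  [seq (i, j) | i <- iota 0 k, j <- iota 0 (gdd_width k u i)].

Definition gdd_graph (k u : nat) (x y : nat * nat) : nat :=
  (x \in gdd_points k u) && (y \in gdd_points k u) && (x.1 != y.1).

Definition is_gdd (k u t q : nat) : Prop := realizes (gdd_graph k u) t q 0 0.

Lemma gdd_check k u t q B :
  design_ok (gdd_points k u) (fun x y => x.1 != y.1) B t q 0 0 -> is_gdd k u t q.
Proof. exact: realizes_check. Qed.

(* Deleting points turns some of the K4s into triangles. *)
Definition truncate (k u : nat) (B : seq (seq (nat * nat))) :=
  [seq [seq x <- b | x \in gdd_points k u] | b <- B].

(** * Explicit designs with k - 1 groups of size 12 and one of size u *)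

Definition gdd4_4_12 : seq (seq (nat * nat)) := gdd_blocks 36 3 6 1 4
    [:: 0; 1; 2; 36; 0; 4; 23; 38; 0; 7; 17; 41; 0; 10; 32; 43; 0; 13; 26; 44; 0; 16;
    11; 46; 0; 19; 5; 37; 0; 22; 20; 39; 0; 25; 14; 40; 0; 28; 35; 42; 0; 31; 29; 45;
    0; 34; 8; 47; 3; 1; 20; 38; 3; 4; 5; 36; 3; 7; 35; 43; 3; 10; 14; 41; 3; 13; 8; 46;
    3; 16; 29; 44; 3; 19; 23; 39; 3; 22; 2; 37; 3; 25; 32; 42; 3; 28; 17; 40; 3; 31;
    11; 47; 3; 34; 26; 45].

Definition gdd4_5_12 : seq (seq (nat * nat)) := gdd_blocks 60 5 2 3 4
    [:: 0; 4; 46; 53; 0; 12; 38; 51; 0; 1; 44; 47; 0; 9; 36; 57; 0; 11; 27; 28; 0; 2;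
    8; 31; 0; 19; 37; 41; 1; 3; 9; 37].

Definition gdd4_6_12 : seq (seq (nat * nat)) := gdd_blocks 72 6 1 3 4
    [:: 0; 8; 21; 55; 0; 2; 11; 33; 0; 1; 5; 45; 0; 14; 29; 49; 0; 3; 10; 56].

Definition gdd4_5_6 : seq (seq (nat * nat)) := gdd_blocks 48 4 2 3 4
    [:: 0; 1; 23; 42; 0; 15; 17; 30; 0; 3; 21; 38; 0; 5; 11; 14; 0; 2; 27; 49; 0; 9;
    43; 48; 0; 19; 26; 51; 0; 37; 47; 53].

Definition gdd4_6_6 : seq (seq (nat * nat)) := gdd_blocks 60 5 1 3 4
    [:: 0; 1; 29; 60; 0; 8; 22; 63; 0; 3; 12; 39; 0; 7; 23; 41; 0; 2; 6; 49].

Lemma gdd_4_12_3 : is_gdd 4 12 288 0.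
Proof. by apply: (gdd_check (B := gdd_blocks 48 4 1 2 3
    [:: 0; 1; 14; 0; 3; 25; 0; 2; 7; 0; 6; 15; 0; 10; 27; 0; 11; 29])); vm_compute. Qed.

Lemma gdd_5_12_3 : is_gdd 5 12 480 0.
Proof. by apply: (gdd_check (B := gdd_blocks 60 5 1 2 3
    [:: 0; 2; 18; 0; 3; 9; 0; 14; 33; 0; 11; 34; 0; 1; 13; 0; 4; 21; 0; 8; 32; 0; 7; 29])); vm_compute. Qed.

Lemma gdd_6_12_3 : is_gdd 6 12 720 0.
Proof. by apply: (gdd_check (B := gdd_blocks 72 6 1 2 3
    [:: 0; 2; 5; 0; 14; 40; 0; 19; 44; 0; 7; 15; 0; 4; 35; 0; 9; 38; 0; 10; 23; 0; 1;
    21; 0; 11; 27; 0; 17; 39])); vm_compute. Qed.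

Lemma gdd_4_12_4 : is_gdd 4 12 0 144.
Proof. by apply: (gdd_check (B := gdd4_4_12)); vm_compute. Qed.

Lemma gdd_5_12_4 : is_gdd 5 12 0 240.
Proof. by apply: (gdd_check (B := gdd4_5_12)); vm_compute. Qed.

Lemma gdd_6_12_4 : is_gdd 6 12 0 360.
Proof. by apply: (gdd_check (B := gdd4_6_12)); vm_compute. Qed.

Lemma gdd_5_6_3 : is_gdd 5 6 384 0.
Proof. by apply: (gdd_check (B := gdd_blocks 48 4 2 3 3
    [:: 0; 1; 11; 0; 2; 53; 0; 3; 34; 0; 5; 22; 0; 6; 25; 0; 7; 21; 0; 9; 10; 0; 13;
    35; 0; 15; 30; 0; 23; 29; 0; 27; 45; 0; 37; 48; 0; 39; 49; 0; 41; 50; 0; 43; 52; 1;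
    3; 53])); vm_compute. Qed.

Lemma gdd_6_6_3 : is_gdd 6 6 600 0.
Proof. by apply: (gdd_check (B := gdd_blocks 60 5 2 3 3
    [:: 0; 1; 52; 0; 2; 23; 0; 3; 14; 0; 4; 37; 0; 6; 19; 0; 7; 60; 0; 11; 29; 0; 12;
    53; 0; 16; 34; 0; 17; 62; 0; 22; 63; 0; 24; 51; 0; 28; 59; 0; 39; 61; 0; 43; 47; 0;
    57; 64; 1; 3; 15; 1; 7; 23; 1; 9; 33; 1; 27; 63])); vm_compute. Qed.

Lemma gdd_5_6_4 : is_gdd 5 6 0 192.
Proof. by apply: (gdd_check (B := gdd4_5_6)); vm_compute. Qed.

Lemma gdd_6_6_4 : is_gdd 6 6 0 300.
Proof. by apply: (gdd_check (B := gdd4_6_6)); vm_compute. Qed.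

Lemma gdd_5_4_3 : is_gdd 5 4 352 0.
Proof. by apply: (gdd_check (B := gdd_blocks 48 4 3 2 3
    [:: 0; 1; 6; 0; 17; 18; 0; 3; 34; 0; 21; 48; 0; 9; 22; 0; 10; 33; 0; 2; 7; 0; 5;
    14; 0; 35; 51; 0; 38; 41; 0; 26; 37; 0; 11; 29; 0; 19; 46; 0; 23; 50; 1; 16; 50; 1;
    14; 31; 1; 4; 10; 1; 11; 26; 1; 2; 8; 1; 23; 48; 1; 20; 47; 1; 35; 49])); vm_compute. Qed.

Lemma gdd_6_4_3 : is_gdd 6 4 560 0.
Proof. by apply: (gdd_check (B := gdd_blocks 60 5 3 2 3
    [:: 0; 6; 28; 0; 19; 36; 0; 17; 18; 0; 2; 51; 0; 4; 12; 0; 21; 53; 0; 3; 62; 0; 13;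
    27; 0; 1; 8; 0; 14; 47; 0; 7; 56; 0; 34; 60; 0; 31; 49; 0; 16; 37; 0; 23; 61; 0;
    26; 44; 0; 38; 41; 0; 29; 58; 1; 4; 13; 1; 7; 59; 1; 2; 25; 1; 20; 44; 1; 28; 62;
    1; 35; 47; 2; 23; 62; 1; 5; 14; 1; 17; 60; 1; 23; 29])); vm_compute. Qed.

Lemma gdd_5_10_3 : is_gdd 5 10 448 0.
Proof. by apply: (gdd_check (B := gdd_blocks 48 4 6 1 3
    [:: 0; 1; 42; 0; 2; 29; 0; 3; 14; 0; 5; 22; 0; 9; 19; 0; 10; 55; 0; 11; 18; 0; 13;
    34; 0; 15; 33; 0; 17; 27; 0; 21; 50; 0; 23; 46; 0; 25; 57; 0; 26; 48; 0; 31; 54; 0;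
    35; 53; 0; 37; 49; 0; 38; 51; 0; 39; 56; 0; 43; 45; 0; 47; 52; 1; 2; 16; 1; 4; 48;
    1; 7; 20; 1; 8; 53; 1; 10; 52; 1; 11; 55; 1; 15; 51; 1; 19; 44; 1; 23; 34; 1; 27;
    46; 1; 28; 50; 1; 32; 38; 1; 35; 40; 1; 47; 56; 2; 3; 20; 2; 4; 56; 2; 5; 11; 2; 9;
    52; 2; 15; 21; 2; 17; 54; 2; 23; 41; 2; 27; 57; 2; 28; 47; 2; 35; 50; 2; 40; 49; 2;
    45; 55; 3; 4; 5; 3; 10; 28; 3; 16; 54; 3; 17; 48; 3; 29; 49; 3; 34; 53; 3; 40; 46;
    4; 11; 57; 4; 17; 51])); vm_compute. Qed.

Lemma gdd_6_10_3 : is_gdd 6 10 680 0.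
Proof. by apply: (gdd_check (B := gdd_blocks 60 5 6 1 3
    [:: 0; 1; 43; 0; 2; 44; 0; 3; 54; 0; 4; 17; 0; 7; 11; 0; 8; 39; 0; 12; 33; 0; 13;
    62; 0; 14; 58; 0; 16; 67; 0; 18; 49; 0; 19; 66; 0; 22; 34; 0; 23; 36; 0; 26; 32; 0;
    27; 59; 0; 28; 64; 0; 29; 60; 0; 37; 63; 0; 38; 61; 0; 41; 65; 0; 46; 69; 0; 51;
    68; 0; 52; 53; 0; 56; 57; 1; 2; 15; 1; 3; 64; 1; 4; 47; 1; 7; 28; 1; 8; 25; 1; 9;
    13; 1; 10; 27; 1; 14; 23; 1; 17; 40; 1; 20; 32; 1; 29; 61; 1; 33; 67; 1; 34; 45; 1;
    35; 39; 1; 38; 65; 1; 50; 60; 1; 52; 58; 1; 53; 68; 1; 59; 69; 2; 4; 68; 2; 5; 67;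
    2; 9; 69; 2; 10; 62; 2; 16; 63; 2; 21; 28; 2; 23; 26; 2; 29; 45; 2; 34; 58; 2; 35;
    66; 2; 39; 40; 2; 41; 64; 2; 51; 53; 3; 9; 27; 3; 11; 62; 3; 15; 41; 3; 16; 65; 3;
    17; 63; 3; 22; 60; 3; 34; 66; 3; 40; 61; 4; 11; 22; 4; 23; 35; 5; 11; 29])); vm_compute. Qed.

(** A point of the last group lies in 48 / 3 = 16 of the K4s, and no K4 contains two points of a
    group. Deleting two points therefore leaves 32 triangles, eight for each group of size 12. The
    next three designs also arise by deleting two points. *)
Lemma gdd_5_4_4 : is_gdd 5 4 32 160.
Proof. by apply: (gdd_check (B := truncate 5 4 gdd4_5_6)); vm_compute. Qed.

Lemma gdd_5_10_4 : is_gdd 5 10 32 208.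
Proof. by apply: (gdd_check (B := truncate 5 10 gdd4_5_12)); vm_compute. Qed.

Lemma gdd_6_4_4 : is_gdd 6 4 40 260.
Proof. by apply: (gdd_check (B := truncate 6 4 gdd4_6_6)); vm_compute. Qed.

Lemma gdd_6_10_4 : is_gdd 6 10 40 320.
Proof. by apply: (gdd_check (B := truncate 6 10 gdd4_6_12)); vm_compute. Qed.

(** * Small designs *)

Definition complete_graph (n x y : nat) : nat := (x < n) && (y < n).

Definition is_full (n t q p f : nat) : Prop := realizes (complete_graph n) t q p f.

(** The twelve points of one group together with the [c] points at infinity. Pairs at infinity are
    common to all groups, so they are left to the hole. *)
Definition fill_graph (c x y : nat) : nat :=
  (x < 12 + c) && (y < 12 + c) && ((x < 12) || (y < 12)).

Definition is_fill (c t q p : nat) : Prop := realizes (fill_graph c) t q p 0.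

Definition blocks4235 (s4 s2 s3 s5 : seq nat) : seq (seq nat) :=
  chunk 4 s4 ++ chunk 2 s2 ++ chunk 3 s3 ++ chunk 5 s5.

Lemma full_check n t q p f s4 s2 s3 s5 :
  design_ok (iota 0 n) (fun _ _ => true) (blocks4235 s4 s2 s3 s5) t q p f ->
  is_full n t q p f.
Proof.
move=> /realizes_check; apply: realizes_ext => x y _.
by rewrite !mem_iota !add0n /complete_graph andbT.
Qed.

Lemma fill_check c t q p s4 s2 s3 :
  design_ok (iota 0 (12 + c)) (fun x y => (x < 12) || (y < 12))
    (blocks4235 s4 s2 s3 [::]) t q p 0 ->
  is_fill c t q p.
Proof.
move=> /realizes_check; apply: realizes_ext => x y _.
by rewrite !mem_iota !add0n.
Qed.

(** * Decompositions of K_(12+c) minus K_c, named by c and the numbers of K4s and pairs *)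

Lemma fill_0_0_6 : is_fill 0 20 0 6.
Proof.
apply: (@fill_check _ _ _ _
    [::]
    [:: 5; 6; 0; 9; 4; 7; 3; 10; 2; 11; 1; 8]
    [:: 0; 1; 5; 0; 2; 8; 0; 3; 6; 0; 4; 10; 0; 7; 11; 1; 2; 6; 1; 3; 9; 1; 4; 11; 1;
    7; 10; 2; 3; 4; 2; 5; 10; 2; 7; 9; 3; 5; 7; 3; 8; 11; 4; 5; 8; 4; 6; 9; 5; 9; 11;
    6; 7; 8; 6; 10; 11; 8; 9; 10]).
by vm_compute.
Qed.

Lemma fill_0_3_0 : is_fill 0 16 3 0.
Proof.
apply: (@fill_check _ _ _ _
    [:: 0; 5; 6; 8; 1; 4; 7; 11; 2; 3; 9; 10]
    [::]
    [:: 0; 1; 3; 0; 2; 11; 0; 4; 9; 0; 7; 10; 1; 2; 6; 1; 5; 9; 1; 8; 10; 2; 4; 8; 2;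
    5; 7; 3; 4; 5; 3; 6; 7; 3; 8; 11; 4; 6; 10; 5; 10; 11; 6; 9; 11; 7; 8; 9]).
by vm_compute.
Qed.

(** The projective plane of order 3 less a point: the four triangles partition the points and are
    the lines through the deleted point. *)
Lemma fill_0_9_0 : is_fill 0 4 9 0.
Proof.
apply: (@fill_check _ _ _ _
    [:: 2; 4; 5; 8; 0; 4; 6; 10; 1; 4; 7; 11; 3; 5; 7; 10; 0; 7; 8; 9; 2; 9; 10; 11; 3;
    6; 8; 11; 0; 1; 2; 3; 1; 5; 6; 9]
    [::]
    [:: 0; 5; 11; 1; 8; 10; 2; 6; 7; 3; 4; 9]).
by vm_compute.
Qed.

Lemma fill_1_0_0 : is_fill 1 26 0 0.
Proof.
apply: (@fill_check _ _ _ _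
    [::]
    [::]
    [:: 0; 1; 5; 0; 2; 6; 0; 3; 9; 0; 4; 12; 0; 7; 10; 0; 8; 11; 1; 2; 3; 1; 4; 7; 1;
    6; 12; 1; 8; 9; 1; 10; 11; 2; 4; 8; 2; 5; 10; 2; 7; 9; 2; 11; 12; 3; 4; 5; 3; 6;
    11; 3; 7; 12; 3; 8; 10; 4; 6; 10; 4; 9; 11; 5; 6; 9; 5; 7; 11; 5; 8; 12; 6; 7; 8;
    9; 10; 12]).
by vm_compute.
Qed.

Lemma fill_1_6_0 : is_fill 1 14 6 0.
Proof.
apply: (@fill_check _ _ _ _
    [:: 0; 2; 5; 7; 3; 7; 9; 10; 4; 5; 9; 12; 0; 1; 3; 8; 2; 4; 6; 8; 1; 6; 10; 12]
    [::]
    [:: 0; 4; 10; 0; 6; 9; 0; 11; 12; 1; 2; 9; 1; 4; 7; 1; 5; 11; 2; 3; 12; 2; 10; 11;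
    3; 4; 11; 3; 5; 6; 5; 8; 10; 6; 7; 11; 7; 8; 12; 8; 9; 11]).
by vm_compute.
Qed.

Lemma fill_1_7_0 : is_fill 1 12 7 0.
Proof.
apply: (@fill_check _ _ _ _
    [:: 2; 5; 9; 10; 0; 1; 8; 9; 0; 3; 10; 11; 2; 4; 7; 11; 3; 5; 6; 12; 7; 8; 10; 12;
    1; 4; 6; 10]
    [::]
    [:: 0; 2; 6; 0; 4; 12; 0; 5; 7; 1; 2; 12; 1; 3; 7; 1; 5; 11; 2; 3; 8; 3; 4; 9; 4;
    5; 8; 6; 7; 9; 6; 8; 11; 9; 11; 12]).
by vm_compute.
Qed.

(** The projective plane of order 3, developed from the difference set {0, 1, 3, 9} modulo 13. *)
Lemma fill_1_13_0 : is_fill 1 0 13 0.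
Proof.
apply: (@fill_check _ _ _ _
    [:: 0; 1; 3; 9; 1; 2; 4; 10; 2; 3; 5; 11; 3; 4; 6; 12; 0; 4; 5; 7; 1; 5; 6; 8; 2;
    6; 7; 9; 3; 7; 8; 10; 4; 8; 9; 11; 5; 9; 10; 12; 0; 6; 10; 11; 1; 7; 11; 12; 0; 2;
    8; 12]
    [::]
    [::]).
by vm_compute.
Qed.

Lemma fill_2_0_6 : is_fill 2 28 0 6.
Proof.
apply: (@fill_check _ _ _ _
    [::]
    [:: 3; 7; 0; 8; 4; 11; 2; 6; 5; 9; 1; 10]
    [:: 0; 1; 9; 0; 2; 11; 0; 3; 13; 0; 4; 6; 0; 5; 7; 0; 10; 12; 1; 2; 7; 1; 3; 12; 1;
    4; 13; 1; 5; 11; 1; 6; 8; 2; 3; 4; 2; 5; 13; 2; 8; 12; 2; 9; 10; 3; 5; 8; 3; 6; 9;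
    3; 10; 11; 4; 5; 12; 4; 7; 10; 4; 8; 9; 5; 6; 10; 6; 7; 13; 6; 11; 12; 7; 8; 11; 7;
    9; 12; 8; 10; 13; 9; 11; 13]).
by vm_compute.
Qed.

Lemma fill_2_3_0 : is_fill 2 24 3 0.
Proof.
apply: (@fill_check _ _ _ _
    [:: 0; 2; 4; 11; 1; 6; 7; 8; 3; 5; 9; 10]
    [::]
    [:: 0; 1; 5; 0; 3; 13; 0; 6; 10; 0; 7; 9; 0; 8; 12; 1; 2; 10; 1; 3; 11; 1; 4; 12;
    1; 9; 13; 2; 3; 8; 2; 5; 7; 2; 6; 13; 2; 9; 12; 3; 4; 7; 3; 6; 12; 4; 5; 6; 4; 8;
    9; 4; 10; 13; 5; 8; 13; 5; 11; 12; 6; 9; 11; 7; 10; 12; 7; 11; 13; 8; 10; 11]).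
by vm_compute.
Qed.

Lemma fill_2_4_0 : is_fill 2 22 4 0.
Proof.
apply: (@fill_check _ _ _ _
    [:: 0; 1; 4; 13; 5; 6; 9; 13; 3; 7; 8; 13; 2; 10; 11; 13]
    [::]
    [:: 0; 2; 3; 0; 5; 10; 0; 6; 7; 0; 8; 9; 0; 11; 12; 1; 2; 8; 1; 3; 6; 1; 5; 11; 1;
    7; 10; 1; 9; 12; 2; 4; 9; 2; 5; 7; 2; 6; 12; 3; 4; 11; 3; 5; 12; 3; 9; 10; 4; 5; 8;
    4; 6; 10; 4; 7; 12; 6; 8; 11; 7; 9; 11; 8; 10; 12]).
by vm_compute.
Qed.

Lemma fill_2_6_0 : is_fill 2 18 6 0.
Proof.
apply: (@fill_check _ _ _ _
    [:: 2; 7; 8; 12; 1; 5; 6; 7; 2; 5; 10; 13; 3; 5; 11; 12; 0; 3; 7; 13; 2; 3; 4; 9]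
    [::]
    [:: 0; 1; 4; 0; 2; 6; 0; 5; 9; 0; 8; 11; 0; 10; 12; 1; 2; 11; 1; 3; 10; 1; 8; 13;
    1; 9; 12; 3; 6; 8; 4; 5; 8; 4; 6; 12; 4; 7; 10; 4; 11; 13; 6; 9; 13; 6; 10; 11; 7;
    9; 11; 8; 9; 10]).
by vm_compute.
Qed.

Lemma fill_2_10_0 : is_fill 2 10 10 0.
Proof.
apply: (@fill_check _ _ _ _
    [:: 1; 6; 8; 10; 0; 4; 9; 11; 2; 3; 6; 9; 0; 5; 7; 8; 1; 3; 5; 11; 4; 5; 6; 12; 2;
    8; 11; 12; 2; 4; 7; 10; 1; 7; 9; 12; 0; 3; 10; 12]
    [::]
    [:: 0; 1; 2; 0; 6; 13; 1; 4; 13; 2; 5; 13; 3; 4; 8; 3; 7; 13; 5; 9; 10; 6; 7; 11;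
    8; 9; 13; 10; 11; 13]).
by vm_compute.
Qed.

Lemma fill_2_11_0 : is_fill 2 8 11 0.
Proof.
apply: (@fill_check _ _ _ _
    [:: 0; 4; 8; 12; 1; 5; 9; 13; 2; 7; 8; 13; 3; 6; 9; 12; 0; 6; 11; 13; 1; 7; 10; 12;
    2; 5; 11; 12; 3; 4; 10; 13; 0; 1; 2; 3; 4; 5; 6; 7; 8; 9; 10; 11]
    [::]
    [:: 2; 6; 10; 3; 7; 11; 0; 5; 10; 1; 4; 11; 2; 4; 9; 3; 5; 8; 0; 7; 9; 1; 6; 8]).
by vm_compute.
Qed.

Lemma fill_3_0_0 : is_fill 3 34 0 0.
Proof.
apply: (@fill_check _ _ _ _
    [::]
    [::]
    [:: 0; 1; 14; 0; 2; 9; 0; 3; 13; 0; 4; 6; 0; 5; 12; 0; 7; 10; 0; 8; 11; 1; 2; 12;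
    1; 3; 4; 1; 5; 6; 1; 7; 11; 1; 8; 9; 1; 10; 13; 2; 3; 8; 2; 4; 13; 2; 5; 7; 2; 6;
    10; 2; 11; 14; 3; 5; 11; 3; 6; 14; 3; 7; 12; 3; 9; 10; 4; 5; 10; 4; 7; 14; 4; 8;
    12; 4; 9; 11; 5; 8; 13; 5; 9; 14; 6; 7; 8; 6; 9; 12; 6; 11; 13; 7; 9; 13; 8; 10;
    14; 10; 11; 12]).
by vm_compute.
Qed.

Lemma fill_3_5_0 : is_fill 3 24 5 0.
Proof.
apply: (@fill_check _ _ _ _
    [:: 0; 2; 5; 8; 2; 3; 7; 11; 3; 4; 8; 12; 0; 1; 7; 12; 1; 4; 5; 11]
    [::]
    [:: 0; 3; 14; 0; 4; 9; 0; 6; 13; 0; 10; 11; 1; 2; 6; 1; 3; 13; 1; 8; 9; 1; 10; 14;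
    2; 4; 13; 2; 9; 14; 2; 10; 12; 3; 5; 10; 3; 6; 9; 4; 6; 10; 4; 7; 14; 5; 6; 14; 5;
    7; 13; 5; 9; 12; 6; 7; 8; 6; 11; 12; 7; 9; 10; 8; 10; 13; 8; 11; 14; 9; 11; 13]).
by vm_compute.
Qed.

Lemma fill_3_6_0 : is_fill 3 22 6 0.
Proof.
apply: (@fill_check _ _ _ _
    [:: 3; 4; 8; 11; 1; 5; 8; 10; 7; 9; 11; 13; 0; 2; 5; 7; 2; 3; 9; 10; 0; 1; 4; 13]
    [::]
    [:: 0; 3; 14; 0; 6; 8; 0; 9; 12; 0; 10; 11; 1; 2; 12; 1; 3; 7; 1; 6; 9; 1; 11; 14;
    2; 4; 14; 2; 6; 11; 2; 8; 13; 3; 5; 13; 3; 6; 12; 4; 5; 9; 4; 6; 7; 4; 10; 12; 5;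
    6; 14; 5; 11; 12; 6; 10; 13; 7; 8; 12; 7; 10; 14; 8; 9; 14]).
by vm_compute.
Qed.

Lemma fill_3_7_0 : is_fill 3 20 7 0.
Proof.
apply: (@fill_check _ _ _ _
    [:: 3; 5; 7; 11; 4; 8; 10; 11; 1; 3; 9; 12; 0; 7; 10; 12; 1; 4; 7; 13; 0; 5; 6; 13;
    6; 7; 8; 9]
    [::]
    [:: 0; 1; 8; 0; 2; 9; 0; 3; 4; 0; 11; 14; 1; 2; 10; 1; 5; 14; 1; 6; 11; 2; 3; 6; 2;
    4; 5; 2; 7; 14; 2; 8; 13; 2; 11; 12; 3; 8; 14; 3; 10; 13; 4; 6; 12; 4; 9; 14; 5; 8;
    12; 5; 9; 10; 6; 10; 14; 9; 11; 13]).
by vm_compute.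
Qed.

Lemma fill_3_15_0 : is_fill 3 4 15 0.
Proof.
apply: (@fill_check _ _ _ _
    [:: 0; 4; 8; 12; 1; 5; 9; 13; 2; 6; 10; 14; 1; 4; 11; 14; 2; 7; 8; 13; 3; 6; 9; 12;
    0; 6; 11; 13; 1; 7; 10; 12; 3; 5; 8; 14; 0; 7; 9; 14; 2; 5; 11; 12; 3; 4; 10; 13;
    0; 1; 2; 3; 4; 5; 6; 7; 8; 9; 10; 11]
    [::]
    [:: 3; 7; 11; 0; 5; 10; 2; 4; 9; 1; 6; 8]).
by vm_compute.
Qed.

Lemma fill_4_0_6 : is_fill 4 36 0 6.
Proof.
apply: (@fill_check _ _ _ _
    [::]
    [:: 2; 7; 4; 8; 5; 11; 0; 9; 6; 10; 1; 3]
    [:: 0; 1; 11; 0; 2; 14; 0; 3; 8; 0; 4; 6; 0; 5; 15; 0; 7; 13; 0; 10; 12; 1; 2; 6;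
    1; 4; 12; 1; 5; 10; 1; 7; 15; 1; 8; 13; 1; 9; 14; 2; 3; 9; 2; 4; 5; 2; 8; 12; 2;
    10; 15; 2; 11; 13; 3; 4; 15; 3; 5; 13; 3; 6; 14; 3; 7; 12; 3; 10; 11; 4; 7; 9; 4;
    10; 13; 4; 11; 14; 5; 6; 7; 5; 8; 14; 5; 9; 12; 6; 8; 15; 6; 9; 13; 6; 11; 12; 7;
    8; 11; 7; 10; 14; 8; 9; 10; 9; 11; 15]).
by vm_compute.
Qed.

Lemma fill_4_3_0 : is_fill 4 32 3 0.
Proof.
apply: (@fill_check _ _ _ _
    [:: 0; 5; 7; 8; 1; 6; 9; 10; 2; 3; 4; 11]
    [::]
    [:: 0; 1; 13; 0; 2; 9; 0; 3; 10; 0; 4; 14; 0; 6; 12; 0; 11; 15; 1; 2; 8; 1; 3; 14;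
    1; 4; 12; 1; 5; 15; 1; 7; 11; 2; 5; 14; 2; 6; 15; 2; 7; 13; 2; 10; 12; 3; 5; 12; 3;
    6; 7; 3; 8; 13; 3; 9; 15; 4; 5; 10; 4; 6; 8; 4; 7; 15; 4; 9; 13; 5; 6; 13; 5; 9;
    11; 6; 11; 14; 7; 9; 12; 7; 10; 14; 8; 9; 14; 8; 10; 15; 8; 11; 12; 10; 11; 13]).
by vm_compute.
Qed.

Lemma fill_4_4_0 : is_fill 4 30 4 0.
Proof.
apply: (@fill_check _ _ _ _
    [:: 2; 4; 7; 8; 1; 3; 6; 8; 0; 9; 10; 12; 5; 8; 11; 12]
    [::]
    [:: 0; 1; 7; 0; 2; 5; 0; 3; 14; 0; 4; 15; 0; 6; 11; 0; 8; 13; 1; 2; 9; 1; 4; 12; 1;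
    5; 15; 1; 10; 14; 1; 11; 13; 2; 3; 12; 2; 6; 15; 2; 10; 13; 2; 11; 14; 3; 4; 10; 3;
    5; 9; 3; 7; 13; 3; 11; 15; 4; 5; 13; 4; 6; 14; 4; 9; 11; 5; 6; 10; 5; 7; 14; 6; 7;
    12; 6; 9; 13; 7; 9; 15; 7; 10; 11; 8; 9; 14; 8; 10; 15]).
by vm_compute.
Qed.

(** The affine plane of order 4 without one line, whose points are those at infinity. Deleting one
    or two points of that line gives [fill_3_15_0] and [fill_2_11_0], whose triangles are the
    shortened lines. *)
Lemma fill_4_19_0 : is_fill 4 0 19 0.
Proof.
apply: (@fill_check _ _ _ _
    [:: 0; 4; 8; 12; 1; 5; 9; 13; 2; 6; 10; 14; 3; 7; 11; 15; 0; 5; 10; 15; 1; 4; 11;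
    14; 2; 7; 8; 13; 3; 6; 9; 12; 0; 6; 11; 13; 1; 7; 10; 12; 2; 4; 9; 15; 3; 5; 8; 14;
    0; 7; 9; 14; 1; 6; 8; 15; 2; 5; 11; 12; 3; 4; 10; 13; 0; 1; 2; 3; 4; 5; 6; 7; 8; 9;
    10; 11]
    [::]
    [::]).
by vm_compute.
Qed.

(** * Decompositions of K_n for the hole, named by n and the numbers of K4s, pairs and K5s *)

Lemma full_10_1_3_0 : is_full 10 12 1 3 0.
Proof.
apply: (@full_check _ _ _ _ _
    [:: 0; 4; 6; 8]
    [:: 1; 7; 2; 5; 3; 9]
    [:: 0; 1; 3; 0; 2; 9; 0; 5; 7; 1; 2; 8; 1; 4; 9; 1; 5; 6; 2; 3; 6; 2; 4; 7; 3; 4;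
    5; 3; 7; 8; 5; 8; 9; 6; 7; 9]
    [::]).
by vm_compute.
Qed.

Lemma full_10_3_0_0 : is_full 10 9 3 0 0.
Proof.
apply: (@full_check _ _ _ _ _
    [:: 0; 1; 6; 7; 1; 5; 8; 9; 1; 2; 3; 4]
    [::]
    [:: 0; 2; 9; 0; 3; 8; 0; 4; 5; 2; 5; 7; 2; 6; 8; 3; 5; 6; 3; 7; 9; 4; 6; 9; 4; 7; 8]
    [::]).
by vm_compute.
Qed.

Lemma full_14_2_4_0 : is_full 14 25 2 4 0.
Proof.
apply: (@full_check _ _ _ _ _
    [:: 1; 5; 6; 11; 1; 3; 8; 10]
    [:: 0; 12; 2; 13; 1; 9; 4; 7]
    [:: 0; 1; 2; 0; 3; 6; 0; 4; 8; 0; 5; 10; 0; 7; 9; 0; 11; 13; 1; 4; 12; 1; 7; 13; 2;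
    3; 4; 2; 5; 12; 2; 6; 8; 2; 7; 11; 2; 9; 10; 3; 5; 13; 3; 7; 12; 3; 9; 11; 4; 5; 9;
    4; 6; 13; 4; 10; 11; 5; 7; 8; 6; 7; 10; 6; 9; 12; 8; 9; 13; 8; 11; 12; 10; 12; 13]
    [::]).
by vm_compute.
Qed.

Lemma full_14_3_1_0 : is_full 14 24 3 1 0.
Proof.
apply: (@full_check _ _ _ _ _
    [:: 4; 5; 6; 9; 0; 1; 3; 13; 2; 7; 11; 12]
    [:: 8; 10]
    [:: 0; 2; 10; 0; 4; 12; 0; 5; 8; 0; 6; 7; 0; 9; 11; 1; 2; 6; 1; 4; 10; 1; 5; 11; 1;
    7; 8; 1; 9; 12; 2; 3; 4; 2; 5; 13; 2; 8; 9; 3; 5; 12; 3; 6; 8; 3; 7; 9; 3; 10; 11;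
    4; 7; 13; 4; 8; 11; 5; 7; 10; 6; 10; 12; 6; 11; 13; 8; 12; 13; 9; 10; 13]
    [::]).
by vm_compute.
Qed.

Lemma full_16_3_3_0 : is_full 16 33 3 3 0.
Proof.
apply: (@full_check _ _ _ _ _
    [:: 1; 2; 12; 15; 7; 9; 10; 14; 0; 4; 6; 8]
    [:: 0; 13; 3; 5; 0; 11]
    [:: 0; 1; 7; 0; 2; 9; 0; 3; 12; 0; 5; 14; 0; 10; 15; 1; 3; 10; 1; 4; 5; 1; 6; 11;
    1; 8; 9; 1; 13; 14; 2; 3; 6; 2; 4; 7; 2; 5; 13; 2; 8; 14; 2; 10; 11; 3; 4; 9; 3; 7;
    8; 3; 11; 14; 3; 13; 15; 4; 10; 13; 4; 11; 12; 4; 14; 15; 5; 6; 10; 5; 7; 12; 5; 8;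
    15; 5; 9; 11; 6; 7; 13; 6; 9; 15; 6; 12; 14; 7; 11; 15; 8; 10; 12; 8; 11; 13; 9;
    12; 13]
    [::]).
by vm_compute.
Qed.

Lemma full_16_4_0_0 : is_full 16 32 4 0 0.
Proof.
apply: (@full_check _ _ _ _ _
    [:: 3; 7; 9; 13; 1; 2; 5; 14; 0; 6; 10; 11; 4; 8; 12; 15]
    [::]
    [:: 0; 1; 3; 0; 2; 7; 0; 4; 13; 0; 5; 15; 0; 8; 9; 0; 12; 14; 1; 4; 10; 1; 6; 7; 1;
    8; 13; 1; 9; 12; 1; 11; 15; 2; 3; 4; 2; 6; 8; 2; 9; 15; 2; 10; 12; 2; 11; 13; 3; 5;
    12; 3; 6; 15; 3; 8; 10; 3; 11; 14; 4; 5; 7; 4; 6; 14; 4; 9; 11; 5; 6; 9; 5; 8; 11;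
    5; 10; 13; 6; 12; 13; 7; 8; 14; 7; 10; 15; 7; 11; 12; 9; 10; 14; 13; 14; 15]
    [::]).
by vm_compute.
Qed.

Lemma full_17_0_0_1 : is_full 17 42 0 0 1.
Proof.
apply: (@full_check _ _ _ _ _
    [::]
    [::]
    [:: 0; 1; 15; 0; 2; 14; 0; 3; 12; 0; 4; 16; 0; 5; 11; 0; 6; 8; 0; 7; 10; 0; 9; 13;
    1; 2; 4; 1; 3; 8; 1; 5; 14; 1; 6; 13; 1; 7; 9; 1; 10; 16; 1; 11; 12; 2; 3; 13; 2;
    5; 8; 2; 6; 7; 2; 9; 16; 2; 10; 12; 2; 11; 15; 3; 4; 10; 3; 5; 9; 3; 6; 14; 3; 7;
    15; 3; 11; 16; 4; 5; 13; 4; 6; 12; 4; 7; 14; 4; 8; 15; 4; 9; 11; 5; 6; 16; 5; 7;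
    12; 5; 10; 15; 6; 9; 15; 6; 10; 11; 7; 8; 16; 7; 11; 13; 8; 9; 12; 8; 10; 13; 8;
    11; 14; 9; 10; 14]
    [:: 12; 13; 14; 15; 16]).
by vm_compute.
Qed.

(** The K5 of [full_17_0_0_1] is split into two triangles with a common point and a 4-cycle of
    pairs; [full_23_0_4_0] arises likewise from [full_23_0_0_1]. *)
Lemma full_17_0_4_0 : is_full 17 44 0 4 0.
Proof.
apply: (@full_check _ _ _ _ _
    [::]
    [:: 13; 15; 13; 16; 14; 15; 14; 16]
    [:: 0; 1; 15; 0; 2; 14; 0; 3; 12; 0; 4; 16; 0; 5; 11; 0; 6; 8; 0; 7; 10; 0; 9; 13;
    1; 2; 4; 1; 3; 8; 1; 5; 14; 1; 6; 13; 1; 7; 9; 1; 10; 16; 1; 11; 12; 2; 3; 13; 2;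
    5; 8; 2; 6; 7; 2; 9; 16; 2; 10; 12; 2; 11; 15; 3; 4; 10; 3; 5; 9; 3; 6; 14; 3; 7;
    15; 3; 11; 16; 4; 5; 13; 4; 6; 12; 4; 7; 14; 4; 8; 15; 4; 9; 11; 5; 6; 16; 5; 7;
    12; 5; 10; 15; 6; 9; 15; 6; 10; 11; 7; 8; 16; 7; 11; 13; 8; 9; 12; 8; 10; 13; 8;
    11; 14; 9; 10; 14; 12; 13; 14; 12; 15; 16]
    [::]).
by vm_compute.
Qed.

Lemma full_17_5_1_0 : is_full 17 35 5 1 0.
Proof.
apply: (@full_check _ _ _ _ _
    [:: 2; 3; 11; 16; 3; 8; 13; 14; 0; 7; 11; 14; 0; 13; 15; 16; 2; 7; 8; 9]
    [:: 9; 15]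
    [:: 0; 1; 4; 0; 2; 12; 0; 3; 9; 0; 5; 10; 0; 6; 8; 1; 2; 15; 1; 3; 6; 1; 5; 14; 1;
    7; 16; 1; 8; 11; 1; 9; 12; 1; 10; 13; 2; 4; 14; 2; 5; 13; 2; 6; 10; 3; 4; 7; 3; 5;
    15; 3; 10; 12; 4; 5; 16; 4; 6; 12; 4; 8; 15; 4; 9; 13; 4; 10; 11; 5; 6; 7; 5; 8;
    12; 5; 9; 11; 6; 9; 16; 6; 11; 13; 6; 14; 15; 7; 10; 15; 7; 12; 13; 8; 10; 16; 9;
    10; 14; 11; 12; 15; 12; 14; 16]
    [::]).
by vm_compute.
Qed.

Lemma full_17_6_1_0 : is_full 17 33 6 1 0.
Proof.
apply: (@full_check _ _ _ _ _
    [:: 2; 6; 11; 14; 4; 8; 11; 15; 5; 6; 7; 16; 0; 4; 12; 13; 0; 5; 14; 15; 2; 7; 8;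
    12]
    [:: 13; 16]
    [:: 0; 1; 2; 0; 3; 8; 0; 6; 10; 0; 7; 11; 0; 9; 16; 1; 3; 10; 1; 4; 5; 1; 6; 12; 1;
    7; 15; 1; 8; 16; 1; 9; 11; 1; 13; 14; 2; 3; 4; 2; 5; 10; 2; 9; 13; 2; 15; 16; 3; 5;
    12; 3; 6; 15; 3; 7; 13; 3; 9; 14; 3; 11; 16; 4; 6; 9; 4; 7; 14; 4; 10; 16; 5; 8; 9;
    5; 11; 13; 6; 8; 13; 7; 9; 10; 8; 10; 14; 9; 12; 15; 10; 11; 12; 10; 13; 15; 12;
    14; 16]
    [::]).
by vm_compute.
Qed.

Lemma full_17_7_1_0 : is_full 17 31 7 1 0.
Proof.
apply: (@full_check _ _ _ _ _
    [:: 0; 6; 15; 16; 1; 10; 11; 16; 2; 5; 10; 15; 4; 6; 9; 12; 2; 8; 9; 13; 0; 1; 4;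
    5; 8; 11; 12; 14]
    [:: 13; 14]
    [:: 0; 2; 11; 0; 3; 8; 0; 7; 13; 0; 9; 14; 0; 10; 12; 1; 2; 12; 1; 3; 14; 1; 6; 13;
    1; 7; 8; 1; 9; 15; 2; 3; 4; 2; 6; 7; 2; 14; 16; 3; 5; 7; 3; 6; 11; 3; 9; 16; 3; 10;
    13; 3; 12; 15; 4; 7; 11; 4; 8; 15; 4; 10; 14; 4; 13; 16; 5; 6; 14; 5; 8; 16; 5; 9;
    11; 5; 12; 13; 6; 8; 10; 7; 9; 10; 7; 12; 16; 7; 14; 15; 11; 13; 15]
    [::]).
by vm_compute.
Qed.

Lemma full_17_8_1_0 : is_full 17 29 8 1 0.
Proof.
apply: (@full_check _ _ _ _ _
    [:: 1; 5; 11; 16; 0; 2; 3; 16; 0; 1; 8; 10; 0; 4; 6; 11; 6; 10; 12; 14; 2; 5; 7; 9;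
    3; 4; 9; 15; 0; 7; 14; 15]
    [:: 8; 12]
    [:: 0; 5; 13; 0; 9; 12; 1; 2; 12; 1; 3; 14; 1; 4; 7; 1; 6; 9; 1; 13; 15; 2; 4; 14;
    2; 6; 13; 2; 8; 15; 2; 10; 11; 3; 5; 6; 3; 7; 10; 3; 8; 11; 3; 12; 13; 4; 5; 12; 4;
    8; 16; 4; 10; 13; 5; 8; 14; 5; 10; 15; 6; 7; 8; 6; 15; 16; 7; 11; 13; 7; 12; 16; 8;
    9; 13; 9; 10; 16; 9; 11; 14; 11; 12; 15; 13; 14; 16]
    [::]).
by vm_compute.
Qed.

Lemma full_17_9_1_0 : is_full 17 27 9 1 0.
Proof.
apply: (@full_check _ _ _ _ _
    [:: 5; 10; 14; 15; 4; 7; 14; 16; 4; 6; 10; 11; 1; 8; 15; 16; 0; 5; 6; 8; 0; 3; 7;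
    9; 1; 2; 7; 13; 6; 9; 13; 15; 2; 3; 11; 15]
    [:: 6; 7]
    [:: 0; 1; 10; 0; 2; 16; 0; 4; 15; 0; 11; 12; 0; 13; 14; 1; 3; 5; 1; 4; 9; 1; 6; 12;
    1; 11; 14; 2; 4; 8; 2; 5; 9; 2; 6; 14; 2; 10; 12; 3; 4; 12; 3; 6; 16; 3; 8; 14; 3;
    10; 13; 4; 5; 13; 5; 7; 11; 5; 12; 16; 7; 8; 10; 7; 12; 15; 8; 9; 11; 8; 12; 13; 9;
    10; 16; 9; 12; 14; 11; 13; 16]
    [::]).
by vm_compute.
Qed.

Lemma full_17_10_1_0 : is_full 17 25 10 1 0.
Proof.
apply: (@full_check _ _ _ _ _
    [:: 6; 13; 15; 16; 5; 10; 11; 12; 1; 5; 8; 13; 1; 3; 11; 16; 8; 10; 14; 15; 0; 2;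
    12; 13; 2; 3; 7; 9; 3; 4; 6; 14; 4; 9; 11; 13; 0; 7; 11; 15]
    [:: 3; 15]
    [:: 0; 1; 6; 0; 3; 5; 0; 4; 10; 0; 8; 9; 0; 14; 16; 1; 2; 4; 1; 7; 10; 1; 9; 15; 1;
    12; 14; 2; 5; 15; 2; 6; 10; 2; 8; 16; 2; 11; 14; 3; 8; 12; 3; 10; 13; 4; 5; 16; 4;
    7; 8; 4; 12; 15; 5; 6; 7; 5; 9; 14; 6; 8; 11; 6; 9; 12; 7; 12; 16; 7; 13; 14; 9;
    10; 16]
    [::]).
by vm_compute.
Qed.

Lemma full_18_3_3_0 : is_full 18 44 3 3 0.
Proof.
apply: (@full_check _ _ _ _ _
    [:: 2; 3; 5; 8; 4; 7; 14; 17; 1; 6; 9; 12]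
    [:: 0; 16; 10; 15; 11; 13]
    [:: 0; 1; 2; 0; 3; 4; 0; 5; 15; 0; 6; 13; 0; 7; 10; 0; 8; 11; 0; 9; 14; 0; 12; 17;
    1; 3; 7; 1; 4; 13; 1; 5; 10; 1; 8; 14; 1; 11; 16; 1; 15; 17; 2; 4; 12; 2; 6; 17; 2;
    7; 11; 2; 9; 15; 2; 10; 16; 2; 13; 14; 3; 6; 10; 3; 9; 11; 3; 12; 14; 3; 13; 15; 3;
    16; 17; 4; 5; 16; 4; 6; 11; 4; 8; 15; 4; 9; 10; 5; 6; 14; 5; 7; 9; 5; 11; 17; 5;
    12; 13; 6; 7; 15; 6; 8; 16; 7; 8; 13; 7; 12; 16; 8; 9; 17; 8; 10; 12; 9; 13; 16;
    10; 11; 14; 10; 13; 17; 11; 12; 15; 14; 15; 16]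
    [::]).
by vm_compute.
Qed.

Lemma full_18_4_3_0 : is_full 18 42 4 3 0.
Proof.
apply: (@full_check _ _ _ _ _
    [:: 0; 2; 4; 10; 9; 15; 16; 17; 3; 4; 11; 13; 1; 7; 10; 12]
    [:: 6; 8; 4; 5; 10; 14]
    [:: 0; 1; 3; 0; 5; 14; 0; 6; 9; 0; 7; 8; 0; 11; 16; 0; 12; 15; 0; 13; 17; 1; 2; 11;
    1; 4; 16; 1; 5; 9; 1; 6; 13; 1; 8; 15; 1; 14; 17; 2; 3; 17; 2; 5; 7; 2; 6; 12; 2;
    8; 16; 2; 9; 14; 2; 13; 15; 3; 5; 12; 3; 6; 15; 3; 7; 9; 3; 8; 14; 3; 10; 16; 4; 6;
    14; 4; 7; 15; 4; 8; 9; 4; 12; 17; 5; 6; 17; 5; 8; 11; 5; 10; 15; 5; 13; 16; 6; 7;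
    16; 6; 10; 11; 7; 11; 17; 7; 13; 14; 8; 10; 17; 8; 12; 13; 9; 10; 13; 9; 11; 12;
    11; 14; 15; 12; 14; 16]
    [::]).
by vm_compute.
Qed.

Lemma full_18_5_0_0 : is_full 18 41 5 0 0.
Proof.
apply: (@full_check _ _ _ _ _
    [:: 2; 8; 12; 13; 7; 12; 14; 17; 1; 4; 15; 16; 0; 6; 10; 11; 3; 5; 9; 12]
    [::]
    [:: 0; 1; 3; 0; 2; 4; 0; 5; 14; 0; 7; 15; 0; 8; 17; 0; 9; 13; 0; 12; 16; 1; 2; 9;
    1; 5; 8; 1; 6; 17; 1; 7; 13; 1; 10; 14; 1; 11; 12; 2; 3; 7; 2; 5; 6; 2; 10; 16; 2;
    11; 17; 2; 14; 15; 3; 4; 14; 3; 6; 15; 3; 8; 11; 3; 10; 13; 3; 16; 17; 4; 5; 11; 4;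
    6; 12; 4; 7; 9; 4; 8; 10; 4; 13; 17; 5; 7; 10; 5; 13; 16; 5; 15; 17; 6; 7; 8; 6; 9;
    16; 6; 13; 14; 7; 11; 16; 8; 9; 15; 8; 14; 16; 9; 10; 17; 9; 11; 14; 10; 12; 15;
    11; 13; 15]
    [::]).
by vm_compute.
Qed.

Lemma full_18_5_3_0 : is_full 18 40 5 3 0.
Proof.
apply: (@full_check _ _ _ _ _
    [:: 2; 3; 10; 12; 0; 2; 7; 16; 6; 9; 12; 14; 2; 5; 8; 9; 7; 12; 15; 17]
    [:: 4; 7; 9; 11; 1; 13]
    [:: 0; 1; 6; 0; 3; 11; 0; 4; 14; 0; 5; 10; 0; 8; 17; 0; 9; 15; 0; 12; 13; 1; 2; 14;
    1; 3; 9; 1; 4; 12; 1; 5; 16; 1; 7; 8; 1; 10; 15; 1; 11; 17; 2; 4; 11; 2; 6; 17; 2;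
    13; 15; 3; 4; 15; 3; 5; 17; 3; 6; 7; 3; 8; 13; 3; 14; 16; 4; 5; 13; 4; 6; 16; 4; 8;
    10; 4; 9; 17; 5; 6; 15; 5; 7; 14; 5; 11; 12; 6; 8; 11; 6; 10; 13; 7; 9; 10; 7; 11;
    13; 8; 12; 16; 8; 14; 15; 9; 13; 16; 10; 11; 14; 10; 16; 17; 11; 15; 16; 13; 14; 17]
    [::]).
by vm_compute.
Qed.

Lemma full_18_6_0_0 : is_full 18 39 6 0 0.
Proof.
apply: (@full_check _ _ _ _ _
    [:: 1; 5; 14; 16; 2; 4; 9; 10; 0; 10; 11; 16; 7; 8; 9; 12; 3; 6; 10; 13; 9; 15; 16;
    17]
    [::]
    [:: 0; 1; 12; 0; 2; 6; 0; 3; 9; 0; 4; 15; 0; 5; 17; 0; 7; 13; 0; 8; 14; 1; 2; 11;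
    1; 3; 4; 1; 6; 8; 1; 7; 17; 1; 9; 13; 1; 10; 15; 2; 3; 16; 2; 5; 12; 2; 7; 14; 2;
    8; 15; 2; 13; 17; 3; 5; 8; 3; 7; 11; 3; 12; 17; 3; 14; 15; 4; 5; 6; 4; 7; 16; 4; 8;
    11; 4; 12; 13; 4; 14; 17; 5; 7; 10; 5; 9; 11; 5; 13; 15; 6; 7; 15; 6; 9; 14; 6; 11;
    17; 6; 12; 16; 8; 10; 17; 8; 13; 16; 10; 12; 14; 11; 12; 15; 11; 13; 14]
    [::]).
by vm_compute.
Qed.

Lemma full_18_6_3_0 : is_full 18 38 6 3 0.
Proof.
apply: (@full_check _ _ _ _ _
    [:: 0; 1; 5; 9; 1; 4; 6; 15; 2; 5; 8; 13; 11; 12; 14; 17; 4; 5; 7; 14; 1; 2; 3; 17]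
    [:: 4; 17; 2; 16; 10; 14]
    [:: 0; 2; 4; 0; 3; 7; 0; 6; 11; 0; 8; 10; 0; 12; 13; 0; 14; 15; 0; 16; 17; 1; 7;
    12; 1; 8; 11; 1; 10; 13; 1; 14; 16; 2; 6; 7; 2; 9; 14; 2; 10; 11; 2; 12; 15; 3; 4;
    16; 3; 5; 15; 3; 6; 10; 3; 8; 12; 3; 9; 11; 3; 13; 14; 4; 8; 9; 4; 10; 12; 4; 11;
    13; 5; 6; 12; 5; 10; 17; 5; 11; 16; 6; 8; 14; 6; 9; 17; 6; 13; 16; 7; 8; 17; 7; 9;
    13; 7; 10; 16; 7; 11; 15; 8; 15; 16; 9; 10; 15; 9; 12; 16; 13; 15; 17]
    [::]).
by vm_compute.
Qed.

Lemma full_18_7_0_0 : is_full 18 37 7 0 0.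
Proof.
apply: (@full_check _ _ _ _ _
    [:: 4; 10; 11; 14; 2; 7; 10; 12; 0; 8; 9; 16; 1; 5; 8; 10; 8; 12; 13; 14; 5; 14;
    15; 17; 3; 5; 6; 12]
    [::]
    [:: 0; 1; 12; 0; 2; 5; 0; 3; 14; 0; 4; 13; 0; 6; 10; 0; 7; 17; 0; 11; 15; 1; 2; 16;
    1; 3; 17; 1; 4; 7; 1; 6; 15; 1; 9; 14; 1; 11; 13; 2; 3; 4; 2; 6; 14; 2; 8; 15; 2;
    9; 11; 2; 13; 17; 3; 7; 9; 3; 8; 11; 3; 10; 13; 3; 15; 16; 4; 5; 9; 4; 6; 16; 4; 8;
    17; 4; 12; 15; 5; 7; 11; 5; 13; 16; 6; 7; 8; 6; 9; 13; 6; 11; 17; 7; 13; 15; 7; 14;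
    16; 9; 10; 15; 9; 12; 17; 10; 16; 17; 11; 12; 16]
    [::]).
by vm_compute.
Qed.

Lemma full_18_8_0_0 : is_full 18 35 8 0 0.
Proof.
apply: (@full_check _ _ _ _ _
    [:: 6; 7; 12; 15; 0; 3; 12; 16; 0; 4; 7; 8; 1; 3; 4; 13; 5; 7; 9; 13; 4; 9; 10; 12;
    3; 9; 11; 17; 0; 2; 13; 14]
    [::]
    [:: 0; 1; 9; 0; 5; 11; 0; 6; 10; 0; 15; 17; 1; 2; 16; 1; 5; 12; 1; 6; 17; 1; 7; 14;
    1; 8; 11; 1; 10; 15; 2; 3; 7; 2; 4; 17; 2; 5; 10; 2; 6; 11; 2; 8; 12; 2; 9; 15; 3;
    5; 6; 3; 8; 10; 3; 14; 15; 4; 5; 15; 4; 6; 14; 4; 11; 16; 5; 8; 17; 5; 14; 16; 6;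
    8; 13; 6; 9; 16; 7; 10; 11; 7; 16; 17; 8; 9; 14; 8; 15; 16; 10; 13; 16; 10; 14; 17;
    11; 12; 14; 11; 13; 15; 12; 13; 17]
    [::]).
by vm_compute.
Qed.

Lemma full_18_9_0_0 : is_full 18 33 9 0 0.
Proof.
apply: (@full_check _ _ _ _ _
    [:: 1; 8; 11; 17; 2; 6; 7; 17; 4; 9; 13; 15; 0; 3; 5; 17; 5; 11; 14; 15; 0; 7; 12;
    15; 2; 9; 10; 11; 0; 2; 8; 16; 5; 7; 8; 9]
    [::]
    [:: 0; 1; 4; 0; 6; 11; 0; 9; 14; 0; 10; 13; 1; 2; 13; 1; 3; 9; 1; 5; 16; 1; 6; 15;
    1; 7; 14; 1; 10; 12; 2; 3; 15; 2; 4; 5; 2; 12; 14; 3; 4; 16; 3; 6; 14; 3; 7; 10; 3;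
    8; 12; 3; 11; 13; 4; 6; 12; 4; 7; 11; 4; 8; 14; 4; 10; 17; 5; 6; 10; 5; 12; 13; 6;
    8; 13; 6; 9; 16; 7; 13; 16; 8; 10; 15; 9; 12; 17; 10; 14; 16; 11; 12; 16; 13; 14;
    17; 15; 16; 17]
    [::]).
by vm_compute.
Qed.

Lemma full_18_10_0_0 : is_full 18 31 10 0 0.
Proof.
apply: (@full_check _ _ _ _ _
    [:: 3; 14; 15; 17; 0; 1; 4; 9; 2; 6; 7; 13; 5; 8; 10; 16; 1; 6; 11; 12; 4; 10; 12;
    13; 2; 4; 15; 16; 6; 9; 10; 15; 2; 9; 12; 14; 1; 13; 14; 16]
    [::]
    [:: 0; 2; 10; 0; 3; 6; 0; 5; 7; 0; 8; 14; 0; 11; 16; 0; 12; 17; 0; 13; 15; 1; 2; 5;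
    1; 3; 10; 1; 7; 17; 1; 8; 15; 2; 3; 11; 2; 8; 17; 3; 4; 7; 3; 5; 9; 3; 8; 13; 3;
    12; 16; 4; 5; 17; 4; 6; 8; 4; 11; 14; 5; 6; 14; 5; 11; 13; 5; 12; 15; 6; 16; 17; 7;
    8; 12; 7; 9; 16; 7; 10; 14; 7; 11; 15; 8; 9; 11; 9; 13; 17; 10; 11; 17]
    [::]).
by vm_compute.
Qed.

Lemma full_19_0_0_0 : is_full 19 57 0 0 0.
Proof.
apply: (@full_check _ _ _ _ _
    [::]
    [::]
    [:: 0; 1; 15; 0; 2; 10; 0; 3; 6; 0; 4; 16; 0; 5; 14; 0; 7; 18; 0; 8; 9; 0; 11; 12;
    0; 13; 17; 1; 2; 6; 1; 3; 8; 1; 4; 12; 1; 5; 9; 1; 7; 17; 1; 10; 14; 1; 11; 16; 1;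
    13; 18; 2; 3; 14; 2; 4; 17; 2; 5; 12; 2; 7; 9; 2; 8; 13; 2; 11; 15; 2; 16; 18; 3;
    4; 5; 3; 7; 10; 3; 9; 13; 3; 11; 17; 3; 12; 16; 3; 15; 18; 4; 6; 13; 4; 7; 14; 4;
    8; 11; 4; 9; 18; 4; 10; 15; 5; 6; 16; 5; 7; 8; 5; 10; 17; 5; 11; 18; 5; 13; 15; 6;
    7; 11; 6; 8; 17; 6; 9; 15; 6; 10; 12; 6; 14; 18; 7; 12; 13; 7; 15; 16; 8; 10; 18;
    8; 12; 15; 8; 14; 16; 9; 10; 11; 9; 12; 14; 9; 16; 17; 10; 13; 16; 11; 13; 14; 12;
    17; 18; 14; 15; 17]
    [::]).
by vm_compute.
Qed.

(** The four K4s meet pairwise in single points, like four lines in general position. The points 0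
    to 3, each on just one of them, receive odd degree, and the star of three pairs at 0 restores
    parity. The same configuration serves for 21, 25 and 27 points. *)
Lemma full_19_4_3_0 : is_full 19 48 4 3 0.
Proof.
apply: (@full_check _ _ _ _ _
    [:: 0; 4; 5; 6; 1; 4; 7; 8; 2; 5; 7; 9; 3; 6; 8; 9]
    [:: 0; 1; 0; 2; 0; 3]
    [:: 0; 7; 17; 0; 8; 13; 0; 9; 16; 0; 10; 12; 0; 11; 15; 0; 14; 18; 1; 2; 14; 1; 3;
    17; 1; 5; 10; 1; 6; 13; 1; 9; 12; 1; 11; 18; 1; 15; 16; 2; 3; 15; 2; 4; 17; 2; 6;
    18; 2; 8; 11; 2; 10; 16; 2; 12; 13; 3; 4; 12; 3; 5; 16; 3; 7; 13; 3; 10; 18; 3; 11;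
    14; 4; 9; 18; 4; 10; 13; 4; 11; 16; 4; 14; 15; 5; 8; 14; 5; 11; 12; 5; 13; 18; 5;
    15; 17; 6; 7; 11; 6; 10; 14; 6; 12; 15; 6; 16; 17; 7; 10; 15; 7; 12; 14; 7; 16; 18;
    8; 10; 17; 8; 12; 16; 8; 15; 18; 9; 10; 11; 9; 13; 15; 9; 14; 17; 11; 13; 17; 12;
    17; 18; 13; 14; 16]
    [::]).
by vm_compute.
Qed.

Lemma full_19_5_0_0 : is_full 19 47 5 0 0.
Proof.
apply: (@full_check _ _ _ _ _
    [:: 1; 4; 11; 16; 1; 3; 7; 14; 3; 6; 13; 16; 4; 6; 7; 9; 9; 11; 13; 14]
    [::]
    [:: 0; 1; 13; 0; 2; 16; 0; 3; 9; 0; 4; 18; 0; 5; 8; 0; 6; 10; 0; 7; 15; 0; 11; 17;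
    0; 12; 14; 1; 2; 9; 1; 5; 10; 1; 6; 8; 1; 12; 15; 1; 17; 18; 2; 3; 12; 2; 4; 17; 2;
    5; 6; 2; 7; 13; 2; 8; 11; 2; 10; 14; 2; 15; 18; 3; 4; 8; 3; 5; 17; 3; 10; 18; 3;
    11; 15; 4; 5; 14; 4; 10; 15; 4; 12; 13; 5; 7; 11; 5; 9; 12; 5; 13; 18; 5; 15; 16;
    6; 11; 18; 6; 12; 17; 6; 14; 15; 7; 8; 17; 7; 10; 16; 7; 12; 18; 8; 9; 15; 8; 10;
    13; 8; 12; 16; 8; 14; 18; 9; 10; 17; 9; 16; 18; 10; 11; 12; 13; 15; 17; 14; 16; 17]
    [::]).
by vm_compute.
Qed.

Lemma full_19_8_0_0 : is_full 19 41 8 0 0.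
Proof.
apply: (@full_check _ _ _ _ _
    [:: 0; 3; 5; 10; 1; 12; 16; 17; 6; 7; 8; 10; 1; 4; 5; 6; 8; 9; 12; 13; 3; 9; 15;
    16; 0; 7; 11; 15; 4; 11; 13; 17]
    [::]
    [:: 0; 1; 8; 0; 2; 13; 0; 4; 14; 0; 6; 12; 0; 9; 17; 0; 16; 18; 1; 2; 9; 1; 3; 11;
    1; 7; 14; 1; 10; 13; 1; 15; 18; 2; 3; 12; 2; 4; 15; 2; 5; 8; 2; 6; 16; 2; 7; 17; 2;
    10; 18; 2; 11; 14; 3; 4; 18; 3; 6; 14; 3; 7; 13; 3; 8; 17; 4; 7; 12; 4; 8; 16; 4;
    9; 10; 5; 7; 16; 5; 9; 14; 5; 11; 12; 5; 13; 15; 5; 17; 18; 6; 9; 11; 6; 13; 18; 6;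
    15; 17; 7; 9; 18; 8; 11; 18; 8; 14; 15; 10; 11; 16; 10; 12; 15; 10; 14; 17; 12; 14;
    18; 13; 14; 16]
    [::]).
by vm_compute.
Qed.

Lemma full_19_9_0_0 : is_full 19 39 9 0 0.
Proof.
apply: (@full_check _ _ _ _ _
    [:: 1; 5; 6; 17; 2; 10; 15; 16; 0; 3; 9; 15; 6; 8; 15; 18; 1; 9; 10; 11; 4; 5; 11;
    15; 3; 12; 14; 16; 4; 8; 14; 17; 0; 2; 12; 18]
    [::]
    [:: 0; 1; 16; 0; 4; 10; 0; 5; 13; 0; 6; 14; 0; 7; 17; 0; 8; 11; 1; 2; 13; 1; 3; 4;
    1; 7; 18; 1; 8; 12; 1; 14; 15; 2; 3; 17; 2; 4; 9; 2; 5; 8; 2; 6; 11; 2; 7; 14; 3;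
    5; 7; 3; 6; 10; 3; 8; 13; 3; 11; 18; 4; 6; 12; 4; 7; 16; 4; 13; 18; 5; 9; 14; 5;
    10; 12; 5; 16; 18; 6; 7; 9; 6; 13; 16; 7; 8; 10; 7; 11; 12; 7; 13; 15; 8; 9; 16; 9;
    12; 13; 9; 17; 18; 10; 13; 17; 10; 14; 18; 11; 13; 14; 11; 16; 17; 12; 15; 17]
    [::]).
by vm_compute.
Qed.

Lemma full_19_10_0_0 : is_full 19 37 10 0 0.
Proof.
apply: (@full_check _ _ _ _ _
    [:: 0; 1; 4; 12; 7; 11; 16; 17; 1; 10; 11; 13; 2; 6; 9; 11; 2; 5; 12; 15; 6; 7; 10;
    12; 8; 9; 10; 15; 0; 5; 10; 16; 3; 4; 8; 11; 3; 12; 13; 17]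
    [::]
    [:: 0; 2; 8; 0; 3; 7; 0; 6; 13; 0; 9; 17; 0; 11; 15; 0; 14; 18; 1; 2; 18; 1; 3; 5;
    1; 6; 8; 1; 7; 9; 1; 14; 17; 1; 15; 16; 2; 3; 16; 2; 4; 13; 2; 7; 14; 2; 10; 17; 3;
    6; 15; 3; 9; 14; 3; 10; 18; 4; 5; 9; 4; 6; 17; 4; 7; 15; 4; 10; 14; 4; 16; 18; 5;
    6; 18; 5; 7; 13; 5; 8; 17; 5; 11; 14; 6; 14; 16; 7; 8; 18; 8; 12; 14; 8; 13; 16; 9;
    12; 16; 9; 13; 18; 11; 12; 18; 13; 14; 15; 15; 17; 18]
    [::]).
by vm_compute.
Qed.

Lemma full_20_3_4_0 : is_full 20 56 3 4 0.
Proof.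
apply: (@full_check _ _ _ _ _
    [:: 5; 8; 11; 17; 1; 3; 12; 16; 0; 4; 7; 18]
    [:: 2; 15; 14; 19; 10; 13; 6; 9]
    [:: 0; 1; 15; 0; 2; 16; 0; 3; 13; 0; 5; 6; 0; 8; 12; 0; 9; 17; 0; 10; 14; 0; 11;
    19; 1; 2; 8; 1; 4; 10; 1; 5; 7; 1; 6; 14; 1; 9; 11; 1; 13; 19; 1; 17; 18; 2; 3; 11;
    2; 4; 19; 2; 5; 18; 2; 6; 10; 2; 7; 9; 2; 12; 13; 2; 14; 17; 3; 4; 14; 3; 5; 15; 3;
    6; 17; 3; 7; 19; 3; 8; 18; 3; 9; 10; 4; 5; 9; 4; 6; 16; 4; 8; 15; 4; 11; 13; 4; 12;
    17; 5; 10; 19; 5; 12; 14; 5; 13; 16; 6; 7; 12; 6; 8; 19; 6; 11; 18; 6; 13; 15; 7;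
    8; 10; 7; 11; 14; 7; 13; 17; 7; 15; 16; 8; 9; 16; 8; 13; 14; 9; 12; 19; 9; 13; 18;
    9; 14; 15; 10; 11; 16; 10; 12; 18; 10; 15; 17; 11; 12; 15; 14; 16; 18; 15; 18; 19;
    16; 17; 19]
    [::]).
by vm_compute.
Qed.

Lemma full_20_5_1_0 : is_full 20 53 5 1 0.
Proof.
apply: (@full_check _ _ _ _ _
    [:: 4; 7; 9; 13; 2; 7; 15; 18; 0; 7; 11; 17; 8; 10; 16; 19; 5; 6; 12; 14]
    [:: 1; 3]
    [:: 0; 1; 5; 0; 2; 12; 0; 3; 8; 0; 4; 6; 0; 9; 16; 0; 10; 15; 0; 13; 18; 0; 14; 19;
    1; 2; 6; 1; 4; 17; 1; 7; 19; 1; 8; 14; 1; 9; 15; 1; 10; 11; 1; 12; 13; 1; 16; 18;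
    2; 3; 5; 2; 4; 8; 2; 9; 11; 2; 10; 17; 2; 13; 19; 2; 14; 16; 3; 4; 11; 3; 6; 15; 3;
    7; 14; 3; 9; 10; 3; 12; 18; 3; 13; 16; 3; 17; 19; 4; 5; 10; 4; 12; 16; 4; 14; 15;
    4; 18; 19; 5; 7; 8; 5; 9; 18; 5; 11; 13; 5; 15; 19; 5; 16; 17; 6; 7; 16; 6; 8; 11;
    6; 9; 19; 6; 10; 18; 6; 13; 17; 7; 10; 12; 8; 9; 12; 8; 13; 15; 8; 17; 18; 9; 14;
    17; 10; 13; 14; 11; 12; 19; 11; 14; 18; 11; 15; 16; 12; 15; 17]
    [::]).
by vm_compute.
Qed.

Lemma full_21_0_0_0 : is_full 21 70 0 0 0.
Proof.
apply: (@full_check _ _ _ _ _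
    [::]
    [::]
    [:: 0; 1; 18; 0; 2; 13; 0; 3; 12; 0; 4; 8; 0; 5; 17; 0; 6; 16; 0; 7; 14; 0; 9; 11;
    0; 10; 20; 0; 15; 19; 1; 2; 11; 1; 3; 4; 1; 5; 10; 1; 6; 13; 1; 7; 16; 1; 8; 20; 1;
    9; 15; 1; 12; 17; 1; 14; 19; 2; 3; 6; 2; 4; 9; 2; 5; 15; 2; 7; 12; 2; 8; 14; 2; 10;
    18; 2; 16; 20; 2; 17; 19; 3; 5; 14; 3; 7; 13; 3; 8; 15; 3; 9; 16; 3; 10; 19; 3; 11;
    17; 3; 18; 20; 4; 5; 13; 4; 6; 19; 4; 7; 17; 4; 10; 12; 4; 11; 20; 4; 14; 15; 4;
    16; 18; 5; 6; 7; 5; 8; 12; 5; 9; 20; 5; 11; 16; 5; 18; 19; 6; 8; 9; 6; 10; 11; 6;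
    12; 18; 6; 14; 20; 6; 15; 17; 7; 8; 10; 7; 9; 18; 7; 11; 15; 7; 19; 20; 8; 11; 19;
    8; 13; 16; 8; 17; 18; 9; 10; 17; 9; 12; 14; 9; 13; 19; 10; 13; 14; 10; 15; 16; 11;
    12; 13; 11; 14; 18; 12; 15; 20; 12; 16; 19; 13; 15; 18; 13; 17; 20; 14; 16; 17]
    [::]).
by vm_compute.
Qed.

Lemma full_21_4_3_0 : is_full 21 61 4 3 0.
Proof.
apply: (@full_check _ _ _ _ _
    [:: 0; 4; 5; 6; 1; 4; 7; 8; 2; 5; 7; 9; 3; 6; 8; 9]
    [:: 0; 1; 0; 2; 0; 3]
    [:: 0; 7; 13; 0; 8; 12; 0; 9; 16; 0; 10; 19; 0; 11; 14; 0; 15; 17; 0; 18; 20; 1; 2;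
    12; 1; 3; 5; 1; 6; 14; 1; 9; 18; 1; 10; 20; 1; 11; 16; 1; 13; 15; 1; 17; 19; 2; 3;
    17; 2; 4; 20; 2; 6; 16; 2; 8; 14; 2; 10; 15; 2; 11; 13; 2; 18; 19; 3; 4; 15; 3; 7;
    11; 3; 10; 12; 3; 13; 14; 3; 16; 18; 3; 19; 20; 4; 9; 17; 4; 10; 14; 4; 11; 18; 4;
    12; 19; 4; 13; 16; 5; 8; 20; 5; 10; 16; 5; 11; 12; 5; 13; 18; 5; 14; 17; 5; 15; 19;
    6; 7; 20; 6; 10; 11; 6; 12; 15; 6; 13; 19; 6; 17; 18; 7; 10; 17; 7; 12; 18; 7; 14;
    19; 7; 15; 16; 8; 10; 18; 8; 11; 15; 8; 13; 17; 8; 16; 19; 9; 10; 13; 9; 11; 19; 9;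
    12; 14; 9; 15; 20; 11; 17; 20; 12; 13; 20; 12; 16; 17; 14; 15; 18; 14; 16; 20]
    [::]).
by vm_compute.
Qed.

Lemma full_21_8_0_0 : is_full 21 54 8 0 0.
Proof.
apply: (@full_check _ _ _ _ _
    [:: 4; 5; 10; 13; 1; 5; 7; 8; 10; 12; 18; 20; 9; 14; 16; 19; 0; 3; 13; 16; 3; 7; 9;
    20; 0; 1; 14; 18; 4; 8; 12; 19]
    [::]
    [:: 0; 2; 11; 0; 4; 7; 0; 5; 6; 0; 8; 20; 0; 9; 15; 0; 10; 19; 0; 12; 17; 1; 2; 10;
    1; 3; 12; 1; 4; 16; 1; 6; 15; 1; 9; 13; 1; 11; 17; 1; 19; 20; 2; 3; 5; 2; 4; 18; 2;
    6; 19; 2; 7; 13; 2; 8; 16; 2; 9; 17; 2; 12; 15; 2; 14; 20; 3; 4; 14; 3; 6; 8; 3;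
    10; 15; 3; 11; 19; 3; 17; 18; 4; 6; 17; 4; 9; 11; 4; 15; 20; 5; 9; 18; 5; 11; 20;
    5; 12; 16; 5; 14; 17; 5; 15; 19; 6; 7; 16; 6; 9; 12; 6; 10; 14; 6; 11; 18; 6; 13;
    20; 7; 10; 17; 7; 11; 15; 7; 12; 14; 7; 18; 19; 8; 9; 10; 8; 11; 14; 8; 13; 18; 8;
    15; 17; 10; 11; 16; 11; 12; 13; 13; 14; 15; 13; 17; 19; 15; 16; 18; 16; 17; 20]
    [::]).
by vm_compute.
Qed.

Lemma full_21_9_0_0 : is_full 21 52 9 0 0.
Proof.
apply: (@full_check _ _ _ _ _
    [:: 0; 2; 15; 19; 4; 5; 17; 19; 5; 6; 14; 16; 4; 10; 12; 14; 8; 10; 11; 13; 2; 7;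
    13; 17; 3; 8; 15; 17; 3; 6; 7; 12; 0; 11; 16; 17]
    [::]
    [:: 0; 1; 18; 0; 3; 13; 0; 4; 7; 0; 5; 8; 0; 6; 10; 0; 9; 14; 0; 12; 20; 1; 2; 16;
    1; 3; 11; 1; 4; 15; 1; 5; 10; 1; 6; 17; 1; 7; 20; 1; 8; 12; 1; 9; 19; 1; 13; 14; 2;
    3; 10; 2; 4; 6; 2; 5; 9; 2; 8; 14; 2; 11; 12; 2; 18; 20; 3; 4; 9; 3; 5; 18; 3; 14;
    19; 3; 16; 20; 4; 8; 16; 4; 11; 20; 4; 13; 18; 5; 7; 11; 5; 12; 13; 5; 15; 20; 6;
    8; 20; 6; 9; 11; 6; 13; 19; 6; 15; 18; 7; 8; 19; 7; 9; 16; 7; 10; 15; 7; 14; 18; 8;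
    9; 18; 9; 10; 17; 9; 12; 15; 9; 13; 20; 10; 16; 18; 10; 19; 20; 11; 14; 15; 11; 18;
    19; 12; 16; 19; 12; 17; 18; 13; 15; 16; 14; 17; 20]
    [::]).
by vm_compute.
Qed.

Lemma full_23_0_0_1 : is_full 23 81 0 0 1.
Proof.
apply: (@full_check _ _ _ _ _
    [::]
    [::]
    [:: 0; 1; 12; 0; 2; 15; 0; 3; 19; 0; 4; 13; 0; 5; 6; 0; 7; 18; 0; 8; 22; 0; 9; 10;
    0; 11; 20; 0; 14; 17; 0; 16; 21; 1; 2; 10; 1; 3; 18; 1; 4; 20; 1; 5; 21; 1; 6; 22;
    1; 7; 8; 1; 9; 15; 1; 11; 13; 1; 14; 19; 1; 16; 17; 2; 3; 16; 2; 4; 21; 2; 5; 7; 2;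
    6; 20; 2; 8; 9; 2; 11; 17; 2; 12; 22; 2; 13; 19; 2; 14; 18; 3; 4; 11; 3; 5; 13; 3;
    6; 9; 3; 7; 15; 3; 8; 10; 3; 12; 21; 3; 14; 20; 3; 17; 22; 4; 5; 12; 4; 6; 8; 4; 7;
    14; 4; 9; 19; 4; 10; 17; 4; 15; 22; 4; 16; 18; 5; 8; 11; 5; 9; 20; 5; 10; 22; 5;
    14; 16; 5; 15; 18; 5; 17; 19; 6; 7; 13; 6; 10; 18; 6; 11; 19; 6; 12; 17; 6; 14; 21;
    6; 15; 16; 7; 9; 12; 7; 10; 21; 7; 11; 22; 7; 16; 19; 7; 17; 20; 8; 12; 19; 8; 13;
    18; 8; 14; 15; 8; 16; 20; 8; 17; 21; 9; 11; 16; 9; 13; 21; 9; 14; 22; 9; 17; 18;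
    10; 11; 14; 10; 12; 16; 10; 13; 20; 10; 15; 19; 11; 12; 18; 11; 15; 21; 12; 13; 14;
    12; 15; 20; 13; 15; 17; 13; 16; 22]
    [:: 18; 19; 20; 21; 22]).
by vm_compute.
Qed.

Lemma full_23_0_4_0 : is_full 23 83 0 4 0.
Proof.
apply: (@full_check _ _ _ _ _
    [::]
    [:: 19; 21; 19; 22; 20; 21; 20; 22]
    [:: 0; 1; 12; 0; 2; 15; 0; 3; 19; 0; 4; 13; 0; 5; 6; 0; 7; 18; 0; 8; 22; 0; 9; 10;
    0; 11; 20; 0; 14; 17; 0; 16; 21; 1; 2; 10; 1; 3; 18; 1; 4; 20; 1; 5; 21; 1; 6; 22;
    1; 7; 8; 1; 9; 15; 1; 11; 13; 1; 14; 19; 1; 16; 17; 2; 3; 16; 2; 4; 21; 2; 5; 7; 2;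
    6; 20; 2; 8; 9; 2; 11; 17; 2; 12; 22; 2; 13; 19; 2; 14; 18; 3; 4; 11; 3; 5; 13; 3;
    6; 9; 3; 7; 15; 3; 8; 10; 3; 12; 21; 3; 14; 20; 3; 17; 22; 4; 5; 12; 4; 6; 8; 4; 7;
    14; 4; 9; 19; 4; 10; 17; 4; 15; 22; 4; 16; 18; 5; 8; 11; 5; 9; 20; 5; 10; 22; 5;
    14; 16; 5; 15; 18; 5; 17; 19; 6; 7; 13; 6; 10; 18; 6; 11; 19; 6; 12; 17; 6; 14; 21;
    6; 15; 16; 7; 9; 12; 7; 10; 21; 7; 11; 22; 7; 16; 19; 7; 17; 20; 8; 12; 19; 8; 13;
    18; 8; 14; 15; 8; 16; 20; 8; 17; 21; 9; 11; 16; 9; 13; 21; 9; 14; 22; 9; 17; 18;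
    10; 11; 14; 10; 12; 16; 10; 13; 20; 10; 15; 19; 11; 12; 18; 11; 15; 21; 12; 13; 14;
    12; 15; 20; 13; 15; 17; 13; 16; 22; 18; 19; 20; 18; 21; 22]
    [::]).
by vm_compute.
Qed.

Lemma full_23_5_1_0 : is_full 23 74 5 1 0.
Proof.
apply: (@full_check _ _ _ _ _
    [:: 5; 8; 9; 11; 4; 6; 16; 18; 3; 5; 16; 20; 3; 4; 8; 19; 9; 18; 19; 20]
    [:: 6; 11]
    [:: 0; 1; 15; 0; 2; 14; 0; 3; 13; 0; 4; 12; 0; 5; 6; 0; 7; 17; 0; 8; 18; 0; 9; 21;
    0; 10; 16; 0; 11; 20; 0; 19; 22; 1; 2; 11; 1; 3; 18; 1; 4; 9; 1; 5; 13; 1; 6; 20;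
    1; 7; 16; 1; 8; 14; 1; 10; 21; 1; 12; 19; 1; 17; 22; 2; 3; 12; 2; 4; 21; 2; 5; 22;
    2; 6; 10; 2; 7; 18; 2; 8; 16; 2; 9; 15; 2; 13; 20; 2; 17; 19; 3; 6; 15; 3; 7; 21;
    3; 9; 22; 3; 10; 17; 3; 11; 14; 4; 5; 7; 4; 10; 14; 4; 11; 17; 4; 13; 22; 4; 15;
    20; 5; 10; 12; 5; 14; 18; 5; 15; 19; 5; 17; 21; 6; 7; 12; 6; 8; 22; 6; 9; 17; 6;
    13; 19; 6; 14; 21; 7; 8; 20; 7; 9; 10; 7; 11; 13; 7; 14; 19; 7; 15; 22; 8; 10; 15;
    8; 12; 17; 8; 13; 21; 9; 12; 16; 9; 13; 14; 10; 11; 19; 10; 13; 18; 10; 20; 22; 11;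
    12; 18; 11; 15; 21; 11; 16; 22; 12; 13; 15; 12; 14; 22; 12; 20; 21; 13; 16; 17; 14;
    15; 16; 14; 17; 20; 15; 17; 18; 16; 19; 21; 18; 21; 22]
    [::]).
by vm_compute.
Qed.

Lemma full_23_6_1_0 : is_full 23 72 6 1 0.
Proof.
apply: (@full_check _ _ _ _ _
    [:: 0; 9; 16; 22; 0; 10; 12; 19; 14; 15; 16; 18; 3; 8; 13; 19; 8; 12; 15; 22; 3; 9;
    10; 18]
    [:: 13; 14]
    [:: 0; 1; 13; 0; 2; 5; 0; 3; 15; 0; 4; 18; 0; 6; 8; 0; 7; 11; 0; 14; 17; 0; 20; 21;
    1; 2; 19; 1; 3; 21; 1; 4; 7; 1; 5; 22; 1; 6; 15; 1; 8; 16; 1; 9; 12; 1; 10; 20; 1;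
    11; 14; 1; 17; 18; 2; 3; 4; 2; 6; 11; 2; 7; 9; 2; 8; 20; 2; 10; 14; 2; 12; 21; 2;
    13; 16; 2; 15; 17; 2; 18; 22; 3; 5; 17; 3; 6; 7; 3; 11; 16; 3; 12; 20; 3; 14; 22;
    4; 5; 8; 4; 6; 9; 4; 10; 15; 4; 11; 12; 4; 13; 22; 4; 14; 20; 4; 16; 19; 4; 17; 21;
    5; 6; 21; 5; 7; 10; 5; 9; 13; 5; 11; 15; 5; 12; 14; 5; 16; 20; 5; 18; 19; 6; 10;
    22; 6; 12; 16; 6; 13; 18; 6; 14; 19; 6; 17; 20; 7; 8; 14; 7; 12; 18; 7; 13; 20; 7;
    15; 19; 7; 16; 17; 7; 21; 22; 8; 9; 11; 8; 10; 17; 8; 18; 21; 9; 14; 21; 9; 15; 20;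
    9; 17; 19; 10; 11; 13; 10; 16; 21; 11; 17; 22; 11; 18; 20; 11; 19; 21; 12; 13; 17;
    13; 15; 21; 19; 20; 22]
    [::]).
by vm_compute.
Qed.

Lemma full_23_7_1_0 : is_full 23 70 7 1 0.
Proof.
apply: (@full_check _ _ _ _ _
    [:: 0; 7; 10; 21; 1; 6; 21; 22; 4; 6; 8; 20; 0; 1; 3; 14; 5; 7; 13; 22; 3; 5; 19;
    20; 8; 10; 14; 19]
    [:: 4; 13]
    [:: 0; 2; 12; 0; 4; 11; 0; 5; 8; 0; 6; 18; 0; 9; 19; 0; 13; 17; 0; 15; 22; 0; 16;
    20; 1; 2; 8; 1; 4; 16; 1; 5; 15; 1; 7; 12; 1; 9; 10; 1; 11; 18; 1; 13; 19; 1; 17;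
    20; 2; 3; 10; 2; 4; 9; 2; 5; 11; 2; 6; 15; 2; 7; 20; 2; 13; 16; 2; 14; 21; 2; 17;
    22; 2; 18; 19; 3; 4; 21; 3; 6; 7; 3; 8; 22; 3; 9; 13; 3; 11; 17; 3; 12; 16; 3; 15;
    18; 4; 5; 12; 4; 7; 17; 4; 10; 18; 4; 14; 15; 4; 19; 22; 5; 6; 9; 5; 10; 16; 5; 14;
    17; 5; 18; 21; 6; 10; 11; 6; 12; 13; 6; 14; 16; 6; 17; 19; 7; 8; 11; 7; 9; 16; 7;
    14; 18; 7; 15; 19; 8; 9; 15; 8; 12; 21; 8; 13; 18; 8; 16; 17; 9; 11; 22; 9; 12; 14;
    9; 17; 21; 9; 18; 20; 10; 12; 22; 10; 13; 20; 10; 15; 17; 11; 12; 19; 11; 13; 14;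
    11; 15; 16; 11; 20; 21; 12; 15; 20; 12; 17; 18; 13; 15; 21; 14; 20; 22; 16; 18; 22;
    16; 19; 21]
    [::]).
by vm_compute.
Qed.

Lemma full_23_8_1_0 : is_full 23 68 8 1 0.
Proof.
apply: (@full_check _ _ _ _ _
    [:: 10; 13; 18; 22; 0; 8; 12; 18; 8; 10; 15; 20; 3; 6; 17; 18; 5; 6; 9; 13; 0; 1;
    14; 17; 5; 14; 18; 20; 1; 9; 12; 15]
    [:: 3; 22]
    [:: 0; 2; 22; 0; 3; 10; 0; 4; 11; 0; 5; 16; 0; 6; 7; 0; 9; 19; 0; 13; 15; 0; 20;
    21; 1; 2; 19; 1; 3; 16; 1; 4; 18; 1; 5; 10; 1; 6; 20; 1; 7; 11; 1; 8; 22; 1; 13;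
    21; 2; 3; 20; 2; 4; 14; 2; 5; 21; 2; 6; 15; 2; 7; 8; 2; 9; 10; 2; 11; 17; 2; 12;
    13; 2; 16; 18; 3; 4; 5; 3; 7; 13; 3; 8; 21; 3; 9; 14; 3; 11; 12; 3; 15; 19; 4; 6;
    10; 4; 7; 17; 4; 8; 19; 4; 9; 16; 4; 12; 22; 4; 13; 20; 4; 15; 21; 5; 7; 12; 5; 8;
    11; 5; 15; 17; 5; 19; 22; 6; 8; 16; 6; 11; 22; 6; 12; 14; 6; 19; 21; 7; 9; 22; 7;
    10; 21; 7; 14; 15; 7; 16; 20; 7; 18; 19; 8; 9; 17; 8; 13; 14; 9; 11; 20; 9; 18; 21;
    10; 11; 14; 10; 12; 16; 10; 17; 19; 11; 13; 19; 11; 15; 18; 11; 16; 21; 12; 17; 21;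
    12; 19; 20; 13; 16; 17; 14; 16; 19; 14; 21; 22; 15; 16; 22; 17; 20; 22]
    [::]).
by vm_compute.
Qed.

Lemma full_23_9_1_0 : is_full 23 66 9 1 0.
Proof.
apply: (@full_check _ _ _ _ _
    [:: 10; 11; 13; 14; 5; 7; 11; 12; 9; 17; 19; 22; 0; 12; 18; 19; 0; 6; 13; 16; 7; 8;
    15; 22; 6; 8; 18; 20; 9; 10; 12; 15; 5; 14; 17; 20]
    [:: 12; 16]
    [:: 0; 1; 7; 0; 2; 17; 0; 3; 21; 0; 4; 10; 0; 5; 22; 0; 8; 9; 0; 11; 20; 0; 14; 15;
    1; 2; 9; 1; 3; 12; 1; 4; 20; 1; 5; 19; 1; 6; 11; 1; 8; 13; 1; 10; 21; 1; 14; 22; 1;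
    15; 17; 1; 16; 18; 2; 3; 10; 2; 4; 6; 2; 5; 21; 2; 7; 13; 2; 8; 12; 2; 11; 15; 2;
    14; 16; 2; 18; 22; 2; 19; 20; 3; 4; 22; 3; 5; 13; 3; 6; 19; 3; 7; 20; 3; 8; 14; 3;
    9; 11; 3; 15; 18; 3; 16; 17; 4; 5; 8; 4; 7; 16; 4; 9; 13; 4; 11; 19; 4; 12; 17; 4;
    14; 18; 4; 15; 21; 5; 6; 15; 5; 9; 18; 5; 10; 16; 6; 7; 9; 6; 10; 17; 6; 12; 14; 6;
    21; 22; 7; 10; 18; 7; 14; 19; 7; 17; 21; 8; 10; 19; 8; 11; 17; 8; 16; 21; 9; 14;
    21; 9; 16; 20; 10; 20; 22; 11; 16; 22; 11; 18; 21; 12; 13; 22; 12; 20; 21; 13; 15;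
    20; 13; 17; 18; 13; 19; 21; 15; 16; 19]
    [::]).
by vm_compute.
Qed.

Lemma full_23_10_1_0 : is_full 23 64 10 1 0.
Proof.
apply: (@full_check _ _ _ _ _
    [:: 10; 13; 15; 18; 3; 5; 8; 10; 1; 5; 18; 21; 2; 8; 15; 16; 2; 4; 9; 12; 0; 1; 12;
    20; 10; 11; 16; 19; 4; 10; 20; 21; 3; 6; 11; 13; 0; 9; 18; 19]
    [:: 6; 18]
    [:: 0; 2; 10; 0; 3; 21; 0; 4; 11; 0; 5; 13; 0; 6; 8; 0; 7; 16; 0; 14; 17; 0; 15;
    22; 1; 2; 3; 1; 4; 13; 1; 6; 9; 1; 7; 10; 1; 8; 17; 1; 11; 15; 1; 14; 16; 1; 19;
    22; 2; 5; 17; 2; 6; 7; 2; 11; 18; 2; 13; 21; 2; 14; 22; 2; 19; 20; 3; 4; 15; 3; 7;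
    19; 3; 9; 20; 3; 12; 16; 3; 14; 18; 3; 17; 22; 4; 5; 14; 4; 6; 16; 4; 7; 17; 4; 8;
    19; 4; 18; 22; 5; 6; 19; 5; 7; 12; 5; 9; 15; 5; 11; 22; 5; 16; 20; 6; 10; 17; 6;
    12; 15; 6; 14; 21; 6; 20; 22; 7; 8; 22; 7; 9; 11; 7; 13; 14; 7; 15; 21; 7; 18; 20;
    8; 9; 14; 8; 11; 21; 8; 12; 18; 8; 13; 20; 9; 10; 22; 9; 13; 17; 9; 16; 21; 10; 12;
    14; 11; 12; 17; 11; 14; 20; 12; 13; 19; 12; 21; 22; 13; 16; 22; 14; 15; 19; 15; 17;
    20; 16; 17; 18; 17; 19; 21]
    [::]).
by vm_compute.
Qed.

Lemma full_24_5_3_0 : is_full 24 81 5 3 0.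
Proof.
apply: (@full_check _ _ _ _ _
    [:: 3; 8; 10; 21; 0; 9; 17; 22; 7; 14; 17; 19; 2; 13; 16; 17; 6; 11; 15; 18]
    [:: 5; 12; 4; 23; 1; 20]
    [:: 0; 1; 14; 0; 2; 11; 0; 3; 23; 0; 4; 10; 0; 5; 7; 0; 6; 20; 0; 8; 12; 0; 13; 19;
    0; 15; 21; 0; 16; 18; 1; 2; 5; 1; 3; 18; 1; 4; 12; 1; 6; 9; 1; 7; 15; 1; 8; 17; 1;
    10; 13; 1; 11; 16; 1; 19; 21; 1; 22; 23; 2; 3; 9; 2; 4; 7; 2; 6; 19; 2; 8; 18; 2;
    10; 14; 2; 12; 23; 2; 15; 22; 2; 20; 21; 3; 4; 5; 3; 6; 22; 3; 7; 12; 3; 11; 13; 3;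
    14; 16; 3; 15; 17; 3; 19; 20; 4; 6; 17; 4; 8; 14; 4; 9; 20; 4; 11; 22; 4; 13; 15;
    4; 16; 21; 4; 18; 19; 5; 6; 14; 5; 8; 16; 5; 9; 13; 5; 10; 22; 5; 11; 21; 5; 15;
    19; 5; 17; 18; 5; 20; 23; 6; 7; 21; 6; 8; 13; 6; 10; 23; 6; 12; 16; 7; 8; 22; 7; 9;
    18; 7; 10; 11; 7; 13; 23; 7; 16; 20; 8; 9; 11; 8; 15; 20; 8; 19; 23; 9; 10; 19; 9;
    12; 15; 9; 14; 21; 9; 16; 23; 10; 12; 18; 10; 15; 16; 10; 17; 20; 11; 12; 19; 11;
    14; 20; 11; 17; 23; 12; 13; 20; 12; 14; 22; 12; 17; 21; 13; 14; 18; 13; 21; 22; 14;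
    15; 23; 16; 19; 22; 18; 20; 22; 18; 21; 23]
    [::]).
by vm_compute.
Qed.

Lemma full_24_6_0_0 : is_full 24 80 6 0 0.
Proof.
apply: (@full_check _ _ _ _ _
    [:: 0; 10; 15; 22; 5; 7; 11; 16; 1; 8; 17; 23; 2; 12; 14; 19; 6; 9; 13; 20; 3; 4;
    18; 21]
    [::]
    [:: 0; 1; 20; 0; 2; 18; 0; 3; 13; 0; 4; 6; 0; 5; 8; 0; 7; 23; 0; 9; 12; 0; 11; 21;
    0; 14; 16; 0; 17; 19; 1; 2; 13; 1; 3; 22; 1; 4; 19; 1; 5; 15; 1; 6; 21; 1; 7; 9; 1;
    10; 11; 1; 12; 16; 1; 14; 18; 2; 3; 15; 2; 4; 11; 2; 5; 20; 2; 6; 16; 2; 7; 8; 2;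
    9; 21; 2; 10; 23; 2; 17; 22; 3; 5; 10; 3; 6; 7; 3; 8; 16; 3; 9; 19; 3; 11; 14; 3;
    12; 23; 3; 17; 20; 4; 5; 12; 4; 7; 17; 4; 8; 22; 4; 9; 10; 4; 13; 16; 4; 14; 23; 4;
    15; 20; 5; 6; 19; 5; 9; 17; 5; 13; 23; 5; 14; 21; 5; 18; 22; 6; 8; 11; 6; 10; 18;
    6; 12; 17; 6; 14; 22; 6; 15; 23; 7; 10; 21; 7; 12; 18; 7; 13; 22; 7; 14; 20; 7; 15;
    19; 8; 9; 18; 8; 10; 19; 8; 12; 20; 8; 13; 14; 8; 15; 21; 9; 11; 23; 9; 14; 15; 9;
    16; 22; 10; 12; 13; 10; 14; 17; 10; 16; 20; 11; 12; 15; 11; 13; 19; 11; 17; 18; 11;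
    20; 22; 12; 21; 22; 13; 15; 18; 13; 17; 21; 15; 16; 17; 16; 18; 23; 16; 19; 21; 18;
    19; 20; 19; 22; 23; 20; 21; 23]
    [::]).
by vm_compute.
Qed.

Lemma full_24_6_3_0 : is_full 24 79 6 3 0.
Proof.
apply: (@full_check _ _ _ _ _
    [:: 2; 10; 11; 12; 5; 14; 16; 22; 3; 8; 14; 18; 0; 3; 15; 16; 1; 3; 13; 23; 4; 6;
    7; 21]
    [:: 14; 20; 9; 16; 17; 19]
    [:: 0; 1; 12; 0; 2; 8; 0; 4; 23; 0; 5; 7; 0; 6; 10; 0; 9; 14; 0; 11; 17; 0; 13; 18;
    0; 19; 21; 0; 20; 22; 1; 2; 14; 1; 4; 17; 1; 5; 8; 1; 6; 20; 1; 7; 22; 1; 9; 18; 1;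
    10; 19; 1; 11; 15; 1; 16; 21; 2; 3; 21; 2; 4; 5; 2; 6; 18; 2; 7; 20; 2; 9; 15; 2;
    13; 16; 2; 17; 23; 2; 19; 22; 3; 4; 12; 3; 5; 10; 3; 6; 17; 3; 7; 11; 3; 9; 22; 3;
    19; 20; 4; 8; 16; 4; 9; 10; 4; 11; 22; 4; 13; 14; 4; 15; 20; 4; 18; 19; 5; 6; 15;
    5; 9; 20; 5; 11; 18; 5; 12; 21; 5; 13; 17; 5; 19; 23; 6; 8; 9; 6; 11; 13; 6; 12;
    16; 6; 14; 19; 6; 22; 23; 7; 8; 17; 7; 9; 13; 7; 10; 15; 7; 12; 14; 7; 16; 19; 7;
    18; 23; 8; 10; 13; 8; 11; 21; 8; 12; 19; 8; 15; 22; 8; 20; 23; 9; 11; 19; 9; 12;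
    23; 9; 17; 21; 10; 14; 21; 10; 16; 23; 10; 17; 22; 10; 18; 20; 11; 14; 23; 11; 16;
    20; 12; 13; 22; 12; 15; 18; 12; 17; 20; 13; 15; 19; 13; 20; 21; 14; 15; 17; 15; 21;
    23; 16; 17; 18; 18; 21; 22]
    [::]).
by vm_compute.
Qed.

Lemma full_24_7_0_0 : is_full 24 78 7 0 0.
Proof.
apply: (@full_check _ _ _ _ _
    [:: 4; 5; 17; 22; 8; 10; 14; 16; 0; 13; 18; 23; 3; 6; 8; 21; 2; 8; 15; 19; 7; 9;
    19; 20; 1; 11; 12; 19]
    [::]
    [:: 0; 1; 3; 0; 2; 12; 0; 4; 16; 0; 5; 14; 0; 6; 19; 0; 7; 17; 0; 8; 9; 0; 10; 15;
    0; 11; 22; 0; 20; 21; 1; 2; 6; 1; 4; 20; 1; 5; 16; 1; 7; 8; 1; 9; 23; 1; 10; 22; 1;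
    13; 17; 1; 14; 21; 1; 15; 18; 2; 3; 4; 2; 5; 18; 2; 7; 23; 2; 9; 10; 2; 11; 13; 2;
    14; 22; 2; 16; 20; 2; 17; 21; 3; 5; 19; 3; 7; 15; 3; 9; 17; 3; 10; 13; 3; 11; 14;
    3; 12; 23; 3; 16; 18; 3; 20; 22; 4; 6; 7; 4; 8; 18; 4; 9; 13; 4; 10; 12; 4; 11; 23;
    4; 14; 19; 4; 15; 21; 5; 6; 10; 5; 7; 11; 5; 8; 12; 5; 9; 15; 5; 13; 21; 5; 20; 23;
    6; 9; 14; 6; 11; 16; 6; 12; 13; 6; 15; 22; 6; 17; 23; 6; 18; 20; 7; 10; 21; 7; 12;
    18; 7; 13; 14; 7; 16; 22; 8; 11; 17; 8; 13; 20; 8; 22; 23; 9; 11; 21; 9; 12; 16; 9;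
    18; 22; 10; 11; 18; 10; 17; 20; 10; 19; 23; 11; 15; 20; 12; 14; 20; 12; 15; 17; 12;
    21; 22; 13; 15; 16; 13; 19; 22; 14; 15; 23; 14; 17; 18; 16; 17; 19; 16; 21; 23; 18;
    19; 21]
    [::]).
by vm_compute.
Qed.

Lemma full_24_7_3_0 : is_full 24 77 7 3 0.
Proof.
apply: (@full_check _ _ _ _ _
    [:: 2; 6; 8; 9; 2; 10; 13; 14; 4; 5; 6; 21; 2; 18; 22; 23; 3; 4; 19; 20; 0; 8; 12;
    15; 6; 7; 10; 16]
    [:: 1; 10; 8; 11; 4; 17]
    [:: 0; 1; 17; 0; 2; 3; 0; 4; 22; 0; 5; 18; 0; 6; 14; 0; 7; 11; 0; 9; 23; 0; 10; 19;
    0; 13; 20; 0; 16; 21; 1; 2; 7; 1; 3; 5; 1; 4; 16; 1; 6; 12; 1; 8; 22; 1; 9; 18; 1;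
    11; 15; 1; 13; 21; 1; 14; 19; 1; 20; 23; 2; 4; 11; 2; 5; 16; 2; 12; 20; 2; 15; 21;
    2; 17; 19; 3; 6; 15; 3; 7; 18; 3; 8; 17; 3; 9; 21; 3; 10; 23; 3; 11; 12; 3; 13; 22;
    3; 14; 16; 4; 7; 12; 4; 8; 10; 4; 9; 13; 4; 14; 23; 4; 15; 18; 5; 7; 9; 5; 8; 14;
    5; 10; 22; 5; 11; 19; 5; 12; 13; 5; 15; 20; 5; 17; 23; 6; 11; 22; 6; 13; 17; 6; 18;
    20; 6; 19; 23; 7; 8; 20; 7; 13; 19; 7; 14; 17; 7; 15; 23; 7; 21; 22; 8; 13; 18; 8;
    16; 23; 8; 19; 21; 9; 10; 20; 9; 11; 17; 9; 12; 14; 9; 15; 19; 9; 16; 22; 10; 11;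
    21; 10; 12; 18; 10; 15; 17; 11; 13; 23; 11; 14; 18; 11; 16; 20; 12; 16; 17; 12; 19;
    22; 12; 21; 23; 13; 15; 16; 14; 15; 22; 14; 20; 21; 16; 18; 19; 17; 18; 21; 17; 20;
    22]
    [::]).
by vm_compute.
Qed.

Lemma full_24_8_0_0 : is_full 24 76 8 0 0.
Proof.
apply: (@full_check _ _ _ _ _
    [:: 5; 6; 15; 17; 0; 3; 14; 17; 9; 11; 19; 20; 0; 13; 18; 23; 1; 4; 12; 17; 7; 9;
    10; 18; 2; 16; 18; 22; 0; 8; 9; 21]
    [::]
    [:: 0; 1; 10; 0; 2; 5; 0; 4; 20; 0; 6; 11; 0; 7; 15; 0; 12; 16; 0; 19; 22; 1; 2;
    11; 1; 3; 16; 1; 5; 22; 1; 6; 7; 1; 8; 14; 1; 9; 13; 1; 15; 20; 1; 18; 21; 1; 19;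
    23; 2; 3; 21; 2; 4; 6; 2; 7; 23; 2; 8; 20; 2; 9; 12; 2; 10; 14; 2; 13; 15; 2; 17;
    19; 3; 4; 7; 3; 5; 19; 3; 6; 8; 3; 9; 15; 3; 10; 11; 3; 12; 23; 3; 13; 22; 3; 18;
    20; 4; 5; 18; 4; 8; 19; 4; 9; 23; 4; 10; 15; 4; 11; 16; 4; 13; 21; 4; 14; 22; 5; 7;
    12; 5; 8; 23; 5; 9; 14; 5; 10; 20; 5; 11; 13; 5; 16; 21; 6; 9; 16; 6; 10; 12; 6;
    13; 14; 6; 18; 19; 6; 20; 21; 6; 22; 23; 7; 8; 16; 7; 11; 14; 7; 13; 19; 7; 17; 21;
    7; 20; 22; 8; 10; 22; 8; 11; 15; 8; 12; 18; 8; 13; 17; 9; 17; 22; 10; 13; 16; 10;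
    17; 23; 10; 19; 21; 11; 12; 22; 11; 17; 18; 11; 21; 23; 12; 13; 20; 12; 14; 21; 12;
    15; 19; 14; 15; 18; 14; 16; 19; 14; 20; 23; 15; 16; 23; 15; 21; 22; 16; 17; 20]
    [::]).
by vm_compute.
Qed.

Lemma full_24_9_0_0 : is_full 24 74 9 0 0.
Proof.
apply: (@full_check _ _ _ _ _
    [:: 4; 8; 10; 17; 7; 9; 18; 22; 6; 10; 15; 21; 3; 7; 8; 15; 0; 2; 5; 17; 1; 2; 10;
    19; 7; 13; 16; 17; 8; 11; 12; 23; 2; 14; 15; 20]
    [::]
    [:: 0; 1; 12; 0; 3; 18; 0; 4; 15; 0; 6; 22; 0; 7; 14; 0; 8; 19; 0; 9; 23; 0; 10;
    16; 0; 11; 13; 0; 20; 21; 1; 3; 17; 1; 4; 20; 1; 5; 16; 1; 6; 18; 1; 7; 11; 1; 8;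
    14; 1; 9; 13; 1; 15; 22; 1; 21; 23; 2; 3; 13; 2; 4; 22; 2; 6; 7; 2; 8; 16; 2; 9;
    12; 2; 11; 21; 2; 18; 23; 3; 4; 6; 3; 5; 23; 3; 9; 10; 3; 11; 20; 3; 12; 22; 3; 14;
    16; 3; 19; 21; 4; 5; 19; 4; 7; 21; 4; 9; 11; 4; 12; 13; 4; 14; 23; 4; 16; 18; 5; 6;
    11; 5; 7; 20; 5; 8; 22; 5; 9; 14; 5; 10; 13; 5; 12; 15; 5; 18; 21; 6; 8; 9; 6; 12;
    16; 6; 13; 14; 6; 17; 19; 6; 20; 23; 7; 10; 23; 7; 12; 19; 8; 13; 21; 8; 18; 20; 9;
    15; 19; 9; 16; 21; 9; 17; 20; 10; 11; 22; 10; 12; 20; 10; 14; 18; 11; 14; 17; 11;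
    15; 16; 11; 18; 19; 12; 14; 21; 12; 17; 18; 13; 15; 18; 13; 19; 20; 13; 22; 23; 14;
    19; 22; 15; 17; 23; 16; 19; 23; 16; 20; 22; 17; 21; 22]
    [::]).
by vm_compute.
Qed.

Lemma full_24_10_0_0 : is_full 24 72 10 0 0.
Proof.
apply: (@full_check _ _ _ _ _
    [:: 7; 11; 12; 20; 4; 5; 9; 11; 1; 2; 6; 14; 2; 8; 13; 16; 3; 8; 15; 19; 11; 18;
    19; 23; 5; 8; 10; 23; 5; 6; 19; 20; 2; 20; 22; 23; 0; 6; 17; 21]
    [::]
    [:: 0; 1; 23; 0; 2; 3; 0; 4; 7; 0; 5; 22; 0; 8; 12; 0; 9; 15; 0; 10; 19; 0; 11; 13;
    0; 14; 18; 0; 16; 20; 1; 3; 4; 1; 5; 15; 1; 7; 18; 1; 8; 17; 1; 9; 16; 1; 10; 20;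
    1; 11; 22; 1; 12; 13; 1; 19; 21; 2; 4; 19; 2; 5; 18; 2; 7; 10; 2; 9; 17; 2; 11; 21;
    2; 12; 15; 3; 5; 14; 3; 6; 10; 3; 7; 13; 3; 9; 20; 3; 11; 16; 3; 12; 21; 3; 17; 23;
    3; 18; 22; 4; 6; 18; 4; 8; 21; 4; 10; 12; 4; 13; 15; 4; 14; 20; 4; 16; 23; 4; 17;
    22; 5; 7; 21; 5; 12; 16; 5; 13; 17; 6; 7; 16; 6; 8; 9; 6; 11; 15; 6; 12; 23; 6; 13;
    22; 7; 8; 22; 7; 9; 19; 7; 14; 17; 7; 15; 23; 8; 11; 14; 8; 18; 20; 9; 10; 22; 9;
    12; 14; 9; 13; 23; 9; 18; 21; 10; 11; 17; 10; 13; 18; 10; 14; 15; 10; 16; 21; 12;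
    17; 18; 12; 19; 22; 13; 14; 19; 13; 20; 21; 14; 16; 22; 14; 21; 23; 15; 16; 18; 15;
    17; 20; 15; 21; 22; 16; 17; 19]
    [::]).
by vm_compute.
Qed.

Lemma full_24_11_0_0 : is_full 24 70 11 0 0.
Proof.
apply: (@full_check _ _ _ _ _
    [:: 11; 13; 21; 23; 1; 5; 6; 8; 3; 9; 20; 23; 0; 4; 10; 16; 7; 12; 13; 17; 2; 19;
    21; 22; 6; 9; 16; 17; 6; 10; 12; 22; 14; 17; 22; 23; 9; 10; 13; 18; 12; 15; 16; 21]
    [::]
    [:: 0; 1; 21; 0; 2; 12; 0; 3; 11; 0; 5; 22; 0; 6; 13; 0; 7; 14; 0; 8; 17; 0; 9; 19;
    0; 15; 23; 0; 18; 20; 1; 2; 7; 1; 3; 17; 1; 4; 18; 1; 9; 12; 1; 10; 11; 1; 13; 22;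
    1; 14; 15; 1; 16; 23; 1; 19; 20; 2; 3; 8; 2; 4; 23; 2; 5; 18; 2; 6; 20; 2; 9; 14;
    2; 10; 17; 2; 11; 16; 2; 13; 15; 3; 4; 6; 3; 5; 12; 3; 7; 15; 3; 10; 14; 3; 13; 19;
    3; 16; 22; 3; 18; 21; 4; 5; 15; 4; 7; 9; 4; 8; 14; 4; 11; 22; 4; 12; 19; 4; 13; 20;
    4; 17; 21; 5; 7; 23; 5; 9; 21; 5; 10; 20; 5; 11; 17; 5; 13; 14; 5; 16; 19; 6; 7;
    11; 6; 14; 21; 6; 15; 19; 6; 18; 23; 7; 8; 19; 7; 10; 21; 7; 16; 18; 7; 20; 22; 8;
    9; 11; 8; 10; 15; 8; 12; 23; 8; 13; 16; 8; 18; 22; 8; 20; 21; 9; 15; 22; 10; 19;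
    23; 11; 12; 20; 11; 14; 19; 11; 15; 18; 12; 14; 18; 14; 16; 20; 15; 17; 20; 17; 18;
    19]
    [::]).
by vm_compute.
Qed.

Lemma full_25_0_0_0 : is_full 25 100 0 0 0.
Proof.
apply: (@full_check _ _ _ _ _
    [::]
    [::]
    [:: 0; 1; 21; 0; 2; 7; 0; 3; 11; 0; 4; 14; 0; 5; 22; 0; 6; 15; 0; 8; 10; 0; 9; 16;
    0; 12; 24; 0; 13; 19; 0; 17; 18; 0; 20; 23; 1; 2; 18; 1; 3; 17; 1; 4; 5; 1; 6; 12;
    1; 7; 15; 1; 8; 20; 1; 9; 13; 1; 10; 23; 1; 11; 22; 1; 14; 24; 1; 16; 19; 2; 3; 20;
    2; 4; 6; 2; 5; 8; 2; 9; 22; 2; 10; 12; 2; 11; 21; 2; 13; 15; 2; 14; 17; 2; 16; 24;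
    2; 19; 23; 3; 4; 9; 3; 5; 19; 3; 6; 16; 3; 7; 22; 3; 8; 24; 3; 10; 21; 3; 12; 15;
    3; 13; 14; 3; 18; 23; 4; 7; 23; 4; 8; 21; 4; 10; 13; 4; 11; 24; 4; 12; 17; 4; 15;
    18; 4; 16; 20; 4; 19; 22; 5; 6; 18; 5; 7; 24; 5; 9; 17; 5; 10; 14; 5; 11; 16; 5;
    12; 20; 5; 13; 23; 5; 15; 21; 6; 7; 10; 6; 8; 13; 6; 9; 21; 6; 11; 20; 6; 14; 19;
    6; 17; 24; 6; 22; 23; 7; 8; 17; 7; 9; 18; 7; 11; 14; 7; 12; 21; 7; 13; 16; 7; 19;
    20; 8; 9; 23; 8; 11; 18; 8; 12; 19; 8; 14; 22; 8; 15; 16; 9; 10; 20; 9; 11; 19; 9;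
    12; 14; 9; 15; 24; 10; 11; 15; 10; 16; 18; 10; 17; 22; 10; 19; 24; 11; 12; 23; 11;
    13; 17; 12; 13; 18; 12; 16; 22; 13; 20; 24; 13; 21; 22; 14; 15; 23; 14; 16; 21; 14;
    18; 20; 15; 17; 19; 15; 20; 22; 16; 17; 23; 17; 20; 21; 18; 19; 21; 18; 22; 24; 21;
    23; 24]
    [::]).
by vm_compute.
Qed.

Lemma full_25_4_3_0 : is_full 25 91 4 3 0.
Proof.
apply: (@full_check _ _ _ _ _
    [:: 0; 4; 5; 6; 1; 4; 7; 8; 2; 5; 7; 9; 3; 6; 8; 9]
    [:: 0; 1; 0; 2; 0; 3]
    [:: 0; 7; 11; 0; 8; 21; 0; 9; 12; 0; 10; 18; 0; 13; 17; 0; 14; 15; 0; 16; 24; 0;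
    19; 20; 0; 22; 23; 1; 2; 19; 1; 3; 20; 1; 5; 17; 1; 6; 10; 1; 9; 24; 1; 11; 18; 1;
    12; 14; 1; 13; 21; 1; 15; 22; 1; 16; 23; 2; 3; 15; 2; 4; 14; 2; 6; 18; 2; 8; 11; 2;
    10; 17; 2; 12; 21; 2; 13; 22; 2; 16; 20; 2; 23; 24; 3; 4; 13; 3; 5; 23; 3; 7; 22;
    3; 10; 24; 3; 11; 21; 3; 12; 18; 3; 14; 16; 3; 17; 19; 4; 9; 15; 4; 10; 21; 4; 11;
    19; 4; 12; 23; 4; 16; 22; 4; 17; 20; 4; 18; 24; 5; 8; 12; 5; 10; 22; 5; 11; 15; 5;
    13; 14; 5; 16; 21; 5; 18; 19; 5; 20; 24; 6; 7; 21; 6; 11; 16; 6; 12; 19; 6; 13; 24;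
    6; 14; 22; 6; 15; 20; 6; 17; 23; 7; 10; 15; 7; 12; 20; 7; 13; 19; 7; 14; 24; 7; 16;
    17; 7; 18; 23; 8; 10; 20; 8; 13; 16; 8; 14; 23; 8; 15; 17; 8; 18; 22; 8; 19; 24; 9;
    10; 13; 9; 11; 14; 9; 16; 18; 9; 17; 21; 9; 19; 22; 9; 20; 23; 10; 11; 23; 10; 12;
    16; 10; 14; 19; 11; 12; 13; 11; 17; 24; 11; 20; 22; 12; 15; 24; 12; 17; 22; 13; 15;
    23; 13; 18; 20; 14; 17; 18; 14; 20; 21; 15; 16; 19; 15; 18; 21; 19; 21; 23; 21; 22;
    24]
    [::]).
by vm_compute.
Qed.

Lemma full_25_5_0_0 : is_full 25 90 5 0 0.
Proof.
apply: (@full_check _ _ _ _ _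
    [:: 0; 13; 21; 23; 7; 10; 13; 19; 3; 7; 14; 23; 12; 14; 19; 21; 0; 3; 10; 12]
    [::]
    [:: 0; 1; 18; 0; 2; 14; 0; 4; 9; 0; 5; 8; 0; 6; 11; 0; 7; 15; 0; 16; 19; 0; 17; 20;
    0; 22; 24; 1; 2; 21; 1; 3; 5; 1; 4; 22; 1; 6; 23; 1; 7; 11; 1; 8; 17; 1; 9; 15; 1;
    10; 14; 1; 12; 24; 1; 13; 16; 1; 19; 20; 2; 3; 18; 2; 4; 7; 2; 5; 9; 2; 6; 24; 2;
    8; 20; 2; 10; 17; 2; 11; 16; 2; 12; 15; 2; 13; 22; 2; 19; 23; 3; 4; 17; 3; 6; 8; 3;
    9; 21; 3; 11; 15; 3; 13; 20; 3; 16; 22; 3; 19; 24; 4; 5; 20; 4; 6; 12; 4; 8; 10; 4;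
    11; 23; 4; 13; 24; 4; 14; 18; 4; 15; 19; 4; 16; 21; 5; 6; 13; 5; 7; 12; 5; 10; 16;
    5; 11; 14; 5; 15; 24; 5; 17; 21; 5; 18; 19; 5; 22; 23; 6; 7; 20; 6; 9; 10; 6; 14;
    22; 6; 15; 16; 6; 17; 19; 6; 18; 21; 7; 8; 21; 7; 9; 24; 7; 16; 17; 7; 18; 22; 8;
    9; 14; 8; 11; 19; 8; 12; 16; 8; 13; 18; 8; 15; 22; 8; 23; 24; 9; 11; 20; 9; 12; 18;
    9; 13; 17; 9; 16; 23; 9; 19; 22; 10; 11; 18; 10; 15; 23; 10; 20; 24; 10; 21; 22;
    11; 12; 13; 11; 17; 22; 11; 21; 24; 12; 17; 23; 12; 20; 22; 13; 14; 15; 14; 16; 20;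
    14; 17; 24; 15; 17; 18; 15; 20; 21; 16; 18; 24; 18; 20; 23]
    [::]).
by vm_compute.
Qed.

Lemma full_25_8_0_0 : is_full 25 84 8 0 0.
Proof.
apply: (@full_check _ _ _ _ _
    [:: 0; 1; 4; 6; 0; 9; 18; 23; 1; 10; 11; 23; 6; 9; 13; 20; 4; 12; 16; 21; 0; 11;
    12; 15; 15; 16; 18; 20; 0; 10; 13; 21]
    [::]
    [:: 0; 2; 19; 0; 3; 20; 0; 5; 16; 0; 7; 14; 0; 8; 17; 0; 22; 24; 1; 2; 15; 1; 3; 7;
    1; 5; 17; 1; 8; 12; 1; 9; 16; 1; 13; 24; 1; 14; 20; 1; 18; 22; 1; 19; 21; 2; 3; 4;
    2; 5; 22; 2; 6; 23; 2; 7; 13; 2; 8; 18; 2; 9; 10; 2; 11; 21; 2; 12; 14; 2; 16; 24;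
    2; 17; 20; 3; 5; 11; 3; 6; 19; 3; 8; 16; 3; 9; 15; 3; 10; 22; 3; 12; 18; 3; 13; 14;
    3; 17; 21; 3; 23; 24; 4; 5; 23; 4; 7; 22; 4; 8; 15; 4; 9; 19; 4; 10; 20; 4; 11; 14;
    4; 13; 18; 4; 17; 24; 5; 6; 18; 5; 7; 20; 5; 8; 14; 5; 9; 12; 5; 10; 19; 5; 13; 15;
    5; 21; 24; 6; 7; 24; 6; 8; 21; 6; 10; 12; 6; 11; 22; 6; 14; 15; 6; 16; 17; 7; 8;
    19; 7; 9; 17; 7; 10; 18; 7; 11; 16; 7; 12; 23; 7; 15; 21; 8; 9; 11; 8; 10; 24; 8;
    13; 23; 8; 20; 22; 9; 14; 24; 9; 21; 22; 10; 14; 16; 10; 15; 17; 11; 13; 17; 11;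
    18; 24; 11; 19; 20; 12; 13; 19; 12; 17; 22; 12; 20; 24; 13; 16; 22; 14; 17; 23; 14;
    18; 21; 14; 19; 22; 15; 19; 24; 15; 22; 23; 16; 19; 23; 17; 18; 19; 20; 21; 23]
    [::]).
by vm_compute.
Qed.

Lemma full_25_9_0_0 : is_full 25 82 9 0 0.
Proof.
apply: (@full_check _ _ _ _ _
    [:: 7; 8; 11; 23; 8; 10; 13; 19; 3; 15; 20; 24; 13; 20; 22; 23; 12; 16; 17; 19; 9;
    11; 12; 13; 3; 6; 7; 17; 6; 13; 15; 16; 9; 10; 22; 24]
    [::]
    [:: 0; 1; 21; 0; 2; 12; 0; 3; 9; 0; 4; 18; 0; 5; 15; 0; 6; 10; 0; 7; 19; 0; 8; 17;
    0; 11; 22; 0; 13; 24; 0; 14; 23; 0; 16; 20; 1; 2; 7; 1; 3; 14; 1; 4; 22; 1; 5; 8;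
    1; 6; 18; 1; 9; 15; 1; 10; 16; 1; 11; 20; 1; 12; 24; 1; 13; 17; 1; 19; 23; 2; 3;
    19; 2; 4; 10; 2; 5; 13; 2; 6; 22; 2; 8; 15; 2; 9; 17; 2; 11; 21; 2; 14; 16; 2; 18;
    20; 2; 23; 24; 3; 4; 13; 3; 5; 22; 3; 8; 21; 3; 10; 12; 3; 11; 18; 3; 16; 23; 4; 5;
    12; 4; 6; 11; 4; 7; 16; 4; 8; 24; 4; 9; 21; 4; 14; 17; 4; 15; 23; 4; 19; 20; 5; 6;
    21; 5; 7; 24; 5; 9; 23; 5; 10; 18; 5; 11; 16; 5; 14; 19; 5; 17; 20; 6; 8; 20; 6; 9;
    19; 6; 12; 23; 6; 14; 24; 7; 9; 20; 7; 10; 15; 7; 12; 21; 7; 13; 18; 7; 14; 22; 8;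
    9; 14; 8; 12; 18; 8; 16; 22; 9; 16; 18; 10; 11; 14; 10; 17; 23; 10; 20; 21; 11; 15;
    17; 11; 19; 24; 12; 14; 20; 12; 15; 22; 13; 14; 21; 14; 15; 18; 15; 19; 21; 16; 21;
    24; 17; 18; 24; 17; 21; 22; 18; 19; 22; 18; 21; 23]
    [::]).
by vm_compute.
Qed.

Lemma full_25_10_0_0 : is_full 25 80 10 0 0.
Proof.
apply: (@full_check _ _ _ _ _
    [:: 3; 5; 12; 17; 5; 11; 15; 20; 4; 8; 18; 20; 7; 8; 10; 14; 0; 4; 16; 21; 9; 14;
    17; 22; 9; 11; 19; 24; 7; 16; 18; 19; 0; 3; 10; 22; 12; 15; 21; 24]
    [::]
    [:: 0; 1; 8; 0; 2; 14; 0; 5; 18; 0; 6; 23; 0; 7; 12; 0; 9; 20; 0; 11; 17; 0; 13;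
    24; 0; 15; 19; 1; 2; 23; 1; 3; 20; 1; 4; 17; 1; 5; 16; 1; 6; 22; 1; 7; 11; 1; 9;
    15; 1; 10; 12; 1; 13; 14; 1; 18; 24; 1; 19; 21; 2; 3; 18; 2; 4; 15; 2; 5; 13; 2; 6;
    20; 2; 7; 24; 2; 8; 11; 2; 9; 10; 2; 12; 19; 2; 16; 17; 2; 21; 22; 3; 4; 23; 3; 6;
    19; 3; 7; 13; 3; 8; 9; 3; 11; 21; 3; 14; 15; 3; 16; 24; 4; 5; 22; 4; 6; 12; 4; 7;
    9; 4; 10; 24; 4; 11; 14; 4; 13; 19; 5; 6; 10; 5; 7; 21; 5; 8; 19; 5; 9; 23; 5; 14;
    24; 6; 7; 15; 6; 8; 16; 6; 9; 13; 6; 11; 18; 6; 14; 21; 6; 17; 24; 7; 17; 20; 7;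
    22; 23; 8; 12; 23; 8; 13; 21; 8; 15; 17; 8; 22; 24; 9; 12; 16; 9; 18; 21; 10; 11;
    13; 10; 15; 16; 10; 17; 19; 10; 18; 23; 10; 20; 21; 11; 12; 22; 11; 16; 23; 12; 13;
    20; 12; 14; 18; 13; 15; 23; 13; 16; 22; 13; 17; 18; 14; 16; 20; 14; 19; 23; 15; 18;
    22; 17; 21; 23; 19; 20; 22; 20; 23; 24]
    [::]).
by vm_compute.
Qed.

Lemma full_27_0_0_0 : is_full 27 117 0 0 0.
Proof.
apply: (@full_check _ _ _ _ _
    [::]
    [::]
    [:: 0; 1; 5; 0; 2; 18; 0; 3; 6; 0; 4; 7; 0; 8; 9; 0; 10; 12; 0; 11; 21; 0; 13; 19;
    0; 14; 17; 0; 15; 16; 0; 20; 22; 0; 23; 25; 0; 24; 26; 1; 2; 26; 1; 3; 9; 1; 4; 15;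
    1; 6; 14; 1; 7; 22; 1; 8; 24; 1; 10; 13; 1; 11; 18; 1; 12; 16; 1; 17; 21; 1; 19;
    25; 1; 20; 23; 2; 3; 11; 2; 4; 14; 2; 5; 8; 2; 6; 7; 2; 9; 19; 2; 10; 25; 2; 12;
    23; 2; 13; 20; 2; 15; 22; 2; 16; 21; 2; 17; 24; 3; 4; 8; 3; 5; 18; 3; 7; 10; 3; 12;
    22; 3; 13; 21; 3; 14; 26; 3; 15; 24; 3; 16; 17; 3; 19; 23; 3; 20; 25; 4; 5; 20; 4;
    6; 17; 4; 9; 23; 4; 10; 21; 4; 11; 22; 4; 12; 26; 4; 13; 25; 4; 16; 19; 4; 18; 24;
    5; 6; 19; 5; 7; 12; 5; 9; 25; 5; 10; 11; 5; 13; 14; 5; 15; 26; 5; 16; 24; 5; 17;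
    23; 5; 21; 22; 6; 8; 12; 6; 9; 20; 6; 10; 22; 6; 11; 26; 6; 13; 16; 6; 15; 23; 6;
    18; 25; 6; 21; 24; 7; 8; 25; 7; 9; 26; 7; 11; 24; 7; 13; 23; 7; 14; 21; 7; 15; 19;
    7; 16; 20; 7; 17; 18; 8; 10; 14; 8; 11; 23; 8; 13; 15; 8; 16; 26; 8; 17; 20; 8; 18;
    22; 8; 19; 21; 9; 10; 15; 9; 11; 16; 9; 12; 21; 9; 13; 24; 9; 14; 18; 9; 17; 22;
    10; 16; 18; 10; 17; 19; 10; 20; 24; 10; 23; 26; 11; 12; 25; 11; 13; 17; 11; 14; 15;
    11; 19; 20; 12; 13; 18; 12; 14; 20; 12; 15; 17; 12; 19; 24; 13; 22; 26; 14; 16; 23;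
    14; 19; 22; 14; 24; 25; 15; 18; 20; 15; 21; 25; 16; 22; 25; 17; 25; 26; 18; 19; 26;
    18; 21; 23; 20; 21; 26; 22; 23; 24]
    [::]).
by vm_compute.
Qed.

Lemma full_27_4_3_0 : is_full 27 108 4 3 0.
Proof.
apply: (@full_check _ _ _ _ _
    [:: 0; 4; 5; 6; 1; 4; 7; 8; 2; 5; 7; 9; 3; 6; 8; 9]
    [:: 0; 1; 0; 2; 0; 3]
    [:: 0; 7; 24; 0; 8; 26; 0; 9; 20; 0; 10; 21; 0; 11; 13; 0; 12; 15; 0; 14; 23; 0;
    16; 19; 0; 17; 18; 0; 22; 25; 1; 2; 21; 1; 3; 15; 1; 5; 10; 1; 6; 19; 1; 9; 25; 1;
    11; 24; 1; 12; 13; 1; 14; 20; 1; 16; 22; 1; 17; 23; 1; 18; 26; 2; 3; 23; 2; 4; 16;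
    2; 6; 24; 2; 8; 13; 2; 10; 19; 2; 11; 20; 2; 12; 26; 2; 14; 25; 2; 15; 17; 2; 18;
    22; 3; 4; 13; 3; 5; 22; 3; 7; 19; 3; 10; 25; 3; 11; 14; 3; 12; 17; 3; 16; 18; 3;
    20; 21; 3; 24; 26; 4; 9; 23; 4; 10; 26; 4; 11; 22; 4; 12; 25; 4; 14; 17; 4; 15; 21;
    4; 18; 20; 4; 19; 24; 5; 8; 15; 5; 11; 26; 5; 12; 20; 5; 13; 21; 5; 14; 16; 5; 17;
    19; 5; 18; 24; 5; 23; 25; 6; 7; 13; 6; 10; 15; 6; 11; 21; 6; 12; 22; 6; 14; 18; 6;
    16; 26; 6; 17; 25; 6; 20; 23; 7; 10; 14; 7; 11; 23; 7; 12; 21; 7; 15; 22; 7; 16;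
    20; 7; 17; 26; 7; 18; 25; 8; 10; 16; 8; 11; 25; 8; 12; 18; 8; 14; 21; 8; 17; 22; 8;
    19; 23; 8; 20; 24; 9; 10; 24; 9; 11; 18; 9; 12; 16; 9; 13; 15; 9; 14; 22; 9; 17;
    21; 9; 19; 26; 10; 11; 17; 10; 12; 23; 10; 13; 18; 10; 20; 22; 11; 12; 19; 11; 15;
    16; 12; 14; 24; 13; 14; 26; 13; 16; 25; 13; 17; 20; 13; 19; 22; 13; 23; 24; 14; 15;
    19; 15; 18; 23; 15; 20; 26; 15; 24; 25; 16; 17; 24; 16; 21; 23; 18; 19; 21; 19; 20;
    25; 21; 22; 24; 21; 25; 26; 22; 23; 26]
    [::]).
by vm_compute.
Qed.

Lemma full_27_8_0_0 : is_full 27 101 8 0 0.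
Proof.
apply: (@full_check _ _ _ _ _
    [:: 3; 6; 8; 17; 4; 15; 17; 26; 12; 16; 18; 23; 0; 5; 12; 26; 3; 11; 23; 25; 4; 8;
    11; 13; 0; 6; 18; 25; 5; 13; 15; 16]
    [::]
    [:: 0; 1; 10; 0; 2; 13; 0; 3; 19; 0; 4; 14; 0; 7; 16; 0; 8; 15; 0; 9; 20; 0; 11;
    21; 0; 17; 24; 0; 22; 23; 1; 2; 19; 1; 3; 21; 1; 4; 9; 1; 5; 18; 1; 6; 23; 1; 7;
    17; 1; 8; 12; 1; 11; 14; 1; 13; 24; 1; 15; 22; 1; 16; 20; 1; 25; 26; 2; 3; 5; 2; 4;
    23; 2; 6; 15; 2; 7; 22; 2; 8; 18; 2; 9; 17; 2; 10; 14; 2; 11; 24; 2; 12; 25; 2; 16;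
    26; 2; 20; 21; 3; 4; 20; 3; 7; 10; 3; 9; 16; 3; 12; 15; 3; 13; 26; 3; 14; 22; 3;
    18; 24; 4; 5; 22; 4; 6; 19; 4; 7; 18; 4; 10; 24; 4; 12; 21; 4; 16; 25; 5; 6; 20; 5;
    7; 21; 5; 8; 14; 5; 9; 10; 5; 11; 17; 5; 19; 25; 5; 23; 24; 6; 7; 11; 6; 9; 12; 6;
    10; 22; 6; 13; 21; 6; 14; 26; 6; 16; 24; 7; 8; 20; 7; 9; 14; 7; 12; 24; 7; 13; 25;
    7; 15; 23; 7; 19; 26; 8; 9; 23; 8; 10; 25; 8; 16; 22; 8; 19; 24; 8; 21; 26; 9; 11;
    18; 9; 13; 22; 9; 15; 25; 9; 19; 21; 9; 24; 26; 10; 11; 26; 10; 12; 20; 10; 13; 23;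
    10; 15; 19; 10; 16; 21; 10; 17; 18; 11; 12; 22; 11; 15; 20; 11; 16; 19; 12; 13; 14;
    12; 17; 19; 13; 17; 20; 13; 18; 19; 14; 15; 24; 14; 16; 17; 14; 18; 20; 14; 19; 23;
    14; 21; 25; 15; 18; 21; 17; 21; 23; 17; 22; 25; 18; 22; 26; 19; 20; 22; 20; 23; 26;
    20; 24; 25; 21; 22; 24]
    [::]).
by vm_compute.
Qed.

Lemma full_27_9_0_0 : is_full 27 99 9 0 0.
Proof.
apply: (@full_check _ _ _ _ _
    [:: 2; 5; 18; 20; 5; 12; 13; 25; 4; 16; 18; 22; 0; 15; 17; 24; 3; 9; 17; 21; 2; 12;
    19; 24; 0; 4; 9; 19; 20; 21; 22; 25; 3; 13; 15; 16]
    [::]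
    [:: 0; 1; 14; 0; 2; 25; 0; 3; 6; 0; 5; 22; 0; 7; 18; 0; 8; 20; 0; 10; 12; 0; 11;
    13; 0; 16; 26; 0; 21; 23; 1; 2; 8; 1; 3; 25; 1; 4; 11; 1; 5; 16; 1; 6; 21; 1; 7;
    15; 1; 9; 12; 1; 10; 26; 1; 13; 20; 1; 17; 18; 1; 19; 23; 1; 22; 24; 2; 3; 11; 2;
    4; 10; 2; 6; 22; 2; 7; 16; 2; 9; 13; 2; 14; 15; 2; 17; 23; 2; 21; 26; 3; 4; 26; 3;
    5; 14; 3; 7; 24; 3; 8; 10; 3; 12; 20; 3; 18; 19; 3; 22; 23; 4; 5; 17; 4; 6; 13; 4;
    7; 20; 4; 8; 24; 4; 12; 21; 4; 14; 25; 4; 15; 23; 5; 6; 19; 5; 7; 11; 5; 8; 21; 5;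
    9; 10; 5; 15; 26; 5; 23; 24; 6; 7; 10; 6; 8; 23; 6; 9; 24; 6; 11; 14; 6; 12; 16; 6;
    15; 18; 6; 17; 20; 6; 25; 26; 7; 8; 12; 7; 9; 22; 7; 13; 23; 7; 14; 21; 7; 17; 25;
    7; 19; 26; 8; 9; 15; 8; 11; 22; 8; 13; 14; 8; 16; 17; 8; 18; 26; 8; 19; 25; 9; 11;
    16; 9; 14; 18; 9; 20; 26; 9; 23; 25; 10; 11; 19; 10; 13; 22; 10; 14; 17; 10; 15;
    25; 10; 16; 21; 10; 18; 24; 10; 20; 23; 11; 12; 17; 11; 15; 20; 11; 18; 25; 11; 21;
    24; 11; 23; 26; 12; 14; 26; 12; 15; 22; 12; 18; 23; 13; 17; 19; 13; 18; 21; 13; 24;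
    26; 14; 16; 23; 14; 19; 22; 14; 20; 24; 15; 19; 21; 16; 19; 20; 16; 24; 25; 17; 22;
    26]
    [::]).
by vm_compute.
Qed.

(** * Pairwise balanced designs with block sizes 4, 5 and 6 *)

Section TransversalDesign.
Import GRing.Theory.
Local Open Scope ring_scope.
Variables (n : nat) (w : nat -> nat).
Hypotheses (n_gt1 : (1 < n)%N) (n_co6 : coprime n 6).
Hypothesis w_le : forall i, (w i <= n)%N.

(** Over the first five groups this is the affine line with intercept [z.1] and slope [z.2]; the
    sixth group records the slope. *)
Definition td_coord (z : 'Z_n * 'Z_n) (i : nat) : 'Z_n :=
  if (i < 5)%N then z.1 + z.2 *+ i else z.2.

Definition td_line (z : 'Z_n * 'Z_n) : seq (nat * nat) :=
  [seq x <- [seq (i, val (td_coord z i)) | i <- iota 0 6] | (x.2 < w x.1)%N].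

Definition td_point (x : nat * nat) : bool := (x.1 < 6)%N && (x.2 < w x.1)%N.

Lemma mem_td_line z x :
  (x \in td_line z) = td_point x && (x.2 == td_coord z x.1 :> nat).
Proof.
rewrite mem_filter /td_point.
have -> : (x \in [seq (i, val (td_coord z i)) | i <- iota 0 6])
    = (x.1 < 6)%N && (x.2 == td_coord z x.1 :> nat).
  apply/mapP/andP => [[j]|[i6 /eqP e]].
    by rewrite mem_iota => j6 ->.
  by exists x.1; rewrite ?mem_iota // [LHS]surjective_pairing e.
by rewrite andbA [(_ < w _)%N && _]andbC.
Qed.

Lemma td_line_uniq z : uniq (td_line z).
Proof. by rewrite filter_uniq // map_inj_uniq ?iota_uniq // => i j []. Qed.

Lemma Zp_inj_lt (a : nat) (x : 'Z_n) : (a < n)%N -> (a == x :> nat) = (x == a%:R).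
Proof.
move=> an; rewrite -val_eqE /= Zp_nat /= eq_sym.
by rewrite [X in (_ %% X)%N]Zp_cast // modn_small.
Qed.

Lemma unit_small k : (0 < k < 5)%N -> (k%:R : 'Z_n) \is a GRing.unit.
Proof.
move=> k5; rewrite unitZpE //.
have [c2 c3] : coprime n 2 /\ coprime n 3.
  by move: n_co6; rewrite (_ : 6 = 2 * 3)%N // coprimeMr => /andP[].
have c4 : coprime n 4 by rewrite (_ : 4 = 2 * 2)%N // coprimeMr c2.
by case: k k5 => [|[|[|[|[|k]]]]] //; rewrite coprimen1.
Qed.

(* Two points of different groups determine the parameters of the line. *)
Lemma td_unique (x y : nat * nat) : td_point x -> td_point y -> (x.1 < y.1)%N ->
  exists z0, forall z, ((x \in td_line z) && (y \in td_line z)) = (z == z0).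
Proof.
case: x y => [i a] [j b] /= px py ij.
have /andP[/= i6 aw] := px; have /andP[/= j6 bw] := py.
have an := leq_trans aw (w_le i); have bn := leq_trans bw (w_le j).
suff [z0 Hz0] : exists z0 : 'Z_n * 'Z_n, forall z,
    ((td_coord z i == a%:R) && (td_coord z j == b%:R)) = (z == z0).
  by exists z0 => z; rewrite -Hz0 !mem_td_line px py /= (Zp_inj_lt _ an) (Zp_inj_lt _ bn).
have i5 : (i < 5)%N by lia.
rewrite /td_coord i5; case j5: (j < 5)%N; last first.
  exists (a%:R - b%:R *+ i, b%:R) => -[s t] /=; rewrite xpair_eqE.
  case: (eqVneq t b%:R) => [->|_]; last by rewrite !andbF.
  by rewrite !andbT [s == _]eq_sym subr_eq eq_sym.
(* Subtracting the two equations leaves (j - i) t = b - a with j - i at most 4, and 1 to 4 are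
   invertible modulo an n coprime to 6. *)
have uk : ((j - i)%N%:R : 'Z_n) \is a GRing.unit by apply: unit_small; lia.
pose t0 : 'Z_n := (b%:R - a%:R) / (j - i)%N%:R.
have jE (t : 'Z_n) : t *+ j = t *+ i + t *+ (j - i) by rewrite -mulrnDr subnKC // ltnW.
exists (a%:R - t0 *+ i, t0) => -[s t] /=; rewrite xpair_eqE.
apply/andP/andP => [[/eqP sE /eqP tE]|[/eqP -> /eqP ->]].
  have tt0 : t = t0.
    by rewrite /t0 -tE -sE jE addrA [X in X / _]addrC addKr -[t *+ (j - i)]mulr_natr mulrK.
  by rewrite -tt0 -sE addrK eqxx.
by rewrite subrK jE addrA subrK eqxx -[t0 *+ (j - i)]mulr_natr mulrVK // addrC subrK.
Qed.

Lemma td_isdec : isdec (fun x y => (x.1 != y.1) && td_point x && td_point y)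
  [seq td_line z | z <- enum (('Z_n * 'Z_n)%type : finType)].
Proof.
split; first by rewrite all_map; apply/allP => z _ /=; exact: td_line_uniq.
have main (x y : nat * nat) : (x.1 < y.1)%N ->
    pair_count [seq td_line z | z <- enum (('Z_n * 'Z_n)%type : finType)] x y
      = ((x.1 != y.1) && td_point x && td_point y).
  move=> xy; rewrite /pair_count count_map.
  have -> : x.1 != y.1 by rewrite neq_ltn xy.
  case px: (td_point x); last first.
    by rewrite (eq_count (a2 := pred0)) ?count_pred0 // => z; rewrite /= mem_td_line px.
  case py: (td_point y); last first.
    by rewrite (eq_count (a2 := pred0)) ?count_pred0 // => z; rewrite /= !mem_td_line py andbF.
  have [z0 Hz] := td_unique px py xy.
  rewrite (eq_count (a2 := pred1 z0)) => [|z]; last by rewrite /= Hz.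
  by rewrite count_uniq_mem ?enum_uniq // mem_enum.
move=> x y xy; have [e|] := eqVneq x.1 y.1; last first.
  rewrite neq_ltn => /orP[|] lt; first by rewrite main // neq_ltn lt.
  rewrite /pair_count (eq_count (a2 := fun b => (y \in b) && (x \in b))) => [|b].
    by rewrite -/(pair_count _ y x) main // neq_ltn lt /= andbC.
  by rewrite andbC.
rewrite /pair_count count_map (eq_count (a2 := pred0)) ?count_pred0 // => z /=.
rewrite !mem_td_line -e; apply: contraNF xy => /andP[/andP[_ /eqP xE] /andP[_ /eqP yE]].
by rewrite (surjective_pairing x) (surjective_pairing y) -e xE yE.
Qed.

Lemma td_line_size z : (forall i, (i < 4)%N -> w i = n) ->
  (size (td_line z) = 4 + (td_coord z 4 < w 4) + (td_coord z 5 < w 5))%N.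
Proof.
move=> w4; rewrite size_filter count_map.
have lt4 i : (i < 4)%N -> (td_coord z i < w i)%N.
  by move=> i4; rewrite w4 // -{2}(Zp_cast n_gt1).
move: (td_coord z) lt4 => c lt4.
by rewrite /= (lt4 0) ?(lt4 1) ?(lt4 2) ?(lt4 3) //; case: (c 4 < w 4)%N; case: (c 5 < w 5)%N.
Qed.

End TransversalDesign.

Definition size456 (T : Type) (b : seq T) : bool := size b \in [:: 4; 5; 6].

Definition pbd456 (v : nat) : Prop :=
  exists2 B : seq (seq nat), isdec (complete_graph v) B & all (@size456 nat) B.

Lemma size456_gt1 (T : Type) (B : seq (seq T)) :
  all (@size456 T) B -> all (fun b => 1 < size b) B.
Proof. by apply: sub_all => b; rewrite /size456 !inE => /or3P[]/eqP->. Qed.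

Lemma size456_map (T T' : Type) (f : T -> T') (B : seq (seq T)) :
  all (@size456 T') [seq map f b | b <- B] = all (@size456 T) B.
Proof. by rewrite all_map; apply: eq_all => b; rewrite /size456 /= size_map. Qed.

Lemma pbd456_le1 v : v <= 1 -> pbd456 v.
Proof.
move=> v1; exists [::] => //; split=> // x y xy; rewrite /complete_graph.
by case: ltnP => // xv; case: ltnP => // yv; lia.
Qed.

Lemma pbd456_single v : v \in [:: 4; 5; 6] -> pbd456 v.
Proof.
move=> v456; exists [:: iota 0 v]; last by rewrite /= /size456 size_iota v456.
split; first by rewrite /= iota_uniq.
by move=> x y xy; rewrite /pair_count /= !mem_iota !add0n addn0.
Qed.

(** With a single point at infinity a filled group is all of K13. *)
Lemma pbd456_13 : pbd456 13.
Proof.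
have [B dB pB] := fill_1_13_0; exists B; last first.
  have := perm_all (fun k => k \in [:: 4; 5; 6]) pB; rewrite all_map => ->.
  by rewrite /profile /= .
apply: isdec_ext dB _ => x y xy; rewrite /fill_graph /complete_graph.
by case: (ltnP x 13) => // x13; case: (ltnP y 13) => // y13; lia.
Qed.

Definition td_width (n a b i : nat) : nat :=
  if i < 4 then n else if i == 4 then a else if i == 5 then b else 0.

Lemma isdec_group (i k : nat) (B : seq (seq nat)) :
  isdec (complete_graph k) B -> all (@size456 nat) B ->
  isdec (fun x y : nat * nat => [&& x.1 == i, y.1 == i, x.2 < k & y.2 < k])
    [seq map (pair i) b | b <- B].
Proof.
move=> dB sB.
have DB : all (all (fun x => x < k)) B.
  apply: isdec_supp (dB) (size456_gt1 sB) _ => x y _.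
  by rewrite /complete_graph /=; case: (x < k).
have := isdec_map (f := pair i) (f' := snd) (D' := fun x => (x.1 == i) && (x.2 < k)) dB DB.
move=> H; apply: isdec_ext (H _ _) _.
- by move=> x xk; rewrite eqxx.
- by move=> [j x] /andP[/eqP/= -> xk].
move=> x y _; rewrite /complete_graph.
by case: (x.1 == i); case: (y.1 == i); case: (x.2 < k); case: (y.2 < k).
Qed.

(** Groups 0 to 3 of the transversal design are full, group 4 keeps [b] points, and group 5 keeps
    [h] points and becomes the hole; the other groups are filled recursively. A line meeting the
    hole also meets the four full groups, hence has at least five points. *)
Lemma pbd_with_hole n b h : 1 < n -> coprime n 6 -> pbd456 n -> pbd456 b ->
  b <= n -> h <= n ->
  exists Bs : seq (seq (nat * nat)),
    [/\ isdec (fun x y => [&& td_point (td_width n b h) x, td_point (td_width n b h) y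
                  & ~~ ((x.1 == 5) && (y.1 == 5))]) Bs,
        all (@size456 _) Bs
      & all (fun s => has (fun x => x.1 == 5) s ==> (4 < size s)) Bs].
Proof.
move=> n1 n6 [Bn dn sn] [Bb db sb] bn hn; set w := td_width n b h.
have wn i : w i <= n by rewrite /w /td_width; do 3 (case: ifP => // _).
have w4 i : i < 4 -> w i = n by rewrite /w /td_width => ->.
pose L := [seq td_line w z | z <- enum (('Z_n * 'Z_n)%type : finType)].
pose grp (i : nat) := if i == 4 then [seq map (pair i) s | s <- Bb]
            else [seq map (pair i) s | s <- Bn].
exists (L ++ flatten [seq grp i | i <- iota 0 5]).
have sgrp s : s \in flatten [seq grp i | i <- iota 0 5] ->
    size456 s /\ ~~ has (fun x => x.1 == 5) s.
  case/flattenP => B /mapP[i]; rewrite mem_iota add0n => /= i5 -> {B}.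
  have sz B : all (@size456 nat) B -> s \in [seq map (pair i) s | s <- B] ->
      size456 s /\ ~~ has (fun x => x.1 == 5) s.
    move=> sB /mapP[s' s'B ->]; split; first by rewrite /size456 size_map; exact: (allP sB).
    by rewrite has_map; apply/hasPn => x _ /=; rewrite neq_ltn i5.
  by rewrite /grp; case: ifP => _; apply: sz.
split.
- have H := isdec_cat (td_isdec n1 n6 wn) (@isdec_flatten _ _ (iota 0 5) (fun i x y =>
    [&& x.1 == i, y.1 == i, x.2 < w i & y.2 < w i]) grp _).
  apply: isdec_ext (H _) _.
    move=> i; rewrite mem_iota add0n => /= i5; rewrite /grp; case: ifP => [/eqP->|i4].
      exact: isdec_group.
    by rewrite w4; [exact: isdec_group | lia].
  move=> x y _; have [e|ne] := eqVneq x.1 y.1.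
    rewrite -e (_ : ~~ true = false) // !andFb add0n /td_point -e andbb.
    case: (ltnP x.1 5) => [x5|x5].
      rewrite (bigD1_seq x.1) ?mem_iota ?iota_uniq // eqxx !andTb.
      rewrite big1 ?addn0 => [|i /negbTE ix]; last by rewrite eq_sym ix.
      by rewrite (leqW x5) !andTb (ltn_eqF x5) andbT /= addn0.
    rewrite big1_seq => [|i /andP[_]]; last first.
      by rewrite mem_iota add0n => /andP[_ i5]; rewrite (gtn_eqF (leq_trans i5 x5)).
    case: (ltnP x.1 6) => //= x6.
    have /eqP-> : x.1 == 5 by rewrite eqn_leq -ltnS x6 x5.
    by rewrite eqxx !andbF.
  rewrite big1 ?addn0 => [|i _]; first last.
    by rewrite (_ : (x.1 == i) && _ = false) //; apply: contra_neqF ne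
       => /and3P[/eqP-> /eqP-> _].
  by rewrite (_ : (x.1 == 5) && (y.1 == 5) = false) ?andbT //; apply: contra_neqF ne
       => /andP[/eqP-> /eqP->].
- rewrite all_cat; apply/andP; split; last by apply/allP => s /sgrp[].
  rewrite all_map; apply/allP => z _ /=; rewrite /size456 td_line_size //.
  by case: (_ < _); case: (_ < _).
rewrite all_cat; apply/andP; split; last first.
  by apply/allP => s /sgrp[_ /negbTE->].
rewrite all_map; apply/allP => z _ /=; apply/implyP => /hasP[x].
rewrite td_line_size // mem_td_line => /andP[/andP[_ xw] /eqP xE] /eqP x5.
have -> : td_coord z 5 < w 5 by rewrite -x5 -xE.
by case: (td_coord z 4 < w 4).
Qed.

Lemma pbd456_td n a b : 1 < n -> coprime n 6 -> pbd456 n -> pbd456 a -> pbd456 b ->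
  a <= n -> b <= n -> pbd456 (4 * n + a + b).
Proof.
move=> n1 n6 Pn Pa Pb an bn.
have [Bs [dBs sBs _]] := pbd_with_hole n1 n6 Pn Pa an bn.
have [Bb db sb] := Pb; have dg := isdec_group 5 db sb.
pose w := td_width n a b; pose D x := td_point w x.
have dB := isdec_cat dBs dg; set B := Bs ++ _ in dB.
have sB : all (@size456 _) B by rewrite all_cat sBs size456_map.
have DB : all (all D) B.
  apply: isdec_supp (dB) (size456_gt1 sB) _ => x y _.
  rewrite addn_gt0 !lt0b => /orP[/and3P[]//|/and4P[/eqP x5 _ xb _]].
  by rewrite /D /td_point x5 /w /td_width.
pose f (x : nat * nat) := if x.1 < 5 then x.1 * n + x.2 else 4 * n + a + x.2.
pose f' k := if k < 4 * n then (k %/ n, k %% n) else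
  if k < 4 * n + a then (4, k - 4 * n) else (5, k - (4 * n + a)).
have n0 : 0 < n by lia.
have H := isdec_map (f := f) (f' := f') (D' := fun k => k < 4 * n + a + b) dB DB.
exists [seq map f s | s <- B]; last by rewrite size456_map.
have fD x : D x -> f x < 4 * n + a + b /\ f' (f x) = x.
  case: x => i x; rewrite /D /td_point /w /td_width /f /f' /=.
  case: (ltnP i 4) => [i4|i4].
    rewrite (ltn_trans i4) // (ltn_trans i4) //= => xn.
    have lt : i * n + x < 4 * n by nia.
    by rewrite lt divnMDl // divn_small // addn0 modnMDl modn_small //; split; [lia|].
  case: (ltnP i 5) => [i5|i5].
    have -> : i = 4 by lia.
    move=> /= xa; have e1 : (4 * n + x < 4 * n) = false by lia.
    have e2 : 4 * n + x < 4 * n + a by lia.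
    by rewrite e1 e2 addKn; split=> //; lia.
  case: (ltnP i 6) => //= i6; have -> : i = 5 by lia.
  move=> /= xb; have e1 : (4 * n + a + x < 4 * n) = false by lia.
  have e2 : (4 * n + a + x < 4 * n + a) = false by lia.
  by rewrite e1 e2 addKn ltn_add2l.
have f'D k : k < 4 * n + a + b -> D (f' k) /\ f (f' k) = k.
  move=> kv; rewrite /f' /D /td_point /w /td_width /f.
  case: (ltnP k (4 * n)) => [k4|k4] /=.
    have i4 : k %/ n < 4 by rewrite ltn_divLR.
    by rewrite i4 (ltn_trans i4) // (ltn_trans i4) //= ltn_mod n0 -divn_eq.
  case: (ltnP k (4 * n + a)) => [ka|ka] /=; first by split; lia.
  by split; lia.
apply: isdec_ext (H fD f'D) _ => x y xy; rewrite /complete_graph.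
case: (ltnP x _) => xv //=; case: (ltnP y _) => yv //=; rewrite mul1n.
have [Dx fx] := f'D x xv; have [Dy fy] := f'D y yv.
have Px : td_point w (f' x) := Dx; have Py : td_point w (f' y) := Dy.
rewrite -/w Px Py /=.
case: ((f' x).1 =P 5) => [x5|_] //=; case: ((f' y).1 =P 5) => [y5|_] //=.
have /andP[_ xb] := Px; have /andP[_ yb] := Py.
by move: xb yb; rewrite x5 y5 /w /td_width /= => -> ->.
Qed.

(* Under call-by-value reduction [||] and [has] would evaluate all the alternatives. *)
Fixpoint lazy_has (p : pred nat) (s : seq nat) : bool :=
  if s is x :: s' then (if p x then true else lazy_has p s') else false.

Lemma lazy_hasP p s : lazy_has p s -> has p s.
Proof. by elim: s => //= x s IH; case: (p x). Qed.

(** Searches for v = 4 n + a + b with n, a and b already certified in [t]. The listed values are the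
    base cases: at most one point, a single block, and the plane of order 3. *)
Definition pbd_step (t : seq bool) (v : nat) : bool :=
  if v \in [:: 0; 1; 4; 5; 6; 13] then true else
  lazy_has (fun i => let n := v %/ 4 - i in
    if 4 < n then if nth false t n then if coprime n 6 then
      let r := v - 4 * n in
      lazy_has (fun a => if a <= r then if nth false t a then
          if r - a <= n then nth false t (r - a) else false else false else false)
        (iota 0 n.+1)
    else false else false else false)
    (iota 0 (v %/ 4)).

(* [pbd_table k] records, for each [v < k], whether [pbd456 v] follows from the
   trivial designs and the plane of order 3 by iterating [pbd456_td]. *)
Fixpoint pbd_table (k : nat) : seq bool :=
  if k is k'.+1 then let t := pbd_table k' in rcons t (pbd_step t k') else [::].

Lemma size_pbd_table k : size (pbd_table k) = k.
Proof. by elim: k => //= k IH; rewrite size_rcons IH. Qed.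

Lemma pbd_tableP k v : nth false (pbd_table k) v -> pbd456 v.
Proof.
elim: k v => [|k IH] v /=; first by rewrite nth_nil.
rewrite nth_rcons size_pbd_table; case: ifP => [_|_]; first exact: IH.
case: eqP => [->|//]; rewrite /pbd_step; case: ifP => [+ _|_ /lazy_hasP/hasP[i _]].
  rewrite !inE => /orP[/eqP->|]; first exact: pbd456_le1.
  case/orP=> [/eqP->|]; first exact: pbd456_le1.
  case/orP=> [/eqP->|]; first exact: pbd456_single.
  case/orP=> [/eqP->|]; first exact: pbd456_single.
  case/orP=> [/eqP->|/eqP->]; first exact: pbd456_single.
  exact: pbd456_13.
move: (k %/ 4 - i) (leq_subr i (k %/ 4)) => n nk.
case: ifP => // n4; case: ifP => // /IH Sn; case: ifP => // n6 /lazy_hasP/hasP[a].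
rewrite mem_iota add0n => /andP[_ an]; case: ifP => // ar; case: ifP => // /IH Sa.
case: ifP => // rn /IH Sr.
have n4k : 4 * n <= k by move: nk; rewrite leq_divRL // mulnC.
have -> : k = 4 * n + a + (k - 4 * n - a) by lia.
by apply: pbd456_td => //; lia.
Qed.

(** From 229 on the table has no gap up to its end. The end 1221 = 229 + 4 * 248 is where the
    splitting of [split_4n_b] takes over: from there on n is at least 245, while b lies between 229
    and 244. *)
Lemma pbd_table_ok : all id (drop 229 (pbd_table 1221)).
Proof. by vm_compute. Qed.

(** Consecutive integers coprime to 6 differ by 2 or 4. *)
Lemma coprime6_below (k : nat) : 4 < k -> exists2 n, k <= n + 3 & (n <= k) && coprime n 6.
Proof.
move=> k4; have e : k = k %/ 6 * 6 + k %% 6 := divn_eq k 6.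
have c r j : coprime r 6 -> coprime (j * 6 + r) 6.
  by move=> cr; rewrite coprime_sym /coprime gcdnMDl -/(coprime 6 r) coprime_sym.
have : k %% 6 < 6 by rewrite ltn_mod.
case r: (k %% 6) => [|[|[|[|[|[|]]]]]] // _; rewrite r in e.
- exists ((k %/ 6).-1 * 6 + 5); [lia|]; rewrite c //; lia.
- exists (k %/ 6 * 6 + 1); [lia|]; rewrite c //; lia.
- exists (k %/ 6 * 6 + 1); [lia|]; rewrite c //; lia.
- exists (k %/ 6 * 6 + 1); [lia|]; rewrite c //; lia.
- exists (k %/ 6 * 6 + 1); [lia|]; rewrite c //; lia.
- exists (k %/ 6 * 6 + 5); [lia|]; rewrite c //; lia.
Qed.

Lemma split_4n_b k : 1221 <= k -> exists n b,
  [/\ k = 4 * n + b, coprime n 6, 229 <= b, b <= n & n < k].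
Proof.
move=> k1; have [|n n3 /andP[nk cn]] := @coprime6_below ((k - 229) %/ 4); first lia.
by exists n, (k - 4 * n); split=> //; lia.
Qed.

Lemma pbd456_large v : 229 <= v -> pbd456 v.
Proof.
elim/ltn_ind: v => v IH v229; have [v1221|v1221] := ltnP v 1221.
  apply: (@pbd_tableP 1221).
  have -> : v = 229 + (v - 229) by lia.
  rewrite -nth_drop; apply: (allP pbd_table_ok).
  apply: mem_nth; rewrite size_drop size_pbd_table; lia.
have [n [b [e cn b229 bn nv]]] := split_4n_b v1221.
rewrite e -[4 * n]addn0; apply: pbd456_td => //; try lia.
- by apply: IH => //; lia.
- exact: pbd456_le1.
- by apply: IH => //; lia.
Qed.

Lemma pbd_with_large_hole k h : 1221 <= k -> h <= 229 ->
  exists (P : eqType) (ord hole : seq P) (Bs : seq (seq P)),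
    [/\ uniq (hole ++ ord), size ord = k, size hole = h,
        isdec (fun x y => [&& x \in hole ++ ord, y \in hole ++ ord
                 & ~~ ((x \in hole) && (y \in hole))]) Bs
      & all (@size456 _) Bs /\ all (fun s => has [in hole] s ==> (4 < size s)) Bs].
Proof.
move=> k1 h229; have [n [b [-> cn b229 bn nv]]] := split_4n_b k1.
have [|||||Bs [dBs sBs hBs]] := @pbd_with_hole n b h _ cn; try lia; try exact: pbd456_large; try lia.
  by apply: pbd456_large; lia.
pose w := td_width n b h.
pose ord := [seq (i, x) | i <- iota 0 5, x <- iota 0 (w i)].
pose hole := [seq (5, x) | x <- iota 0 h].
have mh x : (x \in hole) = (x.1 == 5) && (x.2 < h).
  apply/mapP/andP => [[y]|[/eqP x5 xh]].
    by rewrite mem_iota => yh ->.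
  by exists x.2; rewrite ?mem_iota // -x5 -surjective_pairing.
have mo x : (x \in ord) = (x.1 < 5) && (x.2 < w x.1).
  apply/allpairsPdep/andP => [[i [y []]]|[x5 xw]].
    by rewrite !mem_iota => i5 yw ->.
  by exists x.1, x.2; rewrite !mem_iota -surjective_pairing.
have mt x : (x \in hole ++ ord) = td_point w x.
  rewrite mem_cat mh mo /td_point; case: x => i x /=.
  have [i5|i5] := ltnP i 5; first by rewrite (ltn_eqF i5) (ltn_trans i5).
  have [->|i5'] := eqVneq i 5; first by rewrite orbF.
  by rewrite (_ : i < 6 = false) //; lia.
exists (nat * nat)%type, ord, hole, Bs; split.
- rewrite cat_uniq map_inj_uniq ?iota_uniq => [|x y []//] /=.
  rewrite allpairs_uniq_dep ?iota_uniq // => [|i _|[i x] [j y] _ _ /= [-> ->] //]; rewrite ?iota_uniq //=.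
  rewrite andbT; apply/hasPn => x; rewrite mo mh => /andP[x5 _].
  by rewrite (ltn_eqF x5).
- rewrite size_allpairs_dep /= !size_iota /w /td_width /=; lia.
- by rewrite size_map size_iota.
- apply: isdec_ext dBs _ => x y xy; rewrite !mt -/w.
  case px: (td_point w x) => //=; case py: (td_point w y) => //=; rewrite !mh.
  move: px py; rewrite /td_point /w.
  case: eqP => //= x5; case: eqP => //= y5; rewrite ?andbF //=.
  by rewrite x5 y5 /td_width /= => -> ->.
split=> //; apply: sub_all hBs => s /implyP H; apply/implyP => /hasP[x xs].
by rewrite mh => /andP[x5 _]; apply: H; apply/hasP; exists x.
Qed.

(** * Inflating a pairwise balanced design *)

Lemma realizes_full_list (T : eqType) (x0 : T) (s : seq T) t q p f :
  uniq s -> is_full (size s) t q p f ->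
  realizes (fun x y => (x \in s) && (y \in s)) t q p f.
Proof.
move=> us H.
have := @realizes_map _ _ _ _ _ _ _ (nth x0 s) (index^~ s)
  (fun k => k < size s) (mem s) H.
move=> R; apply: realizes_ext (R _ _ _) => /=.
- move=> x y xy; rewrite /complete_graph !index_mem.
  by case: (x \in s); case: (y \in s).
- by move=> x y _; rewrite /complete_graph; case: (x < _).
- by move=> k ks; rewrite mem_nth // index_uniq.
- by move=> x xs; rewrite index_mem nth_index.
Qed.

Lemma sum_bool_count (I : Type) (s : seq I) (p : pred I) :
  \sum_(i <- s) (p i : nat) = count p s.
Proof. by elim: s => [|i s IH]; rewrite ?big_nil ?big_cons //= IH. Qed.

Lemma gdd_width_lt k u i j : ((i, j) \in gdd_points k u) = (i < k) && (j < gdd_width k u i).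
Proof.
apply/allpairsPdep/andP => [[i' [j' []]]|[ik jw]].
  by rewrite !mem_iota => ? ? [-> ->].
by exists i, j; rewrite !mem_iota.
Qed.

Section Inflate.
Variables (P : eqType) (z0 : P) (hol ord : seq P) (Bs : seq (seq P)) (c u : nat).
Let hole := z0 :: hol.
Hypothesis pts_uniq : uniq (hole ++ ord).
Hypothesis Bs_dec : isdec (fun x y => [&& x \in hole ++ ord, y \in hole ++ ord
                 & ~~ ((x \in hole) && (y \in hole))]) Bs.

(* [(Some x, i)] is the [i]-th copy of [x], [(None, i)] the [i]-th point at infinity. *)
Let V : eqType := (option P * nat)%type.

Definition weight (o : option P) : nat :=
  if o is Some x then if x == z0 then u else 12 else c.

Definition copies (os : seq (option P)) : seq V :=
  [seq (o, i) | o <- os, i <- iota 0 (weight o)].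

Lemma mem_copies os (v : V) : (v \in copies os) = (v.1 \in os) && (v.2 < weight v.1).
Proof.
apply/allpairsPdep/andP => [[o [i [oo]]]|[vo vw]].
  by rewrite mem_iota => ? ->.
by exists v.1, v.2; rewrite mem_iota -surjective_pairing.
Qed.

Lemma copies_uniq os : uniq os -> uniq (copies os).
Proof.
move=> uo; apply: allpairs_uniq_dep => // [o _|[o i] [o' i'] _ _ /= [-> ->] //].
exact: iota_uniq.
Qed.

Lemma size_copies os : size (copies os) = sumn [seq weight o | o <- os].
Proof. by rewrite size_allpairs_dep; congr sumn; apply: eq_map => o; rewrite size_iota. Qed.

Definition hole_points : seq V := copies (None :: map Some hole).
Definition all_points : seq V := copies (None :: map Some (hole ++ ord)).

Lemma realizes_fill x t q p : x != z0 -> is_fill c t q p ->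
  realizes (fun a b : V => [&& a.1 \in [:: Some x; None], b.1 \in [:: Some x; None],
      ~~ ((a.1 == None) && (b.1 == None)), a.2 < weight a.1 & b.2 < weight b.1]) t q p 0.
Proof.
move=> xz H.
pose f (k : nat) : V := if k < 12 then (Some x, k) else (None, k - 12).
pose f' (v : V) : nat := if v.1 is Some _ then v.2 else 12 + v.2.
pose D' (v : V) := (v.1 \in [:: Some x; None]) && (v.2 < weight v.1).
have := @realizes_map _ _ _ _ _ _ _ f f' (fun k => k < 12 + c) D' H.
move=> R; apply: realizes_ext (R _ _ _) => /=.
- move=> [a i] [b j] ab; rewrite /D' /f' /fill_graph /=.
  case: a ab => [a|] ab /=; case: b ab => [b|] ab /=; rewrite ?inE /= ?eqxx ?orbT ?orbF ?andbT.
  + case: (Some a =P Some x) => [[->]|] //=; case: (Some b =P Some x) => [[->]|] //=.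
      rewrite (negbTE xz); case: (ltnP i 12) => //= i12; case: (ltnP j 12) => //= j12.
      by rewrite !(ltn_addr c) //.
    by rewrite andbF.
  + case: (Some a =P Some x) => [[->]|] //=.
    rewrite (negbTE xz); case: (ltnP i 12) => //= i12; case: (ltnP j c) => //= jc.
    by rewrite (ltn_addr c) // ltn_add2l jc.
  + case: (Some b =P Some x) => [[->]|] //=; last by rewrite !andbF.
    rewrite (negbTE xz) ltn_add2l; case: (ltnP j 12) => //= j12; rewrite ?andbF //.
    by rewrite (ltn_addr c) // !andbT; case: (i < c).
  + by rewrite [12 + j < 12]ltnNge leq_addr /= !andbF muln0.
- by move=> k l _; rewrite /fill_graph; case: (k < _).
- move=> k kc; rewrite /f /D' /f'; case: ltnP => k12 /=.
    by rewrite ?inE eqxx /= (negbTE xz).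
  by rewrite subnKC // ltn_subLR.
- move=> [[a|] i]; rewrite /D' /f /f' ?inE /=.
    rewrite ?orbF => /andP[/eqP[->]]; rewrite (negbTE xz) => i12.
    by rewrite i12 ltn_addr.
  by move=> ic; rewrite ltn_add2l ic; split=> //; rewrite ?addKn.
Qed.

Lemma realizes_gdd (b : seq P) t q : uniq b ->
  is_gdd (size b) (if z0 \in b then u else 12) t q ->
  realizes (fun v1 v2 : V => [&& v1.1 \in map Some b, v2.1 \in map Some b, v1.1 != v2.1,
      v1.2 < weight v1.1 & v2.2 < weight v2.1]) t q 0 0.
Proof.
move=> ub; set u' := if _ then _ else _; set k := size b => H.
(* The group of exceptional size comes last in [gdd_points], so [z0] is moved to the end of the
   block. *)
pose b' := if z0 \in b then rcons (rem z0 b) z0 else b.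
have pb : perm_eq b' b.
  rewrite /b'; case: ifP => // zb.
  by rewrite perm_rcons perm_sym perm_to_rem.
have sb' : size b' = k := perm_size pb.
have mb' x : (x \in b') = (x \in b) := perm_mem pb x.
have ub' : uniq b' by rewrite (perm_uniq pb).
have wE i : i < k -> weight (Some (nth z0 b' i)) = gdd_width k u' i.
  move=> ik; rewrite /weight /gdd_width /u'.
  case zb: (z0 \in b); last first.
    case: eqP => [e|_]; last by case: ifP.
    by move: zb; rewrite -mb' -e mem_nth // sb'.
  have k0 : 0 < k by apply: leq_trans ik.
  have sr : size (rem z0 b) = k.-1 by rewrite size_rem.
  rewrite /b' zb nth_rcons sr; case: (ltnP i k.-1) => ik1.
    case: eqP => // e; have : z0 \in rem z0 b by rewrite -{1}e mem_nth // sr.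
    by rewrite mem_rem_uniqF.
  by rewrite (_ : i == k.-1) ?eqxx //; lia.
pose f (x : nat * nat) : V := (Some (nth z0 b' x.1), x.2).
pose f' (v : V) : nat * nat := if v.1 is Some x then (index x b', v.2) else (0, 0).
pose D' (v : V) := (v.1 \in map Some b) && (v.2 < weight v.1).
have memS x : (Some x \in map Some b) = (x \in b) by rewrite mem_map // => ? ? [].
have NoneS : (None \in map Some b) = false.
  by apply/negbTE/mapP => -[].
have R := @realizes_map _ _ _ _ _ _ _ f f' [in gdd_points k u'] D' H.
have fD x : x \in gdd_points k u' -> D' (f x) /\ f' (f x) = x.
  case: x => i j; rewrite gdd_width_lt => /andP[ik jw].
  rewrite /D' /f' /f /= memS -mb' mem_nth ?sb' // index_uniq ?sb' //.
  by split=> //; have := wE i ik => /= ->.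
have f'D v : D' v -> f' v \in gdd_points k u' /\ f (f' v) = v.
  case: v => [[x|] j]; rewrite /D' /f' /f /= ?NoneS // memS => /andP[xb jw].
  have ik : index x b' < k by rewrite -sb' index_mem mb'.
  have nx : nth z0 b' (index x b') = x by rewrite nth_index ?mb'.
  by rewrite gdd_width_lt ik -wE // nx.
apply: realizes_ext (R _ fD f'D) => [v1 v2 v12|x y _]; last first.
  by rewrite /gdd_graph; case: (x \in _).
case D1: (D' v1); last first.
  rewrite mul0n; move: D1; rewrite /D'; case: (_ \in _) => //= ->.
  by rewrite !andbF.
case D2: (D' v2); last first.
  rewrite mul0n; move: D2; rewrite /D'; case: (v2.1 \in _) => /= [->|_]; by rewrite !andbF.
rewrite mul1n /gdd_graph; have [-> _] := f'D _ D1; have [-> _] := f'D _ D2.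
move: D1 D2; rewrite /D' => /andP[m1 ->] /andP[m2 ->]; rewrite m1 m2 /= andbT.
case: v1 v2 m1 m2 {v12} => [[x|] i] [[y|] j]; rewrite ?NoneS // !memS /f' /= => xb yb.
congr (nat_of_bool (~~ _)); apply/eqP/eqP => [e|[->]//].
by rewrite -[x](nth_index z0 (s := b')) ?mb' // e nth_index ?mb'.
Qed.

(** A pair of copies is covered by the hole design if both lie over the hole or at infinity, by a
    filling if it lies over one point outside the hole or joins such a copy to infinity, and
    otherwise by the design on the unique block through its two points. *)
Lemma realizes_inflate t0 q0 p0 f0 (gt gq gp bt bq : nat -> nat) :
  is_full (size hole_points) t0 q0 p0 f0 ->
  (forall i, i < size ord -> is_fill c (gt i) (gq i) (gp i)) ->
  (forall i, i < size Bs -> let b := nth [::] Bs i in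
     is_gdd (size b) (if z0 \in b then u else 12) (bt i) (bq i)) ->
  realizes (fun x y => (x \in all_points) && (y \in all_points))
    (t0 + \sum_(0 <= i < size ord) gt i + \sum_(0 <= i < size Bs) bt i)
    (q0 + \sum_(0 <= i < size ord) gq i + \sum_(0 <= i < size Bs) bq i)
    (p0 + \sum_(0 <= i < size ord) gp i) f0.
Proof.
move=> H0 Hg Hb.
have uh : uniq hole by move: pts_uniq; rewrite cat_uniq => /andP[].
have uo : uniq ord by move: pts_uniq; rewrite cat_uniq => /and3P[].
have oh x : x \in ord -> x \notin hole.
  by move: pts_uniq; rewrite cat_uniq => /and3P[_ /hasPn H _]; exact: H.
have oz x : x \in ord -> x != z0.
  by move=> /oh; rewrite inE negb_or => /andP[].
have SomeI : injective (@Some P) by move=> ? ? [].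
have uN (s : seq P) : uniq s -> uniq (None :: map Some s).
  by move=> us; rewrite /= map_inj_uniq // us andbT; apply/mapP => -[].
pose G1 x (a b : V) : nat := [&& a.1 \in [:: Some x; None], b.1 \in [:: Some x; None],
      ~~ ((a.1 == None) && (b.1 == None)), a.2 < weight a.1 & b.2 < weight b.1].
pose G2 s (a b : V) : nat := [&& a.1 \in map Some s, b.1 \in map Some s, a.1 != b.1,
      a.2 < weight a.1 & b.2 < weight b.1].
have R0 := realizes_full_list (None, 0) (copies_uniq (uN _ uh)) H0.
have R1 := @realizes_sum V _ (index_iota 0 (size ord)) (fun i => G1 (nth z0 ord i))
   gt gq gp (fun=> 0).
have R2 := @realizes_sum V _ (index_iota 0 (size Bs)) (fun i => G2 (nth [::] Bs i))
   bt bq (fun=> 0) (fun=> 0).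
have := realizesD (realizesD R0 (R1 _)) (R2 _).
rewrite !big1_eq !addn0 => R; apply: realizes_ext (R _ _) => {R R0 R1 R2}; first last.
- move=> i; rewrite mem_index_iota => /andP[_ iB].
  by apply: realizes_gdd; [apply: (allP (proj1 Bs_dec)); rewrite mem_nth | exact: Hb].
- move=> i; rewrite mem_index_iota => /andP[_ iN].
  by apply: realizes_fill; [apply: oz; rewrite mem_nth | exact: Hg].
move=> [oa i] [ob j] ab; rewrite -(big_nth z0 predT (fun x => G1 x (oa, i) (ob, j))).
rewrite -(big_nth [::] predT (fun x => G2 x (oa, i) (ob, j))).
rewrite /G1 /G2 /hole_points /all_points !mem_copies.
rewrite -![(oa, i).1]/oa -![(oa, i).2]/i -![(ob, j).1]/ob -![(ob, j).2]/j.
case: (ltnP i (weight oa)) => wi; last first.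
  by rewrite !andbF /= !big1 // => *; rewrite !andbF.
case: (ltnP j (weight ob)) => wj; last first.
  by rewrite !andbF /= !big1 // => *; rewrite !andbF.
have mN (s : seq P) : (None \in map Some s) = false by apply/negbTE/mapP => -[].
have mS (s : seq P) (x : P) : (Some x \in map Some s) = (x \in s) by rewrite (mem_map SomeI).
have mNS (s : seq P) o : (o \in None :: map Some s) = if o is Some x then x \in s else true.
  by case: o => [x|]; rewrite inE // mS.
rewrite !sum_bool_count !mNS !andbT.
case: oa ob ab wi wj => [x|] [y|] ab _ _.
- have [xy|xy] := eqVneq x y.
    rewrite [X in _ + X](eq_count (a2 := pred0)) ?count_pred0 => [|s]; last first.
      by rewrite /= xy eqxx !andbF.
    rewrite addn0 -xy !andbb mem_cat.
    rewrite (eq_count (a2 := pred1 x)) ?count_uniq_mem // => [|z]; last first.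
      by rewrite /= ?inE /= ?orbF ?andbT ?andbb ?(inj_eq SomeI) eq_sym.
    by case xo: (x \in ord); [rewrite (negbTE (oh _ xo)) | rewrite orbF addn0].
  rewrite [X in _ + X + _](eq_count (a2 := pred0)) ?count_pred0 ?addn0 => [|z]; last first.
    rewrite /= !inE !orbF andbT !(inj_eq SomeI); apply: contraNF xy.
    by case/andP => /eqP-> /eqP->.
  have [_ /(_ x y xy)] := Bs_dec; rewrite /pair_count => e.
  rewrite (eq_count (a2 := fun b => (x \in b) && (y \in b))) => [|s]; last first.
    by rewrite /= !mS (inj_eq SomeI) xy !andbT.
  rewrite e !mem_cat.
  by case: (x \in hole); case: (y \in hole); case: (x \in ord); case: (y \in ord).
- rewrite [X in _ + X](eq_count (a2 := pred0)) ?count_pred0 ?addn0 => [|s]; last first.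
    by rewrite /= mN andbF.
  rewrite (eq_count (a2 := pred1 x)) ?count_uniq_mem // => [|z]; last first.
    by rewrite /= !inE !orbF !andbT (inj_eq SomeI) eq_sym.
  rewrite !andbT mem_cat.
  by case xo: (x \in ord); [rewrite (negbTE (oh _ xo)) | rewrite orbF addn0].
- rewrite [X in _ + X](eq_count (a2 := pred0)) ?count_pred0 ?addn0 => [|s]; last first.
    by rewrite /= mN.
  rewrite (eq_count (a2 := pred1 y)) ?count_uniq_mem // => [|z]; last first.
    by rewrite /= !inE !orbF !andbT (inj_eq SomeI) eq_sym.
  rewrite mem_cat.
  by case yo: (y \in ord); [rewrite (negbTE (oh _ yo)) | rewrite orbF addn0].
- rewrite [X in _ + X](eq_count (a2 := pred0)) ?count_pred0 ?addn0 => [|s]; last first.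
    by rewrite /= mN.
  by [].
Qed.

End Inflate.

(** * From decompositions to linear hypergraphs *)

Lemma is_full_of_list (T : eqType) (x0 : T) (s : seq T) t q p f :
  uniq s -> realizes (fun x y => (x \in s) && (y \in s)) t q p f ->
  is_full (size s) t q p f.
Proof.
move=> us H.
have R := @realizes_map _ _ _ _ _ _ _ (index^~ s) (nth x0 s)
  (mem s) (fun k => k < size s) H.
apply: realizes_ext (R _ _ _) => /=.
- move=> x y xy; rewrite /complete_graph.
  by case: (ltnP x _) => //= xs; case: (ltnP y _) => //= ys; rewrite !mem_nth.
- by move=> x y _; case: (x \in s).
- by move=> x xs; rewrite index_mem nth_index.
- by move=> k ks; rewrite mem_nth // index_uniq.
Qed.

Lemma sum_pair_count (V : finType) (E : seq {set V}) :
  \sum_(x : V) \sum_(y | x != y) count (fun e : {set V} => (x \in e) && (y \in e)) E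
    = \sum_(e <- E) #|e| * #|e|.-1.
Proof.
elim: E => [|e E IH].
  by rewrite big_nil big1 // => x _; rewrite big1.
rewrite big_cons -IH.
under eq_bigr => x _ do rewrite /= big_split /=.
rewrite big_split /=; congr (_ + _).
rewrite (bigID (mem e)) /= [X in _ + X]big1 => [|x /negbTE xe]; last first.
  by rewrite big1 // => y _; rewrite xe.
rewrite addn0 -sum_nat_const; apply: eq_bigr => x xe.
rewrite xe (cardD1 x e) xe -sum1_card big_mkcond [RHS]big_mkcond /=.
by apply: eq_bigr => y _; rewrite !inE eq_sym; case: eqP; case: (y \in e).
Qed.

Lemma full_hypergraph m t q p f : is_full m t q p f ->
  exists E : seq {set 'I_m},
    perm_eq (map (fun e : {set 'I_m} => #|e|) E) (profile t q p f) /\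
    forall x y : 'I_m, x != y ->
      count (fun e : {set 'I_m} => (x \in e) && (y \in e)) E = 1.
Proof.
move=> [B dB pB].
have DB : all (all (fun x => x < m)) B.
  apply: isdec_supp (dB) (profile_size2 pB) _ => x y _.
  by rewrite /complete_graph /=; case: (x < m).
exists [seq [set i : 'I_m | val i \in b] | b <- B]; split.
  rewrite -map_comp (_ : map _ B = map size B) //; apply/eq_in_map => b bB /=.
  have ub := allP (proj1 dB) b bB.
  rewrite cardsE cardE -(size_map val); apply/perm_size/uniq_perm => // [|k].
    by rewrite map_inj_uniq ?enum_uniq //; exact: val_inj.
  apply/mapP/idP => [[i]|kb].
    by rewrite mem_enum => ib ->.
  have km := allP (allP DB b bB) k kb.
  by exists (Ordinal km) => //; rewrite mem_enum.
move=> x y xy; rewrite count_map.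
have := proj2 dB (val x) (val y) xy; rewrite /complete_graph !ltn_ord => e.
by rewrite -[RHS]e; apply: eq_count => b /=; rewrite !inE.
Qed.

Lemma sum_profile (F : nat -> nat) t q p f :
  \sum_(k <- profile t q p f) F k = t * F 3 + q * F 4 + p * F 2 + f * F 5.
Proof.
have sn k n : \sum_(i <- nseq n k) F i = n * F k.
  by rewrite big_nseq; elim: n => //= n ->; rewrite mulSn.
by rewrite /profile !big_cat /= !sn !addnA.
Qed.

(** Counting pairs determines [t] from the other numbers, so constructions may leave [t] existential
    and recover it afterwards. *)
Lemma is_full_edges m t q p f : is_full m t q p f ->
  3 * t + 6 * q + p + 10 * f = 'C(m, 2).
Proof.
move=> /full_hypergraph[E [pE cE]].
have := sum_pair_count E.
rewrite -(big_map (fun e : {set _} => #|e|) predT (fun k => k * k.-1)) /=.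
rewrite (perm_big _ pE) /= sum_profile /=.
under eq_bigr => x _ do under eq_bigr => y xy do rewrite cE //.
under eq_bigr => x _.
  rewrite sum1_card (_ : #|_| = m.-1); last first.
    have := cardC1 x; rewrite card_ord => <-; apply: eq_card => y.
    by rewrite !inE eq_sym.
  over.
rewrite sum_nat_const card_ord bin2 => ->.
rewrite [X in X./2](_ : _ = (3 * t + 6 * q + p + 10 * f).*2) ?doubleK // -muln2; lia.
Qed.

Lemma linear_sub (V : finType) (E E' : seq {set V}) :
  (forall a, count a E' <= count a E) ->
  (forall x y : V, x != y ->
      count (fun e : {set V} => (x \in e) && (y \in e)) E <= 1) ->
  linear_hypergraph E'.
Proof.
move=> EE lE; apply/forallP => x; apply/forallP => y; apply/implyP => xy.
exact: leq_trans (EE _) (lE x y xy).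
Qed.

Lemma Z22_ge_full m t q p f t' q' p' f' : is_full m t q p f ->
  t' <= t -> q' <= q -> p' <= p -> f' <= f ->
  3 * t' + 4 * q' + 2 * p' + 5 * f' <= Z22 m (t' + q' + p' + f').
Proof.
move=> /full_hypergraph[E [pE cE]] tt qq pp ff.
pose part k n := take n [seq e : {set 'I_m} <- E | #|e| == k].
have cnt k : count (fun e : {set 'I_m} => #|e| == k) E = count_mem k (profile t q p f).
  by rewrite -(permP pE) count_map; apply: eq_count.
have sz k n : n <= count_mem k (profile t q p f) -> size (part k n) = n.
  by move=> H; rewrite size_take_min size_filter cnt; apply/minn_idPl.
have cp k : count_mem k (profile t q p f) =
    (3 == k) * t + (4 == k) * q + (2 == k) * p + (5 == k) * f.
  by rewrite /profile !count_cat !count_nseq /= !addnA.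
have mem k n e : e \in part k n -> #|e| = k.
  by move=> /mem_take; rewrite mem_filter => /andP[/eqP].
have dg k n : n <= count_mem k (profile t q p f) -> \sum_(e <- part k n) #|e| = k * n.
  move=> /sz szn; rewrite (eq_big_seq (fun=> k)) => [|e /mem//].
  by rewrite big_const_seq count_predT szn iter_addn_0.
pose E' := part 3 t' ++ part 4 q' ++ part 2 p' ++ part 5 f'.
have sE' : size E' = t' + q' + p' + f'.
  by rewrite !size_cat !sz ?cp /=; lia.
have dE' : total_degree E' = 3 * t' + 4 * q' + 2 * p' + 5 * f'.
  by rewrite /total_degree !big_cat /= !dg ?cp /=; lia.
rewrite -dE' -sE'; apply: Z22_ub; rewrite ?card_ord //.
  apply/negP; rewrite !mem_cat => H.
  have [k k0 [n /mem]] : exists2 k, 0 < k & exists n, set0 \in part k n.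
    by case/or4P: H => H; [exists 3 | exists 4 | exists 2 | exists 5] => //; eexists; exact: H.
  by rewrite cards0 => kE; rewrite -kE in k0.
apply: linear_sub (fun x y xy => eq_leq (cE x y xy)) => a.
(* The four parts are selected by different sizes, so together they form a sub-multiset of [E]. *)
have tk k n : count a (part k n) <= count (predI a (fun e : {set 'I_m} => #|e| == k)) E.
  rewrite -count_filter /part -{2}(cat_take_drop n [seq e <- E | _]) count_cat.
  exact: leq_addr.
rewrite !count_cat.
apply: leq_trans (_ : count (predI a (fun e : {set 'I_m} => #|e| == 3)) E +
  (count (predI a (fun e : {set 'I_m} => #|e| == 4)) E + (count (predI a (fun e : {set 'I_m} => #|e| == 2)) E +
   count (predI a (fun e : {set 'I_m} => #|e| == 5)) E)) <= _).
  by rewrite !leq_add // tk.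
elim: (E) => //= e E1 IH; case: (a e) => /=; last by rewrite !add0n.
by case: (#|e|) => [|[|[|[|[|[|k]]]]]] /=; lia.
Qed.

(** * Families of decompositions of large complete graphs *)

Definition gdd_edges (k u : nat) : nat := 72 * (k.-1 * k.-2) + 12 * u * k.-1.

(* The number of triangles per point of weight 12 in the GDDs with mostly K4s. *)
Definition tri_rate (u : nat) : nat := if u \in [:: 4; 10] then 8 else 0.

Definition gdd_tri (k u : nat) : nat := gdd_edges k u %/ 3.
Definition gdd_quad (k u : nat) : nat := (gdd_edges k u - 3 * (tri_rate u * k.-1)) %/ 6.

Definition gdd_allowed (k u : nat) : bool :=
  (u == 12) && (k \in [:: 4; 5; 6]) || (u \in [:: 4; 6; 10]) && (k \in [:: 5; 6]).

Lemma gdd_allowedP k u : gdd_allowed k u ->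
  [/\ is_gdd k u (gdd_tri k u) 0, is_gdd k u (tri_rate u * k.-1) (gdd_quad k u)
    & gdd_quad k u <= 360].
Proof.
rewrite /gdd_allowed !inE => /orP[/andP[/eqP-> /or3P[]/eqP->]|/andP[/or3P[]/eqP-> /orP[]/eqP->]].
- by split; [exact: gdd_4_12_3 | exact: gdd_4_12_4 |].
- by split; [exact: gdd_5_12_3 | exact: gdd_5_12_4 |].
- by split; [exact: gdd_6_12_3 | exact: gdd_6_12_4 |].
- by split; [exact: gdd_5_4_3 | exact: gdd_5_4_4 |].
- by split; [exact: gdd_6_4_3 | exact: gdd_6_4_4 |].
- by split; [exact: gdd_5_6_3 | exact: gdd_5_6_4 |].
- by split; [exact: gdd_6_6_3 | exact: gdd_6_6_4 |].
- by split; [exact: gdd_5_10_3 | exact: gdd_5_10_4 |].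
- by split; [exact: gdd_6_10_3 | exact: gdd_6_10_4 |].
Qed.

(* A choice of designs for the hole, of size [Nh], and for [N] groups of size 12. *)
Definition core (c Nh N t q p f : nat) : Prop :=
  exists t0 q0 p0 (gt gq gp : nat -> nat),
    [/\ is_full Nh t0 q0 p0 f, forall i, i < N -> is_fill c (gt i) (gq i) (gp i),
        t = t0 + \sum_(0 <= i < N) gt i, q = q0 + \sum_(0 <= i < N) gq i
      & p = p0 + \sum_(0 <= i < N) gp i].

Lemma core_hole c Nh t q p f : is_full Nh t q p f -> core c Nh 0 t q p f.
Proof.
move=> H; exists t, q, p, (fun=> 0), (fun=> 0), (fun=> 0).
by rewrite big_geq // !addn0.
Qed.

Lemma core_fill c Nh N t q p f t' q' p' :
  is_fill c t' q' p' -> core c Nh N t q p f ->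
  core c Nh N.+1 (t + t') (q + q') (p + p') f.
Proof.
move=> H' [t0 [q0 [p0 [gt [gq [gp [H0 Hg -> -> ->]]]]]]].
pose ext (g : nat -> nat) v i := if i < N then g i else v.
have extE g v : \sum_(0 <= i < N.+1) ext g v i = \sum_(0 <= i < N) g i + v.
  rewrite big_nat_recr //= {2}/ext ltnn; congr (_ + _).
  by apply: eq_big_nat => i /andP[_ iN]; rewrite /ext iN.
exists t0, q0, p0, (ext gt t'), (ext gq q'), (ext gp p'); split=> //; rewrite ?extE ?addnA //.
by move=> i iN; rewrite /ext; case: ifP => // /Hg.
Qed.

Lemma core_fills c Nh N k t q p f t' q' p' :
  is_fill c t' q' p' -> core c Nh N t q p f ->
  core c Nh (k + N) (t + k * t') (q + k * q') (p + k * p') f.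
Proof.
move=> H' H; elim: k => [|k IH]; first by rewrite !addn0.
by rewrite !mulSnr !addnA; exact: core_fill.
Qed.

(** Every point outside the hole shares exactly one block with [z0], and the other points of the
    hole share none. This counts the triangles left by truncated designs. *)
Lemma sum_block_degree (P : eqType) (z0 : P) (hol ord : seq P) (Bs : seq (seq P)) :
  uniq (z0 :: hol ++ ord) -> all (fun b => 1 < size b) Bs ->
  isdec (fun x y => [&& x \in z0 :: hol ++ ord, y \in z0 :: hol ++ ord
                 & ~~ ((x \in z0 :: hol) && (y \in z0 :: hol))]) Bs ->
  \sum_(b <- Bs) (z0 \in b) * (size b).-1 = size ord.
Proof.
move=> us sB dB.
have [uB cB] := dB.
have DB : all (all [in z0 :: hol ++ ord]) Bs.
  by apply: isdec_supp (dB) sB _ => x y _; rewrite lt0b => /and3P[].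
have [zn un] : z0 \notin hol ++ ord /\ uniq (hol ++ ord) by apply/andP.
rewrite (eq_big_seq (fun b : seq P => \sum_(x <- hol ++ ord) ((z0 \in b) && (x \in b) : nat))); last first.
  move=> b bB; case zb: (z0 \in b); last by rewrite mul0n big1.
  rewrite mul1n sum_bool_count -size_filter -(size_rem zb); apply/perm_size/uniq_perm.
  - by rewrite rem_uniq // (allP uB).
  - by rewrite filter_uniq.
  move=> x; rewrite mem_rem_uniq ?(allP uB) // !inE mem_filter /=.
  have [xb|//] := boolP (x \in b); rewrite ?andbF //=.
  have := allP (allP DB b bB) x xb; rewrite inE => /orP[/eqP->|xs].
    by rewrite eqxx (negbTE zn).
  by rewrite xs andbT; apply: contraNneq zn => <-.
rewrite exchange_big /=.
rewrite (eq_big_seq (fun x => (x \in ord) : nat)) => [|x xs].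
  rewrite sum_bool_count count_cat.
  rewrite (eq_in_count (a2 := pred0)) ?count_pred0 => [|x xh]; last first.
    by move: un; rewrite cat_uniq => /and3P[_ /hasPn H _]; apply: contraTF xh; exact: H.
  by rewrite add0n (eq_in_count (a2 := predT)) ?count_predT // => x /= ->.
have zx : z0 != x by apply: contraNneq zn => ->.
rewrite sum_bool_count [LHS](cB z0 x zx) !inE eqxx xs orbT /= [x == z0]eq_sym (negbTE zx) /=.
move: xs un; rewrite mem_cat cat_uniq => xs /and3P[_ /hasPn H _].
have [xo|xo] := boolP (x \in ord); first by rewrite H.
by move: xs; rewrite (negbTE xo) orbF => ->.
Qed.

(* The block designs are switched one after the other from the triangle version to the
   K4 version: [j] of them have been switched. *)
Lemma core_inflate c u h N : gdd_allowed 5 u -> 1221 <= N -> 0 < h <= 229 ->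
  exists L (bt bt' bq : nat -> nat),
  [/\ forall i, bq i <= 360, \sum_(0 <= i < L) bt' i = tri_rate u * N
    & forall j t q p f, j <= L -> core c (c + u + 12 * h.-1) N t q p f ->
      is_full (12 * N + (c + u + 12 * h.-1))
        (t + (\sum_(0 <= i < j) bt' i + \sum_(j <= i < L) bt i))
        (q + \sum_(0 <= i < j) bq i) p f].
Proof.
move=> u5 N1 /andP[h0 h229].
have [P [ord [hole [Bs [us so sh dB [s456 s5]]]]]] := pbd_with_large_hole N1 h229.
case: hole us sh dB s5 => [|z0 hol] us sh dB s5; first by rewrite -sh in h0.
pose b i := nth [::] Bs i.
pose ub i := if z0 \in b i then u else 12.
pose bt i := gdd_tri (size (b i)) (ub i).
pose bt' i := tri_rate (ub i) * (size (b i)).-1.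
pose bq i := if i < size Bs then gdd_quad (size (b i)) (ub i) else 0.
have ok i : i < size Bs -> gdd_allowed (size (b i)) (ub i).
  move=> iB; have bB : b i \in Bs by rewrite mem_nth.
  have := allP s456 _ bB; rewrite /size456 /ub; case: ifP => zb; last by rewrite /gdd_allowed => ->.
  have /implyP/(_ _) := allP s5 _ bB.
  have -> : has [in z0 :: hol] (b i) by apply/hasP; exists z0; rewrite ?mem_head.
  move=> /(_ isT) s4 s6; move: u5; rewrite /gdd_allowed.
  have k56 : size (b i) \in [:: 5; 6] by move: s4 s6; rewrite !inE; lia.
  by rewrite s6 k56; case: (u == 12).
exists (size Bs), bt, bt', bq; split.
- by move=> i; rewrite /bq; case: ifP => // /ok/gdd_allowedP[].
(* Only blocks through [z0] can leave triangles, since [tri_rate 12] is 0; their sizes less one add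
   up to [N]. *)
- rewrite -so -(sum_block_degree us (size456_gt1 s456) dB) big_distrr /= (big_nth [::]).
  apply: eq_big_nat => i _; rewrite /bt' /ub -/(b i); case: ifP => _; first by rewrite mul1n.
  by rewrite muln0.
move=> j t q p f jL [t0 [q0 [p0 [gt [gq [gp [H0 Hg -> -> ->]]]]]]].
pose V := all_points z0 hol ord c u.
have sV : size V = 12 * N + (c + u + 12 * h.-1).
  rewrite size_copies /= !map_cat sumn_cat eqxx.
  have wh : {in hol ++ ord, forall x, weight z0 c u (Some x) = 12}.
    by move=> x xs; rewrite /weight; case: eqP xs => // ->; move/andP: us => [/negbTE->].
  have sw s : {subset s <= hol ++ ord} ->
      sumn [seq weight z0 c u o | o <- map Some s] = 12 * size s.
    move=> sub; rewrite -map_comp (_ : map _ s = nseq (size s) 12) ?sumn_nseq //.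
    elim: s sub => //= x s IH sub; rewrite IH => [|y ys]; last by apply: sub; rewrite inE ys orbT.
    by congr (_ :: _); apply: wh; apply: sub; rewrite mem_head.
  rewrite !sw; last 2 first.
  - by move=> x xs; rewrite mem_cat xs orbT.
  - by move=> x xs; rewrite mem_cat xs.
  by move: sh => /= <-; rewrite so; lia.
have shp : size (hole_points z0 hol c u) = c + u + 12 * h.-1.
  rewrite size_copies /= eqxx -map_comp.
  rewrite (_ : map _ hol = nseq (size hol) 12) ?sumn_nseq; last first.
    move/andP: us => [zn _]; elim: (hol) zn => //= x s IH; rewrite inE negb_or.
    by move=> /andP[/negbTE zx zs]; rewrite IH // eq_sym zx.
  by move: sh => /= <-; lia.
rewrite -sV; apply: is_full_of_list; first exact: (None, 0).
  apply: copies_uniq; rewrite cons_uniq map_inj_uniq ?us ?andbT => [|? ? []//].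
  by apply/mapP => -[].
have sel (g g' : nat -> nat) : \sum_(0 <= i < size Bs) (if i < j then g i else g' i)
    = \sum_(0 <= i < j) g i + \sum_(j <= i < size Bs) g' i.
  rewrite (big_cat_nat (n := j)) //=; congr (_ + _).
    by apply: eq_big_nat => i /andP[_ ->].
  by apply: eq_big_nat => i /andP[ji _]; rewrite ltnNge ji.
have := @realizes_inflate P z0 hol ord Bs c u us dB t0 q0 p0 f gt gq gp
  (fun i => if i < j then bt' i else bt i) (fun i => if i < j then bq i else 0).
rewrite shp so !sel big1_eq addn0 => R; apply: R => // i iB /=.
have [H3 H4 _] := gdd_allowedP (ok i iB); rewrite -/(b i) -/(ub i) /bq iB.
by case: ifP.
Qed.

(* The number of K4s is written [h0 + x + a * M + d * i + e * j] with [x < d],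
   [i <= k] and [j <= M - k]. *)
Lemma core_interval c Nh R M h0 p0 a d e k ta td te T0 :
  0 < d -> d <= e -> e <= d * k + d -> k <= M ->
  is_fill c ta a 0 -> is_fill c td (a + d) 0 -> is_fill c te (a + e) 0 ->
  (forall x, x < d -> exists t, core c Nh R t (h0 + x) p0 0) ->
  core c Nh R T0 (h0 + d.-1) p0 0 ->
  (forall q, h0 + a * M <= q <= h0 + d.-1 + a * M + e * (M - k) + d * k ->
     exists t, core c Nh (M + R) t q p0 0) /\
  core c Nh (M + R) (T0 + (M - k) * te + k * td)
    (h0 + d.-1 + a * M + e * (M - k) + d * k) p0 0.
Proof.
move=> d0 de ek kM Fa Fd Fe Hx HT.
have build t q i j : i <= k -> j <= M - k -> core c Nh R t q p0 0 ->
    core c Nh (M + R) (t + j * te + i * td + (M - i - j) * ta)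
      (q + a * M + d * i + e * j) p0 0.
  move=> ik jM H.
  have := core_fills (M - i - j) Fa (core_fills i Fd (core_fills j Fe H)).
  rewrite !muln0 !addn0.
  have -> : M - i - j + (i + (j + R)) = M + R by lia.
  have -> // : q + j * (a + e) + i * (a + d) + (M - i - j) * a
     = q + a * M + d * i + e * j.
  have -> : M = (M - i - j) + i + j by lia.
  rewrite -!addnA (_ : M - i - j + (i + j) - i - j = M - i - j); lia.
split=> [q /andP[q1 q2]|]; last first.
  have := build T0 _ k (M - k) (leqnn _) (leqnn _) HT.
  rewrite (_ : M - k - (M - k) = 0) ?mul0n ?addn0; last lia.
  by rewrite [_ + d * k + _]addnAC.
pose y := q - (h0 + a * M).
have e0 : 0 < e by lia.
(* Greedy choice: as many steps of [e] as fit, but at most [M - k]. What remains is less than d * k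
   + d, by e <= d * k + d or by the upper bound on q; it is spent in steps of [d], and the rest
   below [d] goes to the hole. *)
have [j [i [ik jM yx]]] : exists j i, [/\ i <= k, j <= M - k & y - e * j < d * i + d /\
    d * i + e * j <= y].
  have key j : j <= M - k -> e * j <= y -> y - e * j < d * k + d ->
      exists j i, [/\ i <= k, j <= M - k & y - e * j < d * i + d /\ d * i + e * j <= y].
    move=> jM ejy lt; exists j, ((y - e * j) %/ d).
    have dv := divn_eq (y - e * j) d; have md := ltn_pmod (y - e * j) d0.
    have : (y - e * j) %/ d < k.+1 by rewrite ltn_divLR // mulSn mulnC; lia.
    by rewrite ltnS => ?; split=> //; rewrite mulnC; lia.
  have [small|big] := ltnP (y %/ e) (M - k).
    have dv := divn_eq y e; have md := ltn_pmod y e0.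
    by apply: (key (y %/ e)); rewrite 1?mulnC; lia.
  apply: (key (M - k)) => //; last by rewrite /y; lia.
  by have := leq_trunc_div y e; rewrite mulnC => ?; apply: leq_trans (_ : e * (y %/ e) <= _);
     rewrite ?leq_mul2l ?big ?orbT.
have xd : y - e * j - d * i < d by lia.
have [t Ht] := Hx _ xd; have := build t _ i j ik jM Ht.
have -> : h0 + (y - e * j - d * i) + a * M + d * i + e * j = q by rewrite /y; rewrite /y in yx; lia.
by move=> H; exists (t + j * te + i * td + (M - i - j) * ta).
Qed.

(** Switching blocks one after the other shifts the interval from [lo] to [hi], each time by at most
    360, the number of K4s for six groups of size 12. As hi - lo >= 360, consecutive shifted
    intervals leave no gap. *)
Lemma core_spread c u h N p0 lo hi T :
  gdd_allowed 5 u -> 1221 <= N -> 0 < h <= 229 -> lo + 360 <= hi ->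
  (forall q, lo <= q <= hi -> exists t, core c (c + u + 12 * h.-1) N t q p0 0) ->
  core c (c + u + 12 * h.-1) N T hi p0 0 ->
  forall t q, lo <= q -> 3 * t + 6 * q + p0 = 'C(12 * N + (c + u + 12 * h.-1), 2) ->
  T + tri_rate u * N <= t -> is_full (12 * N + (c + u + 12 * h.-1)) t q p0 0.
Proof.
move=> u5 N1 h0 lohi Hq HT t q loq e Tt.
have [L [bt [bt' [bq [bq360 sbt' inf]]]]] := core_inflate c u5 N1 h0.
have := is_full_edges (inf L _ _ _ _ (leqnn L) HT).
rewrite sbt' (big_geq (leqnn L)) addn0 muln0 addn0 => etop.
(* By the edge count, the fully switched design has at most [t] triangles and hence at least [q]
   K4s. *)
have qtop : q <= hi + \sum_(0 <= i < L) bq i by lia.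
suff [t' Ht'] : exists t', is_full (12 * N + (c + u + 12 * h.-1)) t' q p0 0.
  by have := is_full_edges Ht'; rewrite muln0 addn0 => e'; have -> : t = t' by lia.
have reach j : j <= L -> q <= hi + \sum_(0 <= i < j) bq i ->
    exists t', is_full (12 * N + (c + u + 12 * h.-1)) t' q p0 0.
  elim: j => [|j IH] jL.
    rewrite big_geq // addn0 => qhi; have [|t0 Ht0] := Hq q; first by rewrite loq.
    by have := inf 0 _ _ _ _ jL Ht0; rewrite ![\sum_(0 <= i < 0) _]big_geq // addn0; eauto.
  have [small|big] := leqP q (hi + \sum_(0 <= i < j) bq i); first by move=> _; apply: IH => //; lia.
  move=> qj; have b360 := bq360 j.
  have := qj; rewrite big_nat_recr //= => qj'.
  have [|t0 Ht0] := Hq (q - \sum_(0 <= i < j.+1) bq i).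
    by rewrite big_nat_recr //=; lia.
  have := inf j.+1 _ _ _ _ jL Ht0; rewrite subnK; last by rewrite big_nat_recr //=; lia.
  by eauto.
exact: reach (leqnn L) qtop.
Qed.

Lemma full_of_core c u h N t q p f : gdd_allowed 5 u -> 1221 <= N -> 0 < h <= 229 ->
  core c (c + u + 12 * h.-1) N t q p f ->
  exists t', is_full (12 * N + (c + u + 12 * h.-1)) t' q p f.
Proof.
move=> u5 N1 h0 H; have [L [bt [bt' [bq [_ _ inf]]]]] := core_inflate c u5 N1 h0.
have := inf 0 _ _ _ _ (leq0n L) H; rewrite ![\sum_(0 <= i < 0) _]big_geq // addn0.
by move=> ?; eexists; eassumption.
Qed.

(** * Decompositions of K_m with at most one pair, for each residue of m modulo 12 *)

(** In this and the following lemmas the bound on 3 t comes from the lower hypothesis on n; 240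
    drops to 235 because one pair makes 3 t = 6 n - C - 5. The bound on q is forced: for even m the
    blocks of even size must meet every vertex, so 4 q + 2 p >= m, and for odd m five is the least
    positive number of K4s that parity permits. *)
Lemma full_mod0 N t q : 2000 <= N -> 3 * t + 6 * q + 0 = 'C(12 * N + 24, 2) ->
  3 * N + 6 <= q -> 2 * (12 * N + 24) + 235 <= 3 * t -> is_full (12 * N + 24) t q 0 0.
Proof.
move=> N2 e loq tb.
(* The groups receive three or nine K4s, so the hole has to supply six consecutive numbers. *)
have [|||H HT] := @core_interval 0 24 0 N 6 0 3 6 6 0 16 4 4 70
  isT isT isT _ fill_0_3_0 fill_0_9_0 fill_0_9_0.
- lia.
- move=> x; case: x => [|[|[|[|[|[|x]]]]]] // _; eexists.
  + exact: (core_hole 0 full_24_6_0_0).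
  + exact: (core_hole 0 full_24_7_0_0).
  + exact: (core_hole 0 full_24_8_0_0).
  + exact: (core_hole 0 full_24_9_0_0).
  + exact: (core_hole 0 full_24_10_0_0).
  + exact: (core_hole 0 full_24_11_0_0).
- exact: (core_hole 0 full_24_11_0_0).
rewrite addn0 in H HT.
apply: (@core_spread 0 12 2 N 0 _ _ _ isT _ isT _ H HT) => //; rewrite ?/tri_rate /=; lia.
Qed.

Lemma full_mod6 N t q : 2000 <= N -> 3 * t + 6 * q + 0 = 'C(12 * N + 18, 2) ->
  3 * N + 5 <= q -> 2 * (12 * N + 18) + 235 <= 3 * t -> is_full (12 * N + 18) t q 0 0.
Proof.
move=> N2 e loq tb.
have [|||H HT] := @core_interval 0 18 0 N 5 0 3 6 6 0 16 4 4 31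
  isT isT isT _ fill_0_3_0 fill_0_9_0 fill_0_9_0.
- lia.
- move=> x; case: x => [|[|[|[|[|[|x]]]]]] // _; eexists.
  + exact: (core_hole 0 full_18_5_0_0).
  + exact: (core_hole 0 full_18_6_0_0).
  + exact: (core_hole 0 full_18_7_0_0).
  + exact: (core_hole 0 full_18_8_0_0).
  + exact: (core_hole 0 full_18_9_0_0).
  + exact: (core_hole 0 full_18_10_0_0).
- exact: (core_hole 0 full_18_10_0_0).
rewrite addn0 in H HT.
apply: (@core_spread 0 6 2 N 0 _ _ _ isT _ isT _ H HT) => //; rewrite ?/tri_rate /=; lia.
Qed.

Lemma full_mod4 N t q : 2000 <= N -> 3 * t + 6 * q + 0 = 'C(12 * N + 16, 2) ->
  3 * N + 4 <= q -> 2 * (12 * N + 16) + 235 <= 3 * t -> is_full (12 * N + 16) t q 0 0.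
Proof.
move=> N2 e loq tb.
(* Fifteen groups with four K4s in place of three bridge the steps of 16 between [fill_4_3_0] and
   [fill_4_19_0]. *)
have [|||H HT] := @core_interval 4 16 0 N 4 0 3 1 16 15 32 30 0 32
  isT isT isT _ fill_4_3_0 fill_4_4_0 fill_4_19_0.
- lia.
- move=> x; case: x => [|x] // _; eexists.
  + exact: (core_hole 4 full_16_4_0_0).
- exact: (core_hole 4 full_16_4_0_0).
rewrite addn0 in H HT.
apply: (@core_spread 4 12 1 N 0 _ _ _ isT _ isT _ H HT) => //; rewrite ?/tri_rate /=; lia.
Qed.

Lemma full_mod10 N t q : 2000 <= N -> 3 * t + 6 * q + 0 = 'C(12 * N + 10, 2) ->
  3 * N + 3 <= q -> 2 * (12 * N + 10) + 235 <= 3 * t -> is_full (12 * N + 10) t q 0 0.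
Proof.
move=> N2 e loq tb.
have [|||H HT] := @core_interval 4 10 0 N 3 0 3 1 16 15 32 30 0 9
  isT isT isT _ fill_4_3_0 fill_4_4_0 fill_4_19_0.
- lia.
- move=> x; case: x => [|x] // _; eexists.
  + exact: (core_hole 4 full_10_3_0_0).
- exact: (core_hole 4 full_10_3_0_0).
rewrite addn0 in H HT.
apply: (@core_spread 4 6 1 N 0 _ _ _ isT _ isT _ H HT) => //; rewrite ?/tri_rate /=; lia.
Qed.

Lemma full_mod2 N t q : 2000 <= N -> 3 * t + 6 * q + 1 = 'C(12 * N + 14, 2) ->
  3 * N + 3 <= q -> 2 * (12 * N + 14) + 235 <= 3 * t -> is_full (12 * N + 14) t q 1 0.
Proof.
move=> N2 e loq tb.
have [|||H HT] := @core_interval 2 14 2 (N - 2) 9 1 3 3 8 2 24 18 8 68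
  isT isT isT _ fill_2_3_0 fill_2_6_0 fill_2_11_0.
- lia.
- move=> x; case: x => [|[|[|x]]] // _; eexists.
  + exact: (core_fill fill_2_3_0 (core_fill fill_2_3_0 (core_hole 2 full_14_3_1_0))).
  + exact: (core_fill fill_2_4_0 (core_fill fill_2_3_0 (core_hole 2 full_14_3_1_0))).
  + exact: (core_fill fill_2_4_0 (core_fill fill_2_4_0 (core_hole 2 full_14_3_1_0))).
- exact: (core_fill fill_2_4_0 (core_fill fill_2_4_0 (core_hole 2 full_14_3_1_0))).
rewrite subnK in H HT; last lia.
apply: (@core_spread 2 12 1 N 1 _ _ _ isT _ isT _ H HT) => //; rewrite ?/tri_rate /=; lia.
Qed.

(** For odd m the groups can do without K4s, so q may be as small as 5. One group is set aside and
    supplies, together with the hole, the totals 5 to 10. *)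
Lemma full_mod1 N t q : 2000 <= N -> 3 * t + 6 * q + 0 = 'C(12 * N + 25, 2) ->
  5 <= q -> 2 * (12 * N + 25) + 235 <= 3 * t -> is_full (12 * N + 25) t q 0 0.
Proof.
move=> N2 e loq tb.
have [|||H HT] := @core_interval 1 25 1 (N - 1) 5 0 0 6 13 2 26 14 0 106
  isT isT isT _ fill_1_0_0 fill_1_6_0 fill_1_13_0.
- lia.
- move=> x; case: x => [|[|[|[|[|[|x]]]]]] // _; eexists.
  + exact: (core_fill fill_1_0_0 (core_hole 1 full_25_5_0_0)).
  + exact: (core_fill fill_1_6_0 (core_hole 1 full_25_0_0_0)).
  + exact: (core_fill fill_1_7_0 (core_hole 1 full_25_0_0_0)).
  + exact: (core_fill fill_1_0_0 (core_hole 1 full_25_8_0_0)).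
  + exact: (core_fill fill_1_0_0 (core_hole 1 full_25_9_0_0)).
  + exact: (core_fill fill_1_0_0 (core_hole 1 full_25_10_0_0)).
- exact: (core_fill fill_1_0_0 (core_hole 1 full_25_10_0_0)).
rewrite subnK in H HT; last lia.
apply: (@core_spread 1 12 2 N 0 _ _ _ isT _ isT _ H HT) => //; rewrite ?/tri_rate /=; lia.
Qed.

Lemma full_mod7 N t q : 2000 <= N -> 3 * t + 6 * q + 0 = 'C(12 * N + 19, 2) ->
  5 <= q -> 2 * (12 * N + 19) + 235 <= 3 * t -> is_full (12 * N + 19) t q 0 0.
Proof.
move=> N2 e loq tb.
have [|||H HT] := @core_interval 1 19 1 (N - 1) 5 0 0 6 13 2 26 14 0 63
  isT isT isT _ fill_1_0_0 fill_1_6_0 fill_1_13_0.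
- lia.
- move=> x; case: x => [|[|[|[|[|[|x]]]]]] // _; eexists.
  + exact: (core_fill fill_1_0_0 (core_hole 1 full_19_5_0_0)).
  + exact: (core_fill fill_1_6_0 (core_hole 1 full_19_0_0_0)).
  + exact: (core_fill fill_1_7_0 (core_hole 1 full_19_0_0_0)).
  + exact: (core_fill fill_1_0_0 (core_hole 1 full_19_8_0_0)).
  + exact: (core_fill fill_1_0_0 (core_hole 1 full_19_9_0_0)).
  + exact: (core_fill fill_1_0_0 (core_hole 1 full_19_10_0_0)).
- exact: (core_fill fill_1_0_0 (core_hole 1 full_19_10_0_0)).
rewrite subnK in H HT; last lia.
apply: (@core_spread 1 6 2 N 0 _ _ _ isT _ isT _ H HT) => //; rewrite ?/tri_rate /=; lia.
Qed.

Lemma full_mod3 N t q : 2000 <= N -> 3 * t + 6 * q + 0 = 'C(12 * N + 27, 2) ->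
  5 <= q -> 2 * (12 * N + 27) + 235 <= 3 * t -> is_full (12 * N + 27) t q 0 0.
Proof.
move=> N2 e loq tb.
have [|||H HT] := @core_interval 3 27 1 (N - 1) 5 0 0 5 15 2 34 24 4 133
  isT isT isT _ fill_3_0_0 fill_3_5_0 fill_3_15_0.
- lia.
- move=> x; case: x => [|[|[|[|[|x]]]]] // _; eexists.
  + exact: (core_fill fill_3_5_0 (core_hole 3 full_27_0_0_0)).
  + exact: (core_fill fill_3_6_0 (core_hole 3 full_27_0_0_0)).
  + exact: (core_fill fill_3_7_0 (core_hole 3 full_27_0_0_0)).
  + exact: (core_fill fill_3_0_0 (core_hole 3 full_27_8_0_0)).
  + exact: (core_fill fill_3_0_0 (core_hole 3 full_27_9_0_0)).
- exact: (core_fill fill_3_0_0 (core_hole 3 full_27_9_0_0)).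
rewrite subnK in H HT; last lia.
apply: (@core_spread 3 12 2 N 0 _ _ _ isT _ isT _ H HT) => //; rewrite ?/tri_rate /=; lia.
Qed.

Lemma full_mod9 N t q : 2000 <= N -> 3 * t + 6 * q + 0 = 'C(12 * N + 21, 2) ->
  5 <= q -> 2 * (12 * N + 21) + 235 <= 3 * t -> is_full (12 * N + 21) t q 0 0.
Proof.
move=> N2 e loq tb.
have [|||H HT] := @core_interval 3 21 1 (N - 1) 5 0 0 5 15 2 34 24 4 86
  isT isT isT _ fill_3_0_0 fill_3_5_0 fill_3_15_0.
- lia.
- move=> x; case: x => [|[|[|[|[|x]]]]] // _; eexists.
  + exact: (core_fill fill_3_5_0 (core_hole 3 full_21_0_0_0)).
  + exact: (core_fill fill_3_6_0 (core_hole 3 full_21_0_0_0)).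
  + exact: (core_fill fill_3_7_0 (core_hole 3 full_21_0_0_0)).
  + exact: (core_fill fill_3_0_0 (core_hole 3 full_21_8_0_0)).
  + exact: (core_fill fill_3_0_0 (core_hole 3 full_21_9_0_0)).
- exact: (core_fill fill_3_0_0 (core_hole 3 full_21_9_0_0)).
rewrite subnK in H HT; last lia.
apply: (@core_spread 3 6 2 N 0 _ _ _ isT _ isT _ H HT) => //; rewrite ?/tri_rate /=; lia.
Qed.

(** With c = 1 a group can be filled by K4s alone. The residues 11 and 5 then call for the weights
    10 and 4, whose truncated designs leave 8 N triangles, still within the bound on t. *)
Lemma full_mod11 N t q : 2000 <= N -> 3 * t + 6 * q + 1 = 'C(12 * N + 23, 2) ->
  5 <= q -> 2 * (12 * N + 23) + 235 <= 3 * t -> is_full (12 * N + 23) t q 1 0.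
Proof.
move=> N2 e loq tb.
have [|||H HT] := @core_interval 1 23 0 N 5 1 0 6 13 2 26 14 0 64
  isT isT isT _ fill_1_0_0 fill_1_6_0 fill_1_13_0.
- lia.
- move=> x; case: x => [|[|[|[|[|[|x]]]]]] // _; eexists.
  + exact: (core_hole 1 full_23_5_1_0).
  + exact: (core_hole 1 full_23_6_1_0).
  + exact: (core_hole 1 full_23_7_1_0).
  + exact: (core_hole 1 full_23_8_1_0).
  + exact: (core_hole 1 full_23_9_1_0).
  + exact: (core_hole 1 full_23_10_1_0).
- exact: (core_hole 1 full_23_10_1_0).
rewrite addn0 in H HT.
apply: (@core_spread 1 10 2 N 1 _ _ _ isT _ isT _ H HT) => //; rewrite ?/tri_rate /=; lia.
Qed.

Lemma full_mod5 N t q : 2000 <= N -> 3 * t + 6 * q + 1 = 'C(12 * N + 17, 2) ->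
  5 <= q -> 2 * (12 * N + 17) + 235 <= 3 * t -> is_full (12 * N + 17) t q 1 0.
Proof.
move=> N2 e loq tb.
have [|||H HT] := @core_interval 1 17 0 N 5 1 0 6 13 2 26 14 0 25
  isT isT isT _ fill_1_0_0 fill_1_6_0 fill_1_13_0.
- lia.
- move=> x; case: x => [|[|[|[|[|[|x]]]]]] // _; eexists.
  + exact: (core_hole 1 full_17_5_1_0).
  + exact: (core_hole 1 full_17_6_1_0).
  + exact: (core_hole 1 full_17_7_1_0).
  + exact: (core_hole 1 full_17_8_1_0).
  + exact: (core_hole 1 full_17_9_1_0).
  + exact: (core_hole 1 full_17_10_1_0).
- exact: (core_hole 1 full_17_10_1_0).
rewrite addn0 in H HT.
apply: (@core_spread 1 4 2 N 1 _ _ _ isT _ isT _ H HT) => //; rewrite ?/tri_rate /=; lia.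
Qed.

Lemma full_mod8 N t q : 2000 <= N -> 3 * t + 6 * q + 1 = 'C(12 * N + 20, 2) ->
  3 * N + 5 <= q -> 2 * (12 * N + 20) + 235 <= 3 * t -> is_full (12 * N + 20) t q 1 0.
Proof.
move=> N2 e loq tb.
have [|||H _] := @core_interval 2 20 2 (N - 2) 11 1 3 3 8 2 24 18 8 97
  isT isT isT _ fill_2_3_0 fill_2_6_0 fill_2_11_0.
- lia.
- move=> x; case: x => [|[|[|x]]] // _; eexists.
  + exact: (core_fill fill_2_3_0 (core_fill fill_2_3_0 (core_hole 2 full_20_5_1_0))).
  + exact: (core_fill fill_2_4_0 (core_fill fill_2_3_0 (core_hole 2 full_20_5_1_0))).
  + exact: (core_fill fill_2_4_0 (core_fill fill_2_4_0 (core_hole 2 full_20_5_1_0))).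
- exact: (core_fill fill_2_4_0 (core_fill fill_2_4_0 (core_hole 2 full_20_5_1_0))).
(* The top of the first family has 8 N + 101 triangles, while 3 t may be as small as 24 N + 275.
   Putting more K4s into the two groups set aside lowers this to 8 N + 73, and the two intervals
   overlap. *)
have [|||H' HT] := @core_interval 2 20 2 (N - 2) 25 1 3 3 8 2 24 18 8 69
  isT isT isT _ fill_2_3_0 fill_2_6_0 fill_2_11_0.
- lia.
- move=> x; case: x => [|[|[|x]]] // _; eexists.
  + exact: (core_fill fill_2_10_0 (core_fill fill_2_10_0 (core_hole 2 full_20_5_1_0))).
  + exact: (core_fill fill_2_11_0 (core_fill fill_2_10_0 (core_hole 2 full_20_5_1_0))).
  + exact: (core_fill fill_2_11_0 (core_fill fill_2_11_0 (core_hole 2 full_20_5_1_0))).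
- exact: (core_fill fill_2_11_0 (core_fill fill_2_11_0 (core_hole 2 full_20_5_1_0))).
rewrite subnK in H H' HT; try lia.
apply: (@core_spread 2 6 2 N 1 (11 + 3 * (N - 2)) _ _ isT _ isT _ _ HT) => //; rewrite ?/tri_rate /=; try lia.
move=> x /andP[x1 x2]; have [x3|x3] := leqP x (11 + 2 + 3 * (N - 2) + 8 * (N - 2 - 2) + 3 * 2).
  by apply: H; rewrite x1.
by apply: H'; rewrite x2 andbT; lia.
Qed.

(** * Decompositions with few K4s or many pairs *)

Lemma full_of_hole c u h N t0 q0 p0 f0 t : gdd_allowed 5 u -> 2000 <= N -> 0 < h <= 229 ->
  is_fill c t 0 0 -> is_full (c + u + 12 * h.-1) t0 q0 p0 f0 ->
  exists t', is_full (12 * N + (c + u + 12 * h.-1)) t' q0 p0 f0.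
Proof.
move=> u5 N2 h0 F H; have := core_fills N F (core_hole c H).
by rewrite !muln0 !addn0; apply: full_of_core => //; lia.
Qed.

(** Used with c even, when each of the twelve points of a group has odd degree and must lie in a
    block of even size. Three K4s or six pairs meet each of these points exactly once; four K4s give
    four incidences in excess. *)
Lemma full_pairs c u h N t0 q0 p0 i j t3 t4 t6 :
  gdd_allowed 5 u -> 2000 <= N -> 0 < h <= 229 -> i + j <= N ->
  is_fill c t3 3 0 -> (0 < i -> is_fill c t4 4 0) -> is_fill c t6 0 6 ->
  is_full (c + u + 12 * h.-1) t0 q0 p0 0 ->
  exists t, is_full (12 * N + (c + u + 12 * h.-1)) t (q0 + 3 * (N - j) + i) (p0 + 6 * j) 0.
Proof.
move=> u5 N2 h0 ijN F3 F4 F6 H; have H6 := core_fills j F6 (core_hole c H).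
have {H6} [t H4] : exists t, core c (c + u + 12 * h.-1) (i + j) t (q0 + i * 4) (p0 + 6 * j) 0.
  rewrite muln0 !addn0 [j * 6]mulnC in H6; case: (posnP i) => [->|/F4 {}F4].
    by rewrite !addn0; eexists; exact: H6.
  by have := core_fills i F4 H6; rewrite muln0 addn0; eexists; eassumption.
have := core_fills (N - (i + j)) F3 H4; rewrite muln0 addn0 subnK //.
rewrite (_ : q0 + i * 4 + _ = q0 + 3 * (N - j) + i); last lia.
by apply: full_of_core => //; lia.
Qed.

(** * Upper bounds *)

Section UpperBounds.
Variables (V : finType) (E : seq {set V}).
Hypothesis linE : linear_hypergraph E.
Let m := #|V|.

Definition codeg (F : seq {set V}) (x y : V) : nat :=
  count (fun e : {set V} => (x \in e) && (y \in e)) F.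

Definition covered (x : V) : nat := \sum_(y | x != y) codeg E x y.

Lemma codeg_le1 x y : x != y -> codeg E x y <= 1.
Proof. by move=> xy; have /forallP/(_ x)/forallP/(_ y)/implyP := linE; apply. Qed.

Lemma card_neq (x : V) : #|[pred y | x != y]| = m.-1.
Proof. by rewrite -(cardC1 x); apply: eq_card => y; rewrite !inE eq_sym. Qed.

Lemma covered_le x : covered x <= m.-1.
Proof.
rewrite -(card_neq x) -sum1_card; apply: leq_sum => y xy; exact: codeg_le1.
Qed.

Lemma coveredE x : covered x = \sum_(e <- E) (x \in e) * #|e|.-1.
Proof.
rewrite /covered /codeg; elim: (E) => [|e F IH]; first by rewrite big_nil big1.
rewrite big_cons -IH /= big_split /=; congr (_ + _).
case xe: (x \in e); last by rewrite mul0n big1.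
rewrite mul1n (cardD1 x e) xe /= -sum1_card big_mkcond [RHS]big_mkcond /=.
by apply: eq_bigr => y _; rewrite !inE eq_sym; case: eqP; case: (y \in e).
Qed.

Lemma sum_covered : \sum_x covered x = \sum_(e <- E) #|e| * #|e|.-1.
Proof. exact: sum_pair_count. Qed.

Lemma sum_covered_le : \sum_x covered x <= m * m.-1.
Proof. by rewrite -sum_nat_const; apply: leq_sum => x _; exact: covered_le. Qed.

Lemma sum_incidence (F : seq {set V}) (a : pred nat) :
  \sum_x \sum_(e <- F) (x \in e) * a #|e| = \sum_(e <- F) a #|e| * #|e|.
Proof.
rewrite exchange_big /=; apply: eq_bigr => e _; rewrite -big_distrl /= mulnC.
congr (_ * _); rewrite -sum1_card [RHS]big_mkcond; apply: eq_bigr => x _.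
by case: (x \in e).
Qed.

Lemma total_le : 6 * total_degree E <= m * m.-1 + 12 * size E.
Proof.
apply: leq_trans (leq_add sum_covered_le (leqnn _)); rewrite sum_covered /total_degree.
elim: (E) => [|e F IH]; first by rewrite !big_nil.
rewrite !big_cons /=; have : 6 * #|e| <= #|e| * #|e|.-1 + 12; last lia.
by case: (#|e|) => [|[|[|[|k]]]] //=; nia.
Qed.

(* Every vertex lies in an edge of even size or in an uncovered pair. *)
Lemma total_le_even : ~~ odd m -> 0 < m ->
  14 * total_degree E + 4 * m <= 3 * (m * m) + 24 * size E.
Proof.
move=> em m0; pose ev x := \sum_(e <- E) (x \in e) * ~~ odd #|e|.
have parity x : odd (covered x) = odd (ev x).
  rewrite coveredE /ev; elim: (E) => [|e F IH]; first by rewrite !big_nil.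
  rewrite !big_cons !oddD IH; congr (_ (+) _); case xe: (x \in e) => //.
  rewrite !mul1n; have : 0 < #|e| by apply/card_gt0P; exists x.
  by case: (#|e|) => //= k _; rewrite negbK; case: (odd k).
(* Without an even edge at [x] the number of covered neighbours is even, whereas m - 1 is odd. *)
have vertex x : 3 * covered x + 1 <= 3 * m.-1 + ev x.
  have := covered_le x; have := parity x; have om : odd m.-1 by case: (m) em m0 => //= k; rewrite negbK.
  case: (posnP (ev x)) => [->|evx]; last lia.
  move=> /= oc cm; have : covered x != m.-1 by apply: contraFneq oc => ->.
  lia.
have : \sum_x (3 * covered x + 1) <= \sum_(x : V) (3 * m.-1 + ev x) by apply: leq_sum.
have e3 : \sum_x 3 * covered x = 3 * \sum_x covered x by rewrite big_distrr.
rewrite big_split [X in _ <= X]big_split /= e3 sum_covered sum1_card sum_nat_const -/m.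
rewrite (sum_incidence E (fun k => ~~ odd k)) => H.
(* Equality holds exactly for sizes 2, 3 and 4; this dictates the coefficients 14, 3 and 24. *)
have edges : 14 * total_degree E + \sum_(e <- E) ~~ odd #|e| * #|e|
    <= 3 * (\sum_(e <- E) #|e| * #|e|.-1) + 24 * size E.
  rewrite /total_degree; elim: (E) => [|e F IH]; first by rewrite !big_nil.
  rewrite !big_cons /=.
  have : 14 * #|e| + ~~ odd #|e| * #|e| <= 3 * (#|e| * #|e|.-1) + 24; last lia.
  case: (#|e|) => [|[|[|[|[|k]]]]] //=; case: (odd k) => /=; nia.
have : m * m.-1 + m = m * m by rewrite -mulnSr prednK.
lia.
Qed.

End UpperBounds.

(** * Odd m: parity and the exceptional values *)

(** The left side counts ordered pairs of distinct entries of [Q] together with a common vertex, and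
    linearity allows each pair at most one common vertex. *)
Lemma sum_degree_sq (V : finType) (Q : seq {set V}) : linear_hypergraph Q ->
  \sum_x (count (fun e : {set V} => x \in e) Q) * (count (fun e : {set V} => x \in e) Q).-1
    <= size Q * (size Q).-1.
Proof.
elim: Q => [|e Q IH] lin; first by rewrite big1.
have linQ : linear_hypergraph Q.
  apply: linear_sub (codeg_le1 lin) => a /=; exact: leq_addl.
pose d x := count (fun e : {set V} => x \in e) Q.
have inter : \sum_x (x \in e) * d x <= size Q.
  have -> : \sum_x (x \in e) * d x = \sum_(e' <- Q) #|e :&: e'|.
    under eq_bigr => x _ do rewrite /d -sum_bool_count big_distrr /=.
    rewrite exchange_big /=; apply: eq_bigr => e' _.
    rewrite -sum1_card [RHS]big_mkcond; apply: eq_bigr => x _; rewrite inE.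
    by case: (x \in e); case: (x \in e').
  rewrite -sum1_size big_seq [X in _ <= X]big_seq; apply: leq_sum => e' e'Q.
  rewrite leqNgt; apply/negP => /card_gt1P[x [y [xe ye xy]]].
  have := codeg_le1 lin xy; rewrite /codeg /=; move: xe ye; rewrite !inE.
  move=> /andP[-> xe'] /andP[-> ye'] /=; rewrite leqNgt => /negP; apply.
  rewrite ltnS -has_count; apply/hasP; exists e' => //; by rewrite xe'.
have -> : \sum_x count (fun e : {set V} => x \in e) (e :: Q) *
      (count (fun e : {set V} => x \in e) (e :: Q)).-1
    = \sum_x (d x * (d x).-1 + 2 * ((x \in e) * d x)).
  apply: eq_bigr => x _ /=; rewrite -/(d x); case: (x \in e); last by rewrite mul0n muln0 addn0.
  by case: (d x) => //= k; lia.
have e2 : \sum_x 2 * ((x \in e) * d x) = 2 * \sum_x (x \in e) * d x by rewrite big_distrr.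
rewrite big_split /= e2.
have {}IH : \sum_x d x * (d x).-1 <= size Q * (size Q).-1 := IH linQ.
move: (\sum_x d x * (d x).-1) (\sum_x (x \in e) * d x) IH inter => A B /=.
case: (size Q) => [|k] /=; nia.
Qed.

(* Double counting: a vertex of degree at least 2 contributes its degree to the left side
   of [sum_degree_sq], so that [4 q - 2 <= q (q - 1)] for [q] quadruples. *)
Lemma few_quads (V : finType) (Q : seq {set V}) : linear_hypergraph Q ->
  all (fun e : {set V} => #|e| == 4) Q -> size Q <= 4 ->
  #|[pred x | odd (count (fun e : {set V} => x \in e) Q)]| <= 2 -> size Q = 0.
Proof.
move=> lin Q4 sQ oQ; pose d x := count (fun e : {set V} => x \in e) Q.
have sd : \sum_x d x = 4 * size Q.
  under eq_bigr => x _ do rewrite /d -sum_bool_count.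
  rewrite exchange_big /= (eq_big_seq (fun=> 4)) => [|e eQ].
    by rewrite big_const_seq count_predT iter_addn_0.
  rewrite -(eqP (allP Q4 e eQ)) -sum1_card [RHS]big_mkcond; apply: eq_bigr => x _.
  by case: (x \in e).
have sq : \sum_x d x * (d x).-1 <= size Q * (size Q).-1 := sum_degree_sq lin.
have : \sum_x d x <= \sum_x (d x * (d x).-1 + odd (d x)).
  by apply: leq_sum => x _; case: (d x) => [|[|k]] //=; nia.
rewrite big_split /= sd sum_bool_count.
have -> : count (fun x => odd (d x)) (index_enum V) =
    #|[pred x | odd (count (fun e : {set V} => x \in e) Q)]|.
  by rewrite -sum1_count -sum1_card; apply: eq_bigl => x; rewrite inE.
move: sq oQ; move: (size Q) sQ => [|[|[|[|[|k]]]]] //=; lia.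
Qed.

Lemma sum_by_size (V : finType) (E : seq {set V}) (w : {set V} -> nat) (F : nat -> nat) :
  all (fun e : {set V} => #|e| \in [:: 2; 3; 4; 5]) E ->
  \sum_(e <- E) w e * F #|e| =
    F 2 * (\sum_(e <- E) w e * (#|e| == 2)) + F 3 * (\sum_(e <- E) w e * (#|e| == 3))
    + F 4 * (\sum_(e <- E) w e * (#|e| == 4)) + F 5 * (\sum_(e <- E) w e * (#|e| == 5)).
Proof.
elim: E => [|e E IH] /=; first by rewrite !big_nil !muln0.
move=> /andP[se sE]; rewrite !big_cons IH // !inE in se *.
by case/or4P: se => /eqP-> /=; rewrite !muln0 !muln1 ?add0n; lia.
Qed.

(** A single edge, a K5 and an uncovered pair each use up the whole slack of 2, and an edge of size
    below 2 or above 5 would cost at least 6. The slack is what rounding leaves when m = 5 modulo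
    6. *)
Lemma tight_odd (V : finType) (E : seq {set V}) :
  linear_hypergraph E -> odd #|V| ->
  #|V| * #|V|.-1 + 12 * size E <= 6 * total_degree E + 2 ->
  exists e2 e3 e4 e5,
    [/\ size E = e2 + e3 + e4 + e5, total_degree E = 2 * e2 + 3 * e3 + 4 * e4 + 5 * e5,
        2 * e2 + 6 * e3 + 12 * e4 + 20 * e5 <= #|V| * #|V|.-1,
        e4 <= 4 -> e4 = 0
      & e4 = 0 -> e2 = 0 -> #|V| * #|V|.-1 <> 6 * e3 + 20 * e5 + 2].
Proof.
move=> lin om slack; set m := #|V| in om slack *.
have em : ~~ odd m.-1 by case: (m) om.
have Scov := sum_covered_le lin; rewrite sum_covered -/m in Scov.
have sizes : all (fun e : {set V} => #|e| \in [:: 2; 3; 4; 5]) E.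
  apply: contraT => bad.
  have ge (F : seq {set V}) : 6 * total_degree F + (if all (fun e : {set V} =>
      #|e| \in [:: 2; 3; 4; 5]) F then 0 else 6)
      <= \sum_(e <- F) #|e| * #|e|.-1 + 12 * size F.
    rewrite /total_degree; elim: F => [|e F IH]; first by rewrite !big_nil.
    rewrite !big_cons /=.
    have : 6 * #|e| + (if #|e| \in [:: 2; 3; 4; 5] then 0 else 6) <= #|e| * #|e|.-1 + 12.
      by case: (#|e|) => [|[|[|[|[|[|k]]]]]] //; rewrite ?inE /=; nia.
    move: IH; case: (_ \in _); case: (all _ _) => /=; lia.
  by have := ge E; rewrite (negbTE bad); lia.
pose n k := \sum_(e <- E) (#|e| == k : nat).
have nE (F : nat -> nat) : \sum_(e <- E) F #|e| = F 2 * n 2 + F 3 * n 3 + F 4 * n 4 + F 5 * n 5.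
  have := sum_by_size (fun=> 1) F sizes.
  have one k : \sum_(e <- E) 1 * (#|e| == k) = n k by apply: eq_bigr => e _; rewrite mul1n.
  by rewrite !one => <-; apply: eq_bigr => e _; rewrite mul1n.
have sE : size E = n 2 + n 3 + n 4 + n 5 by have := nE (fun=> 1); rewrite sum1_size; lia.
have tE : total_degree E = 2 * n 2 + 3 * n 3 + 4 * n 4 + 5 * n 5 := nE id.
have cE := nE (fun k => k * k.-1); rewrite /= in cE.
pose d k x := \sum_(e <- E) (x \in e) * (#|e| == k).
have dE x : covered E x = d 2 x + 2 * d 3 x + 3 * d 4 x + 4 * d 5 x.
  by rewrite coveredE (sum_by_size (fun e => x \in e : nat) predn sizes) /= mul1n.
have sd k : \sum_x d k x = k * n k.
  rewrite /d (sum_incidence E (pred1 k)) /n big_distrr /=; apply: eq_bigr => e _.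
  by case: eqP => [->|]; rewrite ?muln1 ?mul1n ?muln0.
have def : \sum_x (m.-1 - covered E x) + \sum_x covered E x = m * m.-1.
  rewrite -big_split /= -sum_nat_const; apply: eq_bigr => x _; rewrite subnK //.
  exact: covered_le.
rewrite sum_covered cE in def.
exists (n 2), (n 3), (n 4), (n 5); split=> //; first lia.
  move=> q4; pose Q := [seq e : {set V} <- E | #|e| == 4].
  have sQ : size Q = n 4 by rewrite size_filter -sum_bool_count.
  rewrite -sQ; apply: (few_quads (Q := Q)); rewrite ?sQ //.
  - apply: linear_sub (codeg_le1 lin) => a; rewrite count_filter.
    by apply: sub_count => e /andP[].
  - exact: filter_all.
  have dQ x : count (fun e : {set V} => x \in e) Q = d 4 x.
    rewrite count_filter -sum_bool_count; apply: eq_bigr => e _ /=.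
    by case: (x \in e); case: (_ == 4).
  (* As m - 1 is even, a vertex on an odd number of K4s lies on a single edge or misses a neighbour;
     the slack allows at most two such incidences. *)
  apply: leq_trans (_ : \sum_x (d 2 x + (m.-1 - covered E x)) <= _); last first.
    by rewrite big_split /= sd; lia.
  rewrite -sum1_card [X in X <= _]big_mkcond; apply: leq_sum => x _; rewrite inE dQ.
  have := covered_le lin x; rewrite -/m dE; case: ifP => //; lia.
move=> n4 n2 tot.
have s2 : \sum_x (m.-1 - covered E x) = 2 by lia.
have d0 k x : n k = 0 -> d k x = 0.
  by move=> nk; have /eqP := sd k; rewrite nk muln0 sum_nat_eq0 => /forallP/(_ x)/eqP.
(* Without edges of size 2 or 4 every vertex misses an even number of neighbours. Both ends of an
   uncovered pair then miss at least two, which exceeds the total of 2. *)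
have gap x : covered E x < m.-1 -> 2 <= m.-1 - covered E x.
  by rewrite dE (d0 2) // (d0 4) //; lia.
have [x xm] : exists x, covered E x < m.-1.
  apply/existsP; apply: contraT; rewrite negb_exists => /forallP H.
  have : \sum_x (m.-1 - covered E x) = 0.
    by apply: big1 => x _; apply/eqP; rewrite subn_eq0 leqNgt.
  by rewrite s2.
have [y xy cxy] : exists2 y, x != y & codeg E x y = 0.
  have [/existsP[y /andP[xy /eqP e]]|] := boolP [exists y, (x != y) && (codeg E x y == 0)].
    by exists y.
  rewrite negb_exists => /forallP H; move: xm.
  rewrite /covered (eq_bigr (fun=> 1)) => [|y xy].
    by rewrite sum1_card card_neq ltnn.
  by apply/eqP; rewrite eqn_leq codeg_le1 // lt0n; have := H y; rewrite xy.
have ym : covered E y < m.-1.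
  have yx : y != x by rewrite eq_sym.
  rewrite /covered (bigD1 x) //= /codeg (eq_count (a2 := fun e : {set V} => (x \in e) && (y \in e))).
    rewrite -/(codeg E x y) cxy add0n -(card_neq y) -sum1_card [X in _ < X](bigD1 x) //= ltnS.
    by apply: leq_sum => z /andP[yz _]; exact: codeg_le1.
  by move=> e; rewrite andbC.
move: s2; rewrite (bigD1 x) //= (bigD1 y) /=; last by rewrite eq_sym.
have := gap x xm; have := gap y ym; lia.
Qed.

(** * Attaining the bounds *)

Lemma bin2_double m : 2 * 'C(m, 2) = m * m.-1.
Proof. by rewrite -mul_bin_diag bin1. Qed.

Lemma bin2_sq m : m * m = 2 * 'C(m, 2) + m.
Proof. by rewrite bin2_double; case: m => //= m; rewrite mulnSr. Qed.

Lemma bin2_12N N k : 'C(12 * N + k, 2) + 6 * N = 3 * (24 * (N * N) + 4 * k * N) + 'C(k, 2).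
Proof.
have := bin2_sq (12 * N + k); have := bin2_sq k.
move: 'C(_, 2) 'C(_, 2) => A B e1 e2.
have : (12 * N + k) * (12 * N + k) = 144 * (N * N) + 24 * (k * N) + k * k by lia.
lia.
Qed.

Lemma mod12_split m k : k <= 30 -> 12 * 2100 < m -> m %% 12 = k %% 12 ->
  exists2 N, 2000 <= N & m = 12 * N + k.
Proof.
move=> k30 m0 e; exists ((m - k) %/ 12); first lia.
have km : k <= m by lia.
have d : 12 %| m - k by rewrite -eqn_mod_dvd // e.
by rewrite mulnC divnK // subnK.
Qed.

(** * Even m, upper end of the range of n *)

(** Here 2 s is the number of incidences of vertices with even blocks beyond one per vertex, 2 p + 4
    q = m + 2 s. With 3 t + 6 q + p = C and t + q + p = n this gives 7 q = C - 3 n + m + 2 s, and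
    the bound is missed by exactly 2 s, which is less than 14. The hole and the [i] groups with four
    K4s account for the whole excess, and [j] groups trade K4s for pairs. *)
Lemma even_top_aux N k s q0 p0 i n (m := 12 * N + k) : 2000 <= N ->
  s <= 6 -> 2 * p0 + 4 * q0 + 4 * i = k + 2 * s -> k <= 30 -> i <= 3 -> p0 <= 5 ->
  p0 %% 3 = 'C(k, 2) %% 3 ->
  (forall j, i + j <= N -> exists t, is_full m t (q0 + 3 * (N - j) + i) (p0 + 6 * j) 0) ->
  3 * n < 'C(m, 2) -> 4 * 'C(m, 2) < 12 * n + 3 * m -> 7 %| 'C(m, 2) - 3 * n + m + 2 * s ->
  exists t q p, [/\ is_full m t q p 0, t + q + p = n
    & 3 * (m * m) + 24 * n < 14 * (3 * t + 4 * q + 2 * p) + 4 * m + 14].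
Proof.
move=> N2 s6 e0 k30 i3 p5 p3 H n1 n2 /dvdnP[q Hq].
have CE := bin2_12N N k; rewrite -/m in CE; have sq := bin2_sq m.
move: ('C(k, 2)) (24 * (N * N) + 4 * k * N) CE p3 => Ck X CE p3.
have mE : m = 12 * N + k by [].
pose p := (m + 2 * s - 4 * q) %/ 2.
have pE : 2 * p + 4 * q = m + 2 * s.
  (* This is where n > C / 3 - m / 4 enters: it keeps the number of pairs nonnegative. *)
  have : 4 * q <= m + 2 * s by lia.
  rewrite /p; lia.
pose j := (p - p0) %/ 6.
have pp : p0 + 6 * j = p by rewrite /j; lia.
have jN : i + j <= N by lia.
have [t Ht] := H j jN.
have edges := is_full_edges Ht.
exists t, (q0 + 3 * (N - j) + i), (p0 + 6 * j); split=> //; lia.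
Qed.
(** For c = 0 each of the seven values of [s] has its own hole. For c = 2 and c = 4 two holes
    realize 0 and 1, and each group with four K4s raises [s] by 2. *)
Lemma even_top m n : ~~ odd m -> 12 * 2100 < m ->
  3 * n < 'C(m, 2) -> 4 * 'C(m, 2) < 12 * n + 3 * m ->
  exists t q p, [/\ is_full m t q p 0, t + q + p = n
    & 3 * (m * m) + 24 * n < 14 * (3 * t + 4 * q + 2 * p) + 4 * m + 14].
Proof.
move=> om m0 n1 n2.
pose s := (3 * ('C(m, 2) - 3 * n + m)) %% 7.
have s6 : s < 7 by rewrite ltn_mod.
have s7 : 7 %| 'C(m, 2) - 3 * n + m + 2 * s by rewrite /s; lia.
have [r rE] : exists r, [&& r < 6 & m %% 12 == 2 * r] by exists ((m %% 12) %/ 2); lia.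
case/andP: rE => r6 /eqP rE.
case: r r6 rE => [|[|[|[|[|[|r]]]]]] // _ rE.
- have [|N N2 mE] := @mod12_split m 24 isT m0; first by rewrite rE.
  have F t q p i j := @full_pairs 0 12 2 N t q p i j _ 0 _ isT N2 isT.
  rewrite {}mE in n1 n2 s7 *; move: (s) s6 s7 => [|[|[|[|[|[|[|?]]]]]]] // _ s7.
  + by apply: (@even_top_aux N 24 0 6 0 0) => // j jN;
    apply: F (jN) fill_0_3_0 _ fill_0_0_6 full_24_6_0_0.
  + by apply: (@even_top_aux N 24 1 5 3 0) => // j jN;
    apply: F (jN) fill_0_3_0 _ fill_0_0_6 full_24_5_3_0.
  + by apply: (@even_top_aux N 24 2 7 0 0) => // j jN;
    apply: F (jN) fill_0_3_0 _ fill_0_0_6 full_24_7_0_0.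
  + by apply: (@even_top_aux N 24 3 6 3 0) => // j jN;
    apply: F (jN) fill_0_3_0 _ fill_0_0_6 full_24_6_3_0.
  + by apply: (@even_top_aux N 24 4 8 0 0) => // j jN;
    apply: F (jN) fill_0_3_0 _ fill_0_0_6 full_24_8_0_0.
  + by apply: (@even_top_aux N 24 5 7 3 0) => // j jN;
    apply: F (jN) fill_0_3_0 _ fill_0_0_6 full_24_7_3_0.
  + by apply: (@even_top_aux N 24 6 9 0 0) => // j jN;
    apply: F (jN) fill_0_3_0 _ fill_0_0_6 full_24_9_0_0.
- have [|N N2 mE] := @mod12_split m 14 isT m0; first by rewrite rE.
  have F t q p i j := @full_pairs 2 12 1 N t q p i j _ 22 _ isT N2 isT.
  rewrite {}mE in n1 n2 s7 *; move: (s) s6 s7 => [|[|[|[|[|[|[|?]]]]]]] // _ s7.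
  + by apply: (@even_top_aux N 14 0 3 1 0) => // j jN;
    apply: F (jN) fill_2_3_0 (fun _ => fill_2_4_0) fill_2_0_6 full_14_3_1_0.
  + by apply: (@even_top_aux N 14 1 2 4 0) => // j jN;
    apply: F (jN) fill_2_3_0 (fun _ => fill_2_4_0) fill_2_0_6 full_14_2_4_0.
  + by apply: (@even_top_aux N 14 2 3 1 1) => // j jN;
    apply: F (jN) fill_2_3_0 (fun _ => fill_2_4_0) fill_2_0_6 full_14_3_1_0.
  + by apply: (@even_top_aux N 14 3 2 4 1) => // j jN;
    apply: F (jN) fill_2_3_0 (fun _ => fill_2_4_0) fill_2_0_6 full_14_2_4_0.
  + by apply: (@even_top_aux N 14 4 3 1 2) => // j jN;
    apply: F (jN) fill_2_3_0 (fun _ => fill_2_4_0) fill_2_0_6 full_14_3_1_0.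
  + by apply: (@even_top_aux N 14 5 2 4 2) => // j jN;
    apply: F (jN) fill_2_3_0 (fun _ => fill_2_4_0) fill_2_0_6 full_14_2_4_0.
  + by apply: (@even_top_aux N 14 6 3 1 3) => // j jN;
    apply: F (jN) fill_2_3_0 (fun _ => fill_2_4_0) fill_2_0_6 full_14_3_1_0.
- have [|N N2 mE] := @mod12_split m 16 isT m0; first by rewrite rE.
  have F t q p i j := @full_pairs 4 12 1 N t q p i j _ 30 _ isT N2 isT.
  rewrite {}mE in n1 n2 s7 *; move: (s) s6 s7 => [|[|[|[|[|[|[|?]]]]]]] // _ s7.
  + by apply: (@even_top_aux N 16 0 4 0 0) => // j jN;
    apply: F (jN) fill_4_3_0 (fun _ => fill_4_4_0) fill_4_0_6 full_16_4_0_0.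
  + by apply: (@even_top_aux N 16 1 3 3 0) => // j jN;
    apply: F (jN) fill_4_3_0 (fun _ => fill_4_4_0) fill_4_0_6 full_16_3_3_0.
  + by apply: (@even_top_aux N 16 2 4 0 1) => // j jN;
    apply: F (jN) fill_4_3_0 (fun _ => fill_4_4_0) fill_4_0_6 full_16_4_0_0.
  + by apply: (@even_top_aux N 16 3 3 3 1) => // j jN;
    apply: F (jN) fill_4_3_0 (fun _ => fill_4_4_0) fill_4_0_6 full_16_3_3_0.
  + by apply: (@even_top_aux N 16 4 4 0 2) => // j jN;
    apply: F (jN) fill_4_3_0 (fun _ => fill_4_4_0) fill_4_0_6 full_16_4_0_0.
  + by apply: (@even_top_aux N 16 5 3 3 2) => // j jN;
    apply: F (jN) fill_4_3_0 (fun _ => fill_4_4_0) fill_4_0_6 full_16_3_3_0.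
  + by apply: (@even_top_aux N 16 6 4 0 3) => // j jN;
    apply: F (jN) fill_4_3_0 (fun _ => fill_4_4_0) fill_4_0_6 full_16_4_0_0.
- have [|N N2 mE] := @mod12_split m 18 isT m0; first by rewrite rE.
  have F t q p i j := @full_pairs 0 6 2 N t q p i j _ 0 _ isT N2 isT.
  rewrite {}mE in n1 n2 s7 *; move: (s) s6 s7 => [|[|[|[|[|[|[|?]]]]]]] // _ s7.
  + by apply: (@even_top_aux N 18 0 3 3 0) => // j jN;
    apply: F (jN) fill_0_3_0 _ fill_0_0_6 full_18_3_3_0.
  + by apply: (@even_top_aux N 18 1 5 0 0) => // j jN;
    apply: F (jN) fill_0_3_0 _ fill_0_0_6 full_18_5_0_0.
  + by apply: (@even_top_aux N 18 2 4 3 0) => // j jN;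
    apply: F (jN) fill_0_3_0 _ fill_0_0_6 full_18_4_3_0.
  + by apply: (@even_top_aux N 18 3 6 0 0) => // j jN;
    apply: F (jN) fill_0_3_0 _ fill_0_0_6 full_18_6_0_0.
  + by apply: (@even_top_aux N 18 4 5 3 0) => // j jN;
    apply: F (jN) fill_0_3_0 _ fill_0_0_6 full_18_5_3_0.
  + by apply: (@even_top_aux N 18 5 7 0 0) => // j jN;
    apply: F (jN) fill_0_3_0 _ fill_0_0_6 full_18_7_0_0.
  + by apply: (@even_top_aux N 18 6 6 3 0) => // j jN;
    apply: F (jN) fill_0_3_0 _ fill_0_0_6 full_18_6_3_0.
- have [|N N2 mE] := @mod12_split m 20 isT m0; first by rewrite rE.
  have F t q p i j := @full_pairs 2 6 2 N t q p i j _ 22 _ isT N2 isT.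
  rewrite {}mE in n1 n2 s7 *; move: (s) s6 s7 => [|[|[|[|[|[|[|?]]]]]]] // _ s7.
  + by apply: (@even_top_aux N 20 0 3 4 0) => // j jN;
    apply: F (jN) fill_2_3_0 (fun _ => fill_2_4_0) fill_2_0_6 full_20_3_4_0.
  + by apply: (@even_top_aux N 20 1 5 1 0) => // j jN;
    apply: F (jN) fill_2_3_0 (fun _ => fill_2_4_0) fill_2_0_6 full_20_5_1_0.
  + by apply: (@even_top_aux N 20 2 3 4 1) => // j jN;
    apply: F (jN) fill_2_3_0 (fun _ => fill_2_4_0) fill_2_0_6 full_20_3_4_0.
  + by apply: (@even_top_aux N 20 3 5 1 1) => // j jN;
    apply: F (jN) fill_2_3_0 (fun _ => fill_2_4_0) fill_2_0_6 full_20_5_1_0.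
  + by apply: (@even_top_aux N 20 4 3 4 2) => // j jN;
    apply: F (jN) fill_2_3_0 (fun _ => fill_2_4_0) fill_2_0_6 full_20_3_4_0.
  + by apply: (@even_top_aux N 20 5 5 1 2) => // j jN;
    apply: F (jN) fill_2_3_0 (fun _ => fill_2_4_0) fill_2_0_6 full_20_5_1_0.
  + by apply: (@even_top_aux N 20 6 3 4 3) => // j jN;
    apply: F (jN) fill_2_3_0 (fun _ => fill_2_4_0) fill_2_0_6 full_20_3_4_0.
- have [|N N2 mE] := @mod12_split m 10 isT m0; first by rewrite rE.
  have F t q p i j := @full_pairs 4 6 1 N t q p i j _ 30 _ isT N2 isT.
  rewrite {}mE in n1 n2 s7 *; move: (s) s6 s7 => [|[|[|[|[|[|[|?]]]]]]] // _ s7.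
  + by apply: (@even_top_aux N 10 0 1 3 0) => // j jN;
    apply: F (jN) fill_4_3_0 (fun _ => fill_4_4_0) fill_4_0_6 full_10_1_3_0.
  + by apply: (@even_top_aux N 10 1 3 0 0) => // j jN;
    apply: F (jN) fill_4_3_0 (fun _ => fill_4_4_0) fill_4_0_6 full_10_3_0_0.
  + by apply: (@even_top_aux N 10 2 1 3 1) => // j jN;
    apply: F (jN) fill_4_3_0 (fun _ => fill_4_4_0) fill_4_0_6 full_10_1_3_0.
  + by apply: (@even_top_aux N 10 3 3 0 1) => // j jN;
    apply: F (jN) fill_4_3_0 (fun _ => fill_4_4_0) fill_4_0_6 full_10_3_0_0.
  + by apply: (@even_top_aux N 10 4 1 3 2) => // j jN;
    apply: F (jN) fill_4_3_0 (fun _ => fill_4_4_0) fill_4_0_6 full_10_1_3_0.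
  + by apply: (@even_top_aux N 10 5 3 0 2) => // j jN;
    apply: F (jN) fill_4_3_0 (fun _ => fill_4_4_0) fill_4_0_6 full_10_3_0_0.
  + by apply: (@even_top_aux N 10 6 1 3 3) => // j jN;
    apply: F (jN) fill_4_3_0 (fun _ => fill_4_4_0) fill_4_0_6 full_10_1_3_0.
Qed.

(** * Even m, rest of the range of n *)

(** With p pairs one has C - 3 n = 3 q - 2 p and misses the sixfold bound by 2 p. Thus p = 0 serves
    when 3 divides C, and p = 1 when C = 1 modulo 3. The last hypothesis makes q large enough for
    the even blocks to meet every vertex. *)
Lemma even_mid m n : ~~ odd m -> 12 * 2100 < m ->
  'C(m, 2) + 2 * m + 240 <= 6 * n -> 3 * n < 'C(m, 2) -> 12 * n + 3 * m <= 4 * 'C(m, 2) ->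
  exists t q p, [/\ is_full m t q p 0, t + q + p = n
    & 2 * 'C(m, 2) + 12 * n < 6 * (3 * t + 4 * q + 2 * p) + 6].
Proof.
move=> om m0 n0 n1 n2.
have [r rE] : exists r, [&& r < 6 & m %% 12 == 2 * r] by exists ((m %% 12) %/ 2); lia.
case/andP: rE => r6 /eqP rE.
case: r r6 rE => [|[|[|[|[|[|r]]]]]] // _ rE.
- have [|N N2 mE] := @mod12_split m 24 isT m0; first by rewrite rE.
  have CE := bin2_12N N 24; rewrite -mE (_ : 'C(24, 2) = 276) // in CE.
  pose q := ('C(m, 2) - 3 * n) %/ 3; pose t := n - q.
  exists t, q, 0; split; rewrite ?/t ?/q; try lia.
  by rewrite mE; apply: full_mod0; rewrite -?mE; lia.
- have [|N N2 mE] := @mod12_split m 14 isT m0; first by rewrite rE.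
  have CE := bin2_12N N 14; rewrite -mE (_ : 'C(14, 2) = 91) // in CE.
  pose q := ('C(m, 2) + 2 - 3 * n) %/ 3; pose t := n - q - 1.
  exists t, q, 1; split; rewrite ?/t ?/q; try lia.
  by rewrite mE; apply: full_mod2; rewrite -?mE; lia.
- have [|N N2 mE] := @mod12_split m 16 isT m0; first by rewrite rE.
  have CE := bin2_12N N 16; rewrite -mE (_ : 'C(16, 2) = 120) // in CE.
  pose q := ('C(m, 2) - 3 * n) %/ 3; pose t := n - q.
  exists t, q, 0; split; rewrite ?/t ?/q; try lia.
  by rewrite mE; apply: full_mod4; rewrite -?mE; lia.
- have [|N N2 mE] := @mod12_split m 18 isT m0; first by rewrite rE.
  have CE := bin2_12N N 18; rewrite -mE (_ : 'C(18, 2) = 153) // in CE.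
  pose q := ('C(m, 2) - 3 * n) %/ 3; pose t := n - q.
  exists t, q, 0; split; rewrite ?/t ?/q; try lia.
  by rewrite mE; apply: full_mod6; rewrite -?mE; lia.
- have [|N N2 mE] := @mod12_split m 20 isT m0; first by rewrite rE.
  have CE := bin2_12N N 20; rewrite -mE (_ : 'C(20, 2) = 190) // in CE.
  pose q := ('C(m, 2) + 2 - 3 * n) %/ 3; pose t := n - q - 1.
  exists t, q, 1; split; rewrite ?/t ?/q; try lia.
  by rewrite mE; apply: full_mod8; rewrite -?mE; lia.
- have [|N N2 mE] := @mod12_split m 10 isT m0; first by rewrite rE.
  have CE := bin2_12N N 10; rewrite -mE (_ : 'C(10, 2) = 45) // in CE.
  pose q := ('C(m, 2) - 3 * n) %/ 3; pose t := n - q.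
  exists t, q, 0; split; rewrite ?/t ?/q; try lia.
  by rewrite mE; apply: full_mod10; rewrite -?mE; lia.
Qed.

(** * Odd m: decompositions for the general and the exceptional values of n *)

Lemma odd_mid13 m n r : (m %% 12) \in [:: 1; 3; 7; 9] -> 12 * 2100 < m ->
  'C(m, 2) + 2 * m + 240 <= 6 * n -> 'C(m, 2) = 3 * (n + r) -> 5 <= r ->
  exists t, is_full m t r 0 0.
Proof.
move=> mr m0 n0 CE r5; exists (n - r).
have tb : 2 * m + 235 <= 3 * (n - r) by lia.
have e : 3 * (n - r) + 6 * r + 0 = 'C(m, 2) by lia.
move: mr; rewrite !inE => /or4P[]/eqP rE.
- have [|N N2 mE] := @mod12_split m 25 isT m0; first by rewrite rE.
  by rewrite mE in e tb *; exact: full_mod1.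
- have [|N N2 mE] := @mod12_split m 27 isT m0; first by rewrite rE.
  by rewrite mE in e tb *; exact: full_mod3.
- have [|N N2 mE] := @mod12_split m 19 isT m0; first by rewrite rE.
  by rewrite mE in e tb *; exact: full_mod7.
- have [|N N2 mE] := @mod12_split m 21 isT m0; first by rewrite rE.
  by rewrite mE in e tb *; exact: full_mod9.
Qed.

Lemma odd_small13 m : (m %% 12) \in [:: 1; 3; 7; 9] -> 12 * 2100 < m ->
  (exists t, is_full m t 0 0 0) /\ (exists t, is_full m t 4 3 0).
Proof.
move=> mr m0; move: mr; rewrite !inE => /or4P[]/eqP rE.
- have [|N N2 ->] := @mod12_split m 25 isT m0; first by rewrite rE.
  by split; [exact: (@full_of_hole 1 12 2 N _ _ _ _ _ isT N2 isT fill_1_0_0 full_25_0_0_0)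
            | exact: (@full_of_hole 1 12 2 N _ _ _ _ _ isT N2 isT fill_1_0_0 full_25_4_3_0)].
- have [|N N2 ->] := @mod12_split m 27 isT m0; first by rewrite rE.
  by split; [exact: (@full_of_hole 3 12 2 N _ _ _ _ _ isT N2 isT fill_3_0_0 full_27_0_0_0)
            | exact: (@full_of_hole 3 12 2 N _ _ _ _ _ isT N2 isT fill_3_0_0 full_27_4_3_0)].
- have [|N N2 ->] := @mod12_split m 19 isT m0; first by rewrite rE.
  by split; [exact: (@full_of_hole 1 6 2 N _ _ _ _ _ isT N2 isT fill_1_0_0 full_19_0_0_0)
            | exact: (@full_of_hole 1 6 2 N _ _ _ _ _ isT N2 isT fill_1_0_0 full_19_4_3_0)].
- have [|N N2 ->] := @mod12_split m 21 isT m0; first by rewrite rE.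
  by split; [exact: (@full_of_hole 3 6 2 N _ _ _ _ _ isT N2 isT fill_3_0_0 full_21_0_0_0)
            | exact: (@full_of_hole 3 6 2 N _ _ _ _ _ isT N2 isT fill_3_0_0 full_21_4_3_0)].
Qed.

Lemma odd_mid5 m n r : (m %% 12) \in [:: 5; 11] -> 12 * 2100 < m ->
  'C(m, 2) + 2 * m + 240 <= 6 * n -> 'C(m, 2) = 3 * (n + r) + 1 -> 4 <= r ->
  exists t, is_full m t r.+1 1 0.
Proof.
move=> mr m0 n0 CE r5; exists (n - r - 2).
have tb : 2 * m + 235 <= 3 * (n - r - 2) by lia.
have e : 3 * (n - r - 2) + 6 * r.+1 + 1 = 'C(m, 2) by lia.
move: mr; rewrite !inE => /orP[]/eqP rE.
- have [|N N2 mE] := @mod12_split m 17 isT m0; first by rewrite rE.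
  by rewrite mE in e tb *; apply: full_mod5.
- have [|N N2 mE] := @mod12_split m 23 isT m0; first by rewrite rE.
  by rewrite mE in e tb *; apply: full_mod11.
Qed.

Lemma odd_small5 m : (m %% 12) \in [:: 5; 11] -> 12 * 2100 < m ->
  (exists t, is_full m t 0 0 1) /\ (exists t, is_full m t 0 4 0).
Proof.
move=> mr m0; move: mr; rewrite !inE => /orP[]/eqP rE.
- have [|N N2 ->] := @mod12_split m 17 isT m0; first by rewrite rE.
  by split; [exact: (@full_of_hole 1 4 2 N _ _ _ _ _ isT N2 isT fill_1_0_0 full_17_0_0_1)
            | exact: (@full_of_hole 1 4 2 N _ _ _ _ _ isT N2 isT fill_1_0_0 full_17_0_4_0)].
- have [|N N2 ->] := @mod12_split m 23 isT m0; first by rewrite rE.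
  by split; [exact: (@full_of_hole 1 10 2 N _ _ _ _ _ isT N2 isT fill_1_0_0 full_23_0_0_1)
            | exact: (@full_of_hole 1 10 2 N _ _ _ _ _ isT N2 isT fill_1_0_0 full_23_0_4_0)].
Qed.

(** * The Zarankiewicz numbers *)

Lemma Z22_le m n : 0 < m -> 6 * Z22 m n <= 2 * 'C(m, 2) + 12 * n.
Proof.
move=> m0; have [E [sE hE lE <-]] := Z22_attained n m0.
by have := total_le lE; rewrite card_ord sE bin2_double.
Qed.

Lemma Z22_le_even m n : 0 < m -> ~~ odd m ->
  14 * Z22 m n + 4 * m <= 3 * (m * m) + 24 * n.
Proof.
move=> m0 om; have [E [sE hE lE <-]] := Z22_attained n m0.
by have := total_le_even lE; rewrite card_ord sE; apply.
Qed.

Lemma Z22_ge m n t q p f t' q' p' f' : is_full m t q p f ->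
  t' <= t -> q' <= q -> p' <= p -> f' <= f -> t' + q' + p' + f' = n ->
  3 * t' + 4 * q' + 2 * p' + 5 * f' <= Z22 m n.
Proof. by move=> H ? ? ? ? <-; apply: Z22_ge_full H _ _ _ _. Qed.

(** This value would leave no slack at all, so that only triangles and K4s occur, with exactly [r]
    K4s, contrary to parity. *)
Lemma Z22_neq13 m n r : odd m -> 'C(m, 2) = 3 * (n + r) -> 1 <= r <= 4 ->
  Z22 m n <> n + r + 2 * n.
Proof.
move=> om CE r4 ZE; have m0 : 0 < m by case: (m) om.
have [E [sE hE lE tE]] := Z22_attained n m0.
have C2 := bin2_double m.
have := tight_odd lE; rewrite card_ord sE tE ZE => /(_ om)[|e2 [e3 [e4 [e5]]]]; first lia.
case=> nE totE cE q4 _; have e4r : e4 = r by lia.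
have : e4 = 0 by apply: q4; lia.
lia.
Qed.

(** The slack of 2 goes to one single edge, one K5 or one uncovered pair, and the number of K4s is
    then r + 1, r - 2 or r. For the listed r each of these is negative or between 1 and 4, except
    for r = 0 with an uncovered pair, which the last clause of [tight_odd] excludes. *)
Lemma Z22_neq5 m n r : odd m -> 'C(m, 2) = 3 * (n + r) + 1 -> r \in [:: 0; 1; 3] ->
  Z22 m n <> n + r + 2 * n.
Proof.
move=> om CE r3 ZE; have m0 : 0 < m by case: (m) om.
have r3' : [|| r == 0, r == 1 | r == 3] by move: r3; rewrite !inE.
have [E [sE hE lE tE]] := Z22_attained n m0.
have C2 := bin2_double m.
have := tight_odd lE; rewrite card_ord sE tE ZE => /(_ om)[|e2 [e3 [e4 [e5]]]]; first lia.
case=> nE totE cE q4 d2.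
have e4E : e4 + 2 * e5 = r + e2 by lia.
have e40 : e4 = 0 by apply: q4; lia.
have e20 : e2 = 0 by lia.
have := d2 e40 e20; lia.
Qed.

Definition exceptional (m n : nat) : bool :=
  has (fun r => n + r == 'C(m, 2) %/ 3) (excS m).

Lemma Z22_odd m n : odd m -> 12 * 2100 < m ->
  'C(m, 2) + 2 * m + 240 <= 6 * n -> 3 * n < 'C(m, 2) ->
  6 * (Z22 m n + exceptional m n) <= 2 * 'C(m, 2) + 12 * n
    < 6 * (Z22 m n + exceptional m n) + 6.
Proof.
move=> om m0 n0 n1; have ub := @Z22_le m n (ltn_trans (ltn0Sn _) m0).
have CN k N : m = 12 * N + k -> 'C(m, 2) %% 3 = 'C(k, 2) %% 3.
  by move=> ->; have := bin2_12N N k; lia.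
have mE : m = 12 * (m %/ 12) + m %% 12 by rewrite mulnC -divn_eq.
have m6 : m %% 6 = (m %% 12) %% 6 by rewrite modn_dvdm.
have [mr|mr] := boolP ((m %% 12) \in [:: 1; 3; 7; 9]).
  have [r CE] : exists r, 'C(m, 2) = 3 * (n + r).
    exists ('C(m, 2) %/ 3 - n); have := CN _ _ mE.
    by move: mr; rewrite !inE => /or4P[]/eqP-> /=; rewrite -?[X in _ = X]/0; lia.
  have r1 : 1 <= r by lia.
  have -> : exceptional m n = (r <= 4).
    rewrite /exceptional /excS m6 CE mulKn //.
    move: mr; rewrite !inE => /or4P[]/eqP-> /=; rewrite !eqn_add2l; lia.
  have [r4|r4] := leqP r 4; last first.
    have [t Ht] := odd_mid13 mr m0 n0 CE r4.
    have e := is_full_edges Ht.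
    have := @Z22_ge m n _ _ _ _ t r 0 0 Ht (leqnn _) (leqnn _) (leqnn _) (leqnn _); lia.
  have ne := Z22_neq13 om CE (introT andP (conj r1 r4)).
  have [[t0 H0] [t4 H4]] := odd_small13 mr m0.
  have e0 := is_full_edges H0; have e4 := is_full_edges H4.
  (* For r = 1 a Steiner triple system has n + 1 triangles and one is dropped. For r = 2, 3, 4 the
     decomposition with four K4s and three pairs has n + r - 9 triangles, and 5 - r of the pairs
     complete n edges. *)
  have [r1'|r2] := eqVneq r 1.
    have := @Z22_ge m n _ _ _ _ n 0 0 0 H0; lia.
  have := @Z22_ge m n _ _ _ _ t4 4 (5 - r) 0 H4; lia.
have {}mr : (m %% 12) \in [:: 5; 11].
  have : odd (m %% 12) by rewrite mE oddD oddM /= in om.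
  have := ltn_pmod m (isT : 0 < 12).
  by move: mr; move: (m %% 12); do 12! [case=> //].
have [r CE] : exists r, 'C(m, 2) = 3 * (n + r) + 1.
  exists ('C(m, 2) %/ 3 - n); have := CN _ _ mE.
  by move: mr; rewrite !inE => /orP[]/eqP-> /=; rewrite -?[X in _ = X]/1; lia.
have -> : exceptional m n = (r \in [:: 0; 1; 3]).
  rewrite /exceptional /excS m6 CE (_ : (3 * (n + r) + 1) %/ 3 = n + r); last lia.
  by move: mr; rewrite !inE => /orP[]/eqP-> /=; rewrite !eqn_add2l orbF ![_ == r]eq_sym.
have [[t5 H5] [t4 H4]] := odd_small5 mr m0.
have e5 := is_full_edges H5; have e4 := is_full_edges H4.
have [r3|r3] := boolP (r \in [:: 0; 1; 3]).
  have ne := Z22_neq5 om CE r3.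
  (* For r = 0 the decomposition with four pairs has n - 1 triangles, and one pair is kept. For r =
     1 it has n triangles, and no pair is kept. For r = 3 the decomposition with a K5 has n
     triangles, and one is dropped. Each misses the bound by one. *)
  move: r3; rewrite !inE => /or3P[]/eqP rE; rewrite rE in CE ne.
  - have := @Z22_ge m n _ _ _ _ (n - 1) 0 1 0 H4; lia.
  - have := @Z22_ge m n _ _ _ _ n 0 0 0 H4; lia.
  - have := @Z22_ge m n _ _ _ _ (n - 1) 0 0 1 H5; lia.
(* Here n - 1 triangles and the K5 attain the bound, which is why 2 is not in S. *)
have [r2|r2] := eqVneq r 2.
  have := @Z22_ge m n _ _ _ _ (n - 1) 0 0 1 H5; lia.
have r4 : 4 <= r by move: r3; rewrite !inE; lia.
have [t Ht] := odd_mid5 mr m0 n0 CE r4.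
have e := is_full_edges Ht.
have := @Z22_ge m n _ _ _ _ t r.+1 1 0 Ht; lia.
Qed.

Lemma Z22_even_top m n : ~~ odd m -> 12 * 2100 < m ->
  3 * n < 'C(m, 2) -> 4 * 'C(m, 2) < 12 * n + 3 * m ->
  14 * Z22 m n + 4 * m <= 3 * (m * m) + 24 * n < 14 * Z22 m n + 4 * m + 14.
Proof.
move=> om m0 n1 n2; rewrite Z22_le_even //; last exact: leq_ltn_trans m0.
have [t [q [p [H e lt]]]] := even_top om m0 n1 n2.
have := @Z22_ge m n _ _ _ _ t q p 0 H; lia.
Qed.

Lemma Z22_even_mid m n : ~~ odd m -> 12 * 2100 < m ->
  'C(m, 2) + 2 * m + 240 <= 6 * n -> 3 * n < 'C(m, 2) -> 12 * n + 3 * m <= 4 * 'C(m, 2) ->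
  6 * Z22 m n <= 2 * 'C(m, 2) + 12 * n < 6 * Z22 m n + 6.
Proof.
move=> om m0 n0 n1 n2; rewrite Z22_le //; last exact: leq_ltn_trans m0.
have [t [q [p [H e lt]]]] := even_mid om m0 n0 n1 n2.
have := @Z22_ge m n _ _ _ _ t q p 0 H; lia.
Qed.

(** * Passage to floors of rational numbers *)

Import Order.TTheory GRing.Theory Num.Theory.
Local Open Scope ring_scope.

Lemma floor_frac (x : rat) (a b z : nat) : (0 < b)%N -> x = a%:R / b%:R ->
  (b * z <= a < b * z + b)%N -> Num.floor x = z%:Z.
Proof.
move=> b0 -> /andP[za az]; have b0' : 0 < b%:R :> rat by rewrite ltr0n.
apply: floor_def; rewrite -[(z%:Z + 1)%R]/((z + 1)%N%:Z) -!pmulrn.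
rewrite ler_pdivlMr // ltr_pdivrMr // -!natrM ler_nat ltr_nat.
by rewrite mulnC za mulnC mulnDr muln1.
Qed.

Theorem theorem1p2 :
  exists m0 : nat, (0 < m0)%N /\
    forall m n : nat, (m0 < m)%N ->
      'C(m, 2)%:R / 6 + m%:R / 3 + 40 <= n%:R :> rat ->
      n%:R < 'C(m, 2)%:R / 3 :> rat ->
      (Z22 m n)%:Z =
        if ~~ odd m && (Num.floor ('C(m, 2)%:R / 3 - m%:R / 4 : rat) < n%:Z) then
          Num.floor (m%:R * (3 * m%:R - 4) / 14 + 12 / 7 * n%:R : rat)
        else if odd m &&
          has (fun r : nat => n%:Z == Num.floor ('C(m, 2)%:R / 3 : rat) - r%:Z)
              (excS m) then
          Num.floor (m%:R * (m%:R - 1) / 6 + 2 * n%:R : rat) - 1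
        else
          Num.floor (m%:R * (m%:R - 1) / 6 + 2 * n%:R : rat).
Proof.
(* After removal of a hole of at most 30 points at least 2000 groups of size 12 remain, more than
   the 1221 for which pairwise balanced designs with a hole are available. *)
exists (12 * 2100)%N; split=> // m n m0 h1 h2.
set C := 'C(m, 2) in h1 h2 *.
have n0 : (C + 2 * m + 240 <= 6 * n)%N.
  have e : (C + 2 * m + 240)%N%:R = C%:R + 2 * m%:R + 240 :> rat by rewrite -natrM -!natrD.
  have e' : (6 * n)%N%:R = 6 * n%:R :> rat by rewrite -natrM.
  by rewrite -(ler_nat rat) e e'; lra.
have n1 : (3 * n < C)%N.
  have e : (3 * n)%N%:R = 3 * n%:R :> rat by rewrite -natrM.
  by rewrite -(ltr_nat rat) e; lra.
have sq : m%:R * m%:R = 2 * C%:R + m%:R :> rat.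
  by rewrite -!natrM -natrD -bin2_sq.
have -> : Num.floor (C%:R / 3 : rat) = (C %/ 3)%N%:Z.
  apply: (@floor_frac _ C 3) => //; rewrite [(3 * _)%N]mulnC leq_trunc_div /=.
  by rewrite -mulSnr ltn_ceil.
have excE : has (fun r : nat => n%:Z == (C %/ 3)%N%:Z - r%:Z) (excS m) = exceptional m n.
  apply: eq_has => r; rewrite eq_sym subr_eq eq_sym -PoszD.
  by [].
rewrite {}excE.
have xE : m%:R * (m%:R - 1) / 6 + 2 * n%:R = (2 * C + 12 * n)%N%:R / 6%:R :> rat.
  have -> : (2 * C + 12 * n)%N%:R = 2 * C%:R + 12 * n%:R :> rat by rewrite -!natrM -natrD.
  by lra.
have [om|om] /= := boolP (odd m).
  have := Z22_odd om m0 n0 n1 => /(floor_frac _ xE) -> //.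
  by case: (exceptional m n); rewrite ?addn0 // PoszD addrK.
have topE : (Num.floor (C%:R / 3 - m%:R / 4 : rat) < n%:Z) = (4 * C < 12 * n + 3 * m)%N.
  have e : (12 * n + 3 * m)%N%:R = 12 * n%:R + 3 * m%:R :> rat by rewrite -!natrM -natrD.
  have e' : (4 * C)%N%:R = 4 * C%:R :> rat by rewrite -natrM.
  by rewrite floor_lt_int -pmulrn -(ltr_nat rat) e e'; apply/idP/idP => H; lra.
rewrite topE; case: ifP => [top|/negbT]; last first.
  rewrite -leqNgt => mid; have := Z22_even_mid om m0 n0 n1 mid.
  by move=> /(floor_frac _ xE) -> //.
have := Z22_even_top om m0 n1 top => /andP[z1 z2].
rewrite (@floor_frac _ (3 * (m * m) + 24 * n - 4 * m) 14 (Z22 m n)) //.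
  rewrite natrB; last by apply: leq_trans z1; rewrite leq_addl.
  have -> : (3 * (m * m) + 24 * n)%N%:R = 3 * (m%:R * m%:R) + 24 * n%:R :> rat.
    by rewrite -!natrM -natrD.
  have -> : (4 * m)%N%:R = 4 * m%:R :> rat by rewrite -natrM.
  by lra.
apply/andP; split; lia.
Qed.
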